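(* Let $\mathfrak g(\mathcal A)$ be an indecomposable type Q Kac--Moody (QKM) algebra of finite growth. Then $\mathcal A$ is either completely $X$-coupled, or completely $Y$-coupled, or completely uncoupled.
   Context: Everything is over $\mathbb C$; $\bar v$ is the parity of a homogeneous $v$. **Quasi-toral algebras.** A finite-dimensional Lie superalgebra $\mathfrak h$ is quasi-toral if $[\mathfrak h_{\bar 0},\mathfrak h]=0$; put $\mathfrak t=\mathfrak h_{\bar 0}$. All $\mathfrak h$-modules considered are finite-dimensional with $\mathfrak t$ acting semisimply. For $\lambda\in\mathfrak t^*$, $\operatorname{rk}\lambda$ is the rank of the symmetric form $(x,y)\mapsto\lambda([x,y])$ on $\mathfrak h_{\bar 1}$. Let $\omega_{\mathfrak h}$ be the automorphism of $\mathfrak h$ equal to $-1$ on $\mathfrak h_{\bar 0}$ and $\sqrt{-1}$ on $\mathfrak h_{\bar 1}$. For an $\mathfrak h$-module $V$, $V^\vee=\{v^\vee: v\in V\}$ is the same superspace with action $x\cdot v^\vee=(\omega_{\mathfrak h}^{-1}(x)v)^\vee$. **Cartan datum.** A Cartan datum $\mathcal A$ consists of: a finite-dimensional quasi-toral $\mathfrak h$; a linearly independent set $\Pi=\{\alpha_1,\dots,\alpha_n\}\subseteq\mathfrak t^*$ (simple roots); for each $\alpha\in\pm\Pi$ an $\mathfrak h$-module $\mathfrak g_\alpha$ on which $\mathfrak t$ acts by $\alpha$; for each $\alpha\in\Pi$ an $\mathfrak h$-module morphism $[-,-]_\alpha:\mathfrak g_\alpha\otimes\mathfrak g_{-\alpha}\to\mathfrak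 h$ which is nondegenerate (nonzero on $U\otimes\mathfrak g_{-\alpha}$ and on $\mathfrak g_\alpha\otimes U'$ for all nonzero submodules $U,U'$). $\tilde{\mathfrak g}(\mathcal A)$ is the Lie superalgebra generated by $\bigoplus_i\mathfrak g_{-\alpha_i}\oplus\mathfrak h\oplus\bigoplus_i\mathfrak g_{\alpha_i}$ with relations: brackets inside $\mathfrak h$ are those of $\mathfrak h$; $[h,x]=h\cdot x$ for $h\in\mathfrak h$, $x\in\mathfrak g_{\pm\alpha_i}$; $[x,y]=\delta_{\alpha\beta}[x,y]_\alpha$ for $x\in\mathfrak g_\alpha$, $y\in\mathfrak g_{-\beta}$, $\alpha,\beta\in\Pi$. $\mathfrak g(\mathcal A)$ is the quotient of $\tilde{\mathfrak g}(\mathcal A)$ by its unique maximal ideal meeting $\mathfrak h$ trivially. Put $\mathfrak h_\alpha=[\mathfrak g_\alpha,\mathfrak g_{-\alpha}]\subseteq\mathfrak h$; $\mathfrak g\langle\alpha\rangle$ is the subalgebra generated by $\mathfrak g_{\alpha}$ and $\mathfrak g_{-\alpha}$. **QKM.** $\mathfrak g(\mathcal A)$ (or $\mathcal A$) is QKM if: (KM1) for all $\alpha,\beta\in\pm\Pi$ one has $(\operatorname{ad}\mathfrak g_\alpha)^N\mathfrak g_\beta=0$ for some $N$ when computed in $\mathfrak g(\mathcal A)$ (integrability; for $\beta=-\alpha$ likewise); (KM2) for $\alpha,\beta\in\Pi$, $[\mathfrak h_\alpha,\mathfrak g_\beta]=0$ implies $[\mathfrak h_\beta,\mathfrak g_\alpha]=0$;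 (KM3) $\operatorname{rk}\alpha=2$ for all $\alpha\in\Pi$; (KM4) each $\mathfrak g_\alpha$, $\alpha\in\Pi$, is irreducible and $\mathfrak g_{-\alpha}\simeq\mathfrak g_\alpha^\vee$; (KM5) $\mathfrak h_\alpha\not\subseteq\sum_{\beta\in\Pi\setminus\{\alpha\}}\mathfrak h_\beta$ for all $\alpha\in\Pi$. It is indecomposable if there is no nontrivial partition $\Pi=\Pi_1\sqcup\Pi_2$ with $[\mathfrak h_\alpha,\mathfrak g_\beta]=[\mathfrak h_\beta,\mathfrak g_\alpha]=0$ for all $\alpha\in\Pi_1,\beta\in\Pi_2$. **Types.** For $\mathfrak s=\mathfrak{sl}(2),\mathfrak{osp}(1|2),\mathfrak{sl}(1|1)$ with supertrace form $(-,-)$, $\mathfrak{ts}=\mathfrak s\otimes\mathbb C[\xi]\oplus\mathbb C c$ with $\xi$ odd, $\xi^2=0$, $c$ even central, and $[x\otimes p,y\otimes q]=(-1)^{\bar p\bar y}[x,y]\otimes pq+(-1)^{\bar y}(x,y)\operatorname{Res}(p'q)c$, where $p'=\partial_\xi p$, $\operatorname{Res}(a+b\xi)=b$. In a QKM algebra each simple root $\alpha$ has exactly one type $Tak(\mathfrak s)$: $\mathfrak g\langle\alpha\rangle$ is a quotient of $\mathfrak{ts}$ by a central ideal contained in $\mathbb C c$. **Generators.** Each $\mathfrak g_{\alpha_i}$ is $(1|1)$-dimensional; identify $\mathfrak g_{-\alpha_i}=\mathfrak g_{\alpha_i}^\vee$. If $\alpha_i$ has type $Tak(\mathfrak{sl}(2))$: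 $e_i$ even, $E_i$ odd nonzero in $\mathfrak g_{\alpha_i}$, $f_i=e_i^\vee$, $F_i=\sqrt{-1}E_i^\vee$, scaled so $\alpha_i([e_i,f_i])=2$. If $\alpha_i$ has type $Tak(\mathfrak{osp}(1|2))$ or $Tak(\mathfrak{sl}(1|1))$: $E_i$ even, $e_i$ odd, $f_i=\sqrt{-1}e_i^\vee$, $F_i=E_i^\vee$, scaled in the $\mathfrak{osp}(1|2)$ case so $\alpha_i([e_i,f_i])=1$. Put $h_i=[e_i,f_i]$, $c_i=[E_i,F_i]$, $H_i=[E_i,f_i]=[e_i,F_i]$. Matrices $X=(x_{ij})$, $Y=(y_{ij})$ are defined by $[H_i,e_j]=x_{ij}E_j$, $[H_i,E_j]=y_{ij}e_j$. **Coupling.** Distinct simple roots $\alpha_i,\alpha_j$ are connected if $\alpha_i(h_j)\alpha_j(h_i)\ne0$, and coupled if they are connected and $\alpha_i(c_j)=\alpha_j(c_i)=0$. $\mathcal A$ is completely $X$-coupled if $x_{ij}=0$ for all $i\neq j$; completely $Y$-coupled if $Y=0$; completely uncoupled if any two distinct connected simple roots are not coupled. **Growth.** $\mathfrak g(\mathcal A)$ is $\mathbb Z$-graded with $\mathfrak h$ in degree $0$ and $\mathfrak g_{\pm\alpha_i}$ in degree $\pm1$; it has finite growth if $\dim$ of the degree-$j$ part is bounded by a polynomial in $|j|$. *)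

(* Defs.v *)
From HB Require Import structures.
From mathcomp Require Import all_boot all_order all_algebra.
From mathcomp Require Import generic_quotient ring.
From mathcomp Require Import boolp reals.
From mathcomp Require Export complex.

Set Implicit Arguments.
Unset Strict Implicit.
Unset Printing Implicit Defensive.

Import GRing.Theory Num.Theory.
Local Open Scope quotient_scope.
Local Open Scope ring_scope.

(* Parities are booleans: [false] is even, [true] is odd, [(+)] is addition in
   Z/2 and [(-1) ^+ (p && q)] is the sign (-1)^(pq).  A superspace is given by
   the projections [part p] onto its two homogeneous components; [v] is
   homogeneous of parity [p] iff [part p v = v], and a subspace is graded iff
   it is stable under both projections. *)
HB.mixin Record isSuperspace (C : fieldType) V of GRing.Lmodule C V := {
  part : bool -> V -> V;
  part_linear : forall p, linear (part p);
  part_sum : forall v, part false v + part true v = v;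
  part_part : forall p q v, part p (part q v) = if p == q then part q v else 0
}.

#[short(type="superspaceType")]
HB.structure Definition Superspace (C : fieldType) :=
  {V of GRing.Lmodule C V & isSuperspace C V}.

#[short(type="finSuperspaceType")]
HB.structure Definition FinSuperspace (C : fieldType) :=
  {V of Vector C V & isSuperspace C V}.

HB.mixin Record isLieSuper (C : fieldType) V of Superspace C V := {
  brk : V -> V -> V;
  brk_linearl : forall y, linear (brk^~ y);
  brk_linearr : forall x, linear (brk x);
  brk_even : forall p q x y,
    part (p (+) q) (brk (part p x) (part q y)) = brk (part p x) (part q y);
  brk_skew : forall p q x y,
    brk (part p x) (part q y)
    = - ((-1) ^+ (p && q) *: brk (part q y) (part p x));
  brk_jacobi : forall p q x y z,
    brk (part p x) (brk (part q y) z)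
    = brk (brk (part p x) (part q y)) z
      + (-1) ^+ (p && q) *: brk (part q y) (brk (part p x) z)
}.

#[short(type="lieSuperType")]
HB.structure Definition LieSuper (C : fieldType) :=
  {V of Superspace C V & isLieSuper C V}.

#[short(type="finLieSuperType")]
HB.structure Definition FinLieSuper (C : fieldType) :=
  {V of FinSuperspace C V & LieSuper C V}.

Arguments part {C s} p v : rename, simpl never.
Arguments brk {C s} x y : rename, simpl never.

HB.instance Definition _ (C : fieldType) (V : superspaceType C) p :=
  GRing.isLinear.Build C V V *:%R (@part C V p) (@part_linear C V p).

HB.instance Definition _ (C : fieldType) (V : lieSuperType C) (x : V) :=
  GRing.isLinear.Build C V V *:%R (@brk C V x) (@brk_linearr C V x).

Lemma partD (C : fieldType) (V : superspaceType C) p (x y : V) :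
  part p (x + y) = part p x + part p y.
Proof. exact: linearD. Qed.
Lemma partB (C : fieldType) (V : superspaceType C) p (x y : V) :
  part p (x - y) = part p x - part p y.
Proof. exact: linearB. Qed.
Lemma partZ (C : fieldType) (V : superspaceType C) p a (x : V) :
  part p (a *: x) = a *: part p x.
Proof. exact: linearZ. Qed.

Section BrkTheory.
Variables (C : fieldType) (V : lieSuperType C).
Implicit Types x y z : V.

Lemma brkDl x y z : brk (x + y) z = brk x z + brk y z.
Proof. by have := @brk_linearl C V z 1 x y; rewrite !scale1r. Qed.

Lemma brk0l z : brk 0 z = 0.
Proof. by apply: (addrI (brk 0 z)); rewrite -brkDl !addr0. Qed.

Lemma brkZl a x z : brk (a *: x) z = a *: brk x z.
Proof. by have := @brk_linearl C V z a x 0; rewrite /= !addr0 brk0l addr0. Qed.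

Lemma brkDr x y z : brk x (y + z) = brk x y + brk x z.
Proof. exact: linearD. Qed.

Lemma brkZr a x y : brk x (a *: y) = a *: brk x y.
Proof. exact: linearZ. Qed.

Lemma brkBl x y z : brk (x - y) z = brk x z - brk y z.
Proof. by rewrite brkDl -scaleN1r brkZl scaleN1r. Qed.

End BrkTheory.

(* Lie superalgebras up to an equivalence relation, and their quotients; used
   both for presentations by generators and relations and for quotients by
   graded ideals. *)
Record lieSetoid (C : fieldType) := LieSetoid {
  ls_car : Type;
  ls_eq : ls_car -> ls_car -> Prop;
  ls0 : ls_car;
  ls_add : ls_car -> ls_car -> ls_car;
  ls_opp : ls_car -> ls_car;
  ls_scale : C -> ls_car -> ls_car;
  ls_part : bool -> ls_car -> ls_car;
  ls_brk : ls_car -> ls_car -> ls_car;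
  ls_refl : forall x, ls_eq x x;
  ls_sym : forall x y, ls_eq x y -> ls_eq y x;
  ls_trans : forall x y z, ls_eq x y -> ls_eq y z -> ls_eq x z;
  ls_add_compat : forall x x' y y',
    ls_eq x x' -> ls_eq y y' -> ls_eq (ls_add x y) (ls_add x' y');
  ls_opp_compat : forall x x', ls_eq x x' -> ls_eq (ls_opp x) (ls_opp x');
  ls_scale_compat : forall a x x',
    ls_eq x x' -> ls_eq (ls_scale a x) (ls_scale a x');
  ls_part_compat : forall p x x',
    ls_eq x x' -> ls_eq (ls_part p x) (ls_part p x');
  ls_brk_compat : forall x x' y y',
    ls_eq x x' -> ls_eq y y' -> ls_eq (ls_brk x y) (ls_brk x' y');
  ls_addA : forall x y z,
    ls_eq (ls_add x (ls_add y z)) (ls_add (ls_add x y) z);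
  ls_addC : forall x y, ls_eq (ls_add x y) (ls_add y x);
  ls_add0 : forall x, ls_eq (ls_add ls0 x) x;
  ls_addN : forall x, ls_eq (ls_add (ls_opp x) x) ls0;
  ls_scaleA : forall a b x,
    ls_eq (ls_scale a (ls_scale b x)) (ls_scale (a * b) x);
  ls_scale1 : forall x, ls_eq (ls_scale 1 x) x;
  ls_scaleDr : forall a x y,
    ls_eq (ls_scale a (ls_add x y)) (ls_add (ls_scale a x) (ls_scale a y));
  ls_scaleDl : forall x a b,
    ls_eq (ls_scale (a + b) x) (ls_add (ls_scale a x) (ls_scale b x));
  ls_partP : forall p a x y,
    ls_eq (ls_part p (ls_add (ls_scale a x) y))
          (ls_add (ls_scale a (ls_part p x)) (ls_part p y));
  ls_part_sum : forall x, ls_eq (ls_add (ls_part false x) (ls_part true x)) x;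
  ls_part_part : forall p q x,
    ls_eq (ls_part p (ls_part q x)) (if p == q then ls_part q x else ls0);
  ls_brkPl : forall z a x y,
    ls_eq (ls_brk (ls_add (ls_scale a x) y) z)
          (ls_add (ls_scale a (ls_brk x z)) (ls_brk y z));
  ls_brkPr : forall z a x y,
    ls_eq (ls_brk z (ls_add (ls_scale a x) y))
          (ls_add (ls_scale a (ls_brk z x)) (ls_brk z y));
  ls_brk_even : forall p q x y,
    ls_eq (ls_part (p (+) q) (ls_brk (ls_part p x) (ls_part q y)))
          (ls_brk (ls_part p x) (ls_part q y));
  ls_brk_skew : forall p q x y,
    ls_eq (ls_brk (ls_part p x) (ls_part q y))
          (ls_opp (ls_scale ((-1) ^+ (p && q))
                            (ls_brk (ls_part q y) (ls_part p x))));
  ls_brk_jacobi : forall p q x y z,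
    ls_eq (ls_brk (ls_part p x) (ls_brk (ls_part q y) z))
          (ls_add (ls_brk (ls_brk (ls_part p x) (ls_part q y)) z)
                  (ls_scale ((-1) ^+ (p && q))
                            (ls_brk (ls_part q y) (ls_brk (ls_part p x) z))))
}.

Section LieQuotient.
Variables (C : fieldType) (S : lieSetoid C).

Definition ls_sort := ls_car S.
HB.instance Definition _ := gen_eqMixin ls_sort.
HB.instance Definition _ := gen_choiceMixin ls_sort.

Definition ls_eqb (x y : ls_sort) : bool := `[< @ls_eq C S x y >].

Lemma ls_eqb_refl : reflexive ls_eqb.
Proof. by move=> x; apply/asboolP; apply: ls_refl. Qed.

Lemma ls_eqb_sym : symmetric ls_eqb.
Proof. by move=> x y; apply: asbool_equiv_eq; split; apply: ls_sym. Qed.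

Lemma ls_eqb_trans : transitive ls_eqb.
Proof.
move=> y x z /asboolP xy /asboolP yz.
by apply/asboolP; apply: ls_trans xy yz.
Qed.

Canonical ls_equiv := EquivRel ls_eqb ls_eqb_refl ls_eqb_sym ls_eqb_trans.

Definition lieQuot := {eq_quot ls_equiv}.
HB.instance Definition _ := Choice.on lieQuot.

Definition lqpi (x : ls_car S) : lieQuot := \pi_({eq_quot ls_equiv}) (x : ls_sort).
Definition lqrepr (x : lieQuot) : ls_car S := repr (x : {eq_quot ls_equiv}).

Lemma lqpiP x y : lqpi x = lqpi y <-> ls_eq x y.
Proof.
split=> [/eqquotP|] xy; first exact/asboolP.
by apply/eqquotP/asboolP.
Qed.

Lemma lqreprK x : lqpi (lqrepr x) = x.
Proof. exact: reprK. Qed.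

Lemma lqW (P : lieQuot -> Prop) : (forall x, P (lqpi x)) -> forall x, P x.
Proof. by move=> Px x; rewrite -[x]lqreprK. Qed.

Lemma lqrepr_pi x : ls_eq (lqrepr (lqpi x)) x.
Proof. by apply/lqpiP; rewrite lqreprK. Qed.

Definition lq_add x y := lqpi (ls_add (lqrepr x) (lqrepr y)).
Definition lq_opp x := lqpi (ls_opp (lqrepr x)).
Definition lq_scale a x := lqpi (ls_scale a (lqrepr x)).
Definition lq_part p x := lqpi (ls_part p (lqrepr x)).
Definition lq_brk x y := lqpi (ls_brk (lqrepr x) (lqrepr y)).

Lemma lq_addE x y : lq_add (lqpi x) (lqpi y) = lqpi (ls_add x y).
Proof. by apply/lqpiP/ls_add_compat; apply: lqrepr_pi. Qed.
Lemma lq_oppE x : lq_opp (lqpi x) = lqpi (ls_opp x).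
Proof. by apply/lqpiP/ls_opp_compat; apply: lqrepr_pi. Qed.
Lemma lq_scaleE a x : lq_scale a (lqpi x) = lqpi (ls_scale a x).
Proof. by apply/lqpiP/ls_scale_compat; apply: lqrepr_pi. Qed.
Lemma lq_partE p x : lq_part p (lqpi x) = lqpi (ls_part p x).
Proof. by apply/lqpiP/ls_part_compat; apply: lqrepr_pi. Qed.
Lemma lq_brkE x y : lq_brk (lqpi x) (lqpi y) = lqpi (ls_brk x y).
Proof. by apply/lqpiP/ls_brk_compat; apply: lqrepr_pi. Qed.

Let lqE := (lq_addE, lq_oppE, lq_scaleE, lq_partE, lq_brkE).

Lemma lq_addA : associative lq_add.
Proof. by elim/lqW=> x; elim/lqW=> y; elim/lqW=> z; rewrite !lqE; apply/lqpiP/ls_addA. Qed.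
Lemma lq_addC : commutative lq_add.
Proof. by elim/lqW=> x; elim/lqW=> y; rewrite !lqE; apply/lqpiP/ls_addC. Qed.
Lemma lq_add0 : left_id (lqpi (ls0 S)) lq_add.
Proof. by elim/lqW=> x; rewrite !lqE; apply/lqpiP/ls_add0. Qed.
Lemma lq_addN : left_inverse (lqpi (ls0 S)) lq_opp lq_add.
Proof. by elim/lqW=> x; rewrite !lqE; apply/lqpiP/ls_addN. Qed.

HB.instance Definition _ :=
  GRing.isZmodule.Build lieQuot lq_addA lq_addC lq_add0 lq_addN.

Lemma lqpi0 : lqpi (ls0 S) = 0. Proof. by []. Qed.
Lemma lqpiD x y : lqpi (ls_add x y) = lqpi x + lqpi y.
Proof. by rewrite -lq_addE. Qed.
Lemma lqpiN x : lqpi (ls_opp x) = - lqpi x.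
Proof. by rewrite -lq_oppE. Qed.

Lemma lq_scaleA a b v : lq_scale a (lq_scale b v) = lq_scale (a * b) v.
Proof. by elim/lqW: v => x; rewrite !lqE; apply/lqpiP/ls_scaleA. Qed.
Lemma lq_scale1 : left_id 1 lq_scale.
Proof. by elim/lqW=> x; rewrite !lqE; apply/lqpiP/ls_scale1. Qed.
Lemma lq_scaleDr : right_distributive lq_scale +%R.
Proof.
move=> a; elim/lqW=> x; elim/lqW=> y.
by rewrite -lqpiD !lqE -lqpiD; apply/lqpiP/ls_scaleDr.
Qed.
Lemma lq_scaleDl v : {morph lq_scale^~ v : a b / a + b}.
Proof.
by elim/lqW: v => x a b /=; rewrite !lqE -lqpiD; apply/lqpiP/ls_scaleDl.
Qed.

HB.instance Definition _ := GRing.Zmodule_isLmodule.Build C lieQuot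
  lq_scaleA lq_scale1 lq_scaleDr lq_scaleDl.

Lemma lqpiZ a x : lqpi (ls_scale a x) = a *: lqpi x.
Proof. by rewrite -lq_scaleE. Qed.

Lemma lq_part_linear p : linear (lq_part p).
Proof.
move=> a; elim/lqW=> x; elim/lqW=> y.
by rewrite -lqpiZ -lqpiD !lqE -lqpiZ -lqpiD; apply/lqpiP/ls_partP.
Qed.
Lemma lq_part_sum v : lq_part false v + lq_part true v = v.
Proof. by elim/lqW: v => x; rewrite !lqE -lqpiD; apply/lqpiP/ls_part_sum. Qed.
Lemma lq_part_part p q v :
  lq_part p (lq_part q v) = if p == q then lq_part q v else 0.
Proof.
elim/lqW: v => x; rewrite !lqE -lqpi0 -(fun_if lqpi).
exact/lqpiP/ls_part_part.
Qed.

HB.instance Definition _ := isSuperspace.Build C lieQuot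
  lq_part_linear lq_part_sum lq_part_part.

Lemma lqpi_part p x : lqpi (ls_part p x) = part p (lqpi x).
Proof. by rewrite -lq_partE. Qed.

Lemma lq_brk_linearl z : linear (lq_brk^~ z).
Proof.
elim/lqW: z => z a; elim/lqW=> x; elim/lqW=> y /=.
by rewrite -lqpiZ -lqpiD !lqE -lqpiZ -lqpiD; apply/lqpiP/ls_brkPl.
Qed.
Lemma lq_brk_linearr z : linear (lq_brk z).
Proof.
elim/lqW: z => z a; elim/lqW=> x; elim/lqW=> y /=.
by rewrite -lqpiZ -lqpiD !lqE -lqpiZ -lqpiD; apply/lqpiP/ls_brkPr.
Qed.
Lemma lq_brk_even p q x y :
  part (p (+) q) (lq_brk (part p x) (part q y)) = lq_brk (part p x) (part q y).
Proof.
elim/lqW: x => x; elim/lqW: y => y.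
by rewrite -(lqpi_part p) -(lqpi_part q) lq_brkE -lqpi_part; apply/lqpiP/ls_brk_even.
Qed.
Lemma lq_brk_skew p q x y :
  lq_brk (part p x) (part q y)
  = - ((-1) ^+ (p && q) *: lq_brk (part q y) (part p x)).
Proof.
elim/lqW: x => x; elim/lqW: y => y.
by rewrite -!lqpi_part !lq_brkE -lqpiZ -lqpiN; apply/lqpiP/ls_brk_skew.
Qed.
Lemma lq_brk_jacobi p q x y z :
  lq_brk (part p x) (lq_brk (part q y) z)
  = lq_brk (lq_brk (part p x) (part q y)) z
    + (-1) ^+ (p && q) *: lq_brk (part q y) (lq_brk (part p x) z).
Proof.
elim/lqW: x => x; elim/lqW: y => y; elim/lqW: z => z.
by rewrite -!lqpi_part !lq_brkE -lqpiZ -lqpiD; apply/lqpiP/ls_brk_jacobi.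
Qed.

HB.instance Definition _ := isLieSuper.Build C lieQuot
  lq_brk_linearl lq_brk_linearr lq_brk_even lq_brk_skew lq_brk_jacobi.

End LieQuotient.

Record lieIdeal (C : fieldType) (g : lieSuperType C) := LieIdeal {
  li_mem :> g -> Prop;
  li0 : li_mem 0;
  liP : forall a x y, li_mem x -> li_mem y -> li_mem (a *: x + y);
  li_part : forall p x, li_mem x -> li_mem (part p x);
  li_brk : forall x y, li_mem y -> li_mem (brk x y)
}.

Section IdealQuotient.
Variables (C : fieldType) (g : lieSuperType C) (I : lieIdeal g).
Implicit Types x y z : g.

Lemma liZ a x : I x -> I (a *: x).
Proof. by move=> Ix; rewrite -[a *: x]addr0; apply: liP => //; apply: li0. Qed.
Lemma liD x y : I x -> I y -> I (x + y).
Proof. by move=> Ix Iy; rewrite -[x]scale1r; apply: liP. Qed.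
Lemma liN x : I x -> I (- x).
Proof. by move=> Ix; rewrite -scaleN1r; apply: liZ. Qed.

Lemma li_brkr x y : I x -> I (brk x y).
Proof.
move=> Ix; rewrite -[x]part_sum -[y]part_sum brkDl !linearD /=.
by do !apply: liD; rewrite brk_skew; apply/liN/liZ/li_brk/li_part.
Qed.

Definition li_eq x y := I (x - y).

Lemma li_eqE x y : x = y -> li_eq x y.
Proof. by move=> ->; rewrite /li_eq subrr; apply: li0. Qed.

Definition ideal_setoid : lieSetoid C.
Proof.
refine (@LieSetoid C g li_eq 0 +%R -%R *:%R (@part C g) (@brk C g)
  _ _ _ _ _ _ _ _ _ _ _ _ _ _ _ _ _ _ _ _ _ _ _ _).
- by move=> x; apply: li_eqE.
- by move=> x y xy; rewrite /li_eq -opprB; apply: liN.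
- move=> x y z xy yz; rewrite /li_eq -[x](subrK y) -addrA.
  exact: liD.
- by move=> x x' y y' xx yy; rewrite /li_eq opprD addrACA; apply: liD.
- by move=> x x' xx; rewrite /li_eq -opprD; apply: liN.
- by move=> a x x' xx; rewrite /li_eq -scalerBr; apply: liZ.
- by move=> p x x' xx; rewrite /li_eq -linearB; apply: li_part.
- move=> x x' y y' xx yy; rewrite /li_eq -[brk x y](subrK (brk x y')) -addrA.
  by apply: liD; [rewrite -linearB; apply: li_brk | rewrite -brkBl; apply: li_brkr].
- by move=> *; apply/li_eqE/addrA.
- by move=> *; apply/li_eqE/addrC.
- by move=> *; apply/li_eqE/add0r.
- by move=> *; apply/li_eqE/addNr.
- by move=> *; apply/li_eqE/scalerA.
- by move=> *; apply/li_eqE/scale1r.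
- by move=> *; apply/li_eqE/scalerDr.
- by move=> *; apply/li_eqE/scalerDl.
- by move=> *; apply/li_eqE/part_linear.
- by move=> *; apply/li_eqE/part_sum.
- by move=> *; apply/li_eqE/part_part.
- by move=> z *; apply/li_eqE/brk_linearl.
- by move=> *; apply/li_eqE/brk_linearr.
- by move=> *; apply/li_eqE/brk_even.
- by move=> *; apply/li_eqE/brk_skew.
- by move=> *; apply/li_eqE/brk_jacobi.
Defined.

Definition quotLie : lieSuperType C := lieQuot ideal_setoid.
Definition quot_pi (x : g) : quotLie := lqpi (x : ls_car ideal_setoid).

End IdealQuotient.

HB.mixin Record hasSuperForm (C : fieldType) V of FinLieSuper C V := {
  sform : V -> V -> C;
  sform_linearl : forall y, scalar (sform^~ y);
  sform_linearr : forall x, scalar (sform x);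
  sform_even : forall p x y, sform (part p x) (part (~~ p) y) = 0;
  sform_sym : forall p x y,
    sform (part p x) (part p y) = (-1) ^+ p * sform (part p y) (part p x);
  sform_inv : forall x y z, sform (brk x y) z = sform x (brk y z)
}.

#[short(type="quadLieSuperType")]
HB.structure Definition QuadLieSuper (C : fieldType) :=
  {V of FinLieSuper C V & hasSuperForm C V}.

(* gl(m|n), with the supertrace form.  The matrix unit E_ij has parity
   [ipar i (+) ipar j]. *)
Section GeneralLinear.
Variables (C : fieldType) (m n : nat).
Implicit Types A B D : 'M[C]_(m + n).

Definition ipar (i : 'I_(m + n)) : bool := (m <= i)%N.

Definition mxpart (p : bool) A : 'M[C]_(m + n) :=
  \matrix_(i, j) (if ipar i (+) ipar j == p then A i j else 0).

Definition mxbrk A B : 'M[C]_(m + n) :=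
  A *m B - \sum_(p : bool) \sum_(q : bool)
             (-1) ^+ (p && q) *: (mxpart q B *m mxpart p A).

Definition str A : C := \sum_i (-1) ^+ ipar i * A i i.

Definition mxform A B : C := str (A *m B).

Lemma mxpart_linear p : linear (mxpart p).
Proof.
move=> a A B; apply/matrixP => i j; rewrite !mxE.
by case: ifP => // _; rewrite mulr0 addr0.
Qed.
HB.instance Definition _ p := GRing.isLinear.Build C
  'M[C]_(m + n) 'M[C]_(m + n) *:%R (mxpart p) (mxpart_linear p).

Lemma mxpart_sum A : mxpart false A + mxpart true A = A.
Proof.
by apply/matrixP => i j; rewrite !mxE; case: addb; rewrite ?addr0 ?add0r.
Qed.
Lemma mxpart_part p q A :
  mxpart p (mxpart q A) = if p == q then mxpart q A else 0.
Proof.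
apply/matrixP => i j; rewrite (fun_if (fun M : 'M[C]_(m + n) => M i j)) !mxE.
by case: p q (addb _ _) => [] [] [].
Qed.
Lemma mxpartK p A : mxpart p (mxpart p A) = mxpart p A.
Proof. by rewrite mxpart_part eqxx. Qed.
Lemma mxpart_hom p q A : mxpart p A = A -> mxpart q A = if q == p then A else 0.
Proof. by move=> <-; rewrite mxpart_part; case: eqP. Qed.

Lemma mxpart_mul p q A B :
  mxpart p A = A -> mxpart q B = B -> mxpart (p (+) q) (A *m B) = A *m B.
Proof.
move=> <- <-; apply/matrixP => i j; rewrite !mxE; case: ifP => // pqE.
rewrite big1 // => k _; rewrite !mxE.
case: ifP => [/eqP kp|]; last by rewrite mul0r.
case: ifP => [/eqP kq|]; last by rewrite mulr0.
by rewrite -kp -kq in pqE; case: (ipar i) (ipar j) (ipar k) pqE => [] [] [].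
Qed.

Lemma mxbrk_hom p q A B : mxpart p A = A -> mxpart q B = B ->
  mxbrk A B = A *m B - (-1) ^+ (p && q) *: (B *m A).
Proof.
move=> Ap Bq; rewrite /mxbrk !big_bool /= !(mxpart_hom _ Ap) !(mxpart_hom _ Bq).
by case: p q {Ap Bq} => [] [] /=;
  rewrite ?(mulmx0, mul0mx, scaler0, addr0, add0r).
Qed.

Lemma mxbrk_linearl B : linear (mxbrk^~ B).
Proof.
move=> a A A'; rewrite /mxbrk !big_bool /= !mxpart_linear !mulmxDr -!scalemxAr.
by rewrite mulmxDl -scalemxAl; apply/matrixP => i j; rewrite !mxE; ring.
Qed.
Lemma mxbrk_linearr A : linear (mxbrk A).
Proof.
move=> a B B'; rewrite /mxbrk !big_bool /= !mxpart_linear !mulmxDl -!scalemxAl.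
by rewrite mulmxDr -scalemxAr; apply/matrixP => i j; rewrite !mxE; ring.
Qed.

Lemma mxbrk_homP p q A B : mxpart p A = A -> mxpart q B = B ->
  mxpart (p (+) q) (mxbrk A B) = mxbrk A B.
Proof.
move=> Ap Bq; rewrite (mxbrk_hom Ap Bq) linearB linearZ /= mxpart_mul //.
by rewrite addbC mxpart_mul.
Qed.

Lemma mxbrk_even p q A B :
  mxpart (p (+) q) (mxbrk (mxpart p A) (mxpart q B))
  = mxbrk (mxpart p A) (mxpart q B).
Proof. by apply: mxbrk_homP; rewrite mxpartK. Qed.

Lemma mxbrk_skew p q A B :
  mxbrk (mxpart p A) (mxpart q B)
  = - ((-1) ^+ (p && q) *: mxbrk (mxpart q B) (mxpart p A)).
Proof.
rewrite (mxbrk_hom (mxpartK p A) (mxpartK q B)).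
rewrite (mxbrk_hom (mxpartK q B) (mxpartK p A)).
by rewrite scalerBr opprB scalerA andbC -signr_addb addbb scale1r.
Qed.

Lemma mxbrk_jacobi p q A B D :
  mxbrk (mxpart p A) (mxbrk (mxpart q B) D)
  = mxbrk (mxbrk (mxpart p A) (mxpart q B)) D
    + (-1) ^+ (p && q) *: mxbrk (mxpart q B) (mxbrk (mxpart p A) D).
Proof.
suff hom r : mxbrk (mxpart p A) (mxbrk (mxpart q B) (mxpart r D))
    = mxbrk (mxbrk (mxpart p A) (mxpart q B)) (mxpart r D)
      + (-1) ^+ (p && q)
        *: mxbrk (mxpart q B) (mxbrk (mxpart p A) (mxpart r D)).
  have brkD X Y Z : mxbrk X (Y + Z) = mxbrk X Y + mxbrk X Z.
    by have := mxbrk_linearr X 1 Y Z; rewrite !scale1r.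
  move: mxbrk brkD hom => br brkD hom.
  by rewrite -[D]mxpart_sum !brkD !hom scalerDr addrACA.
have Ap := mxpartK p A; have Bq := mxpartK q B; have Dr := mxpartK r D.
move: (mxpart p A) (mxpart q B) (mxpart r D) Ap Bq Dr => {}A {}B {}D Ap Bq Dr.
have AB := mxbrk_homP Ap Bq; have BD := mxbrk_homP Bq Dr.
have AD := mxbrk_homP Ap Dr.
rewrite (mxbrk_hom Ap BD) (mxbrk_hom AB Dr) (mxbrk_hom Bq AD).
rewrite (mxbrk_hom Ap Bq) (mxbrk_hom Ap Dr) (mxbrk_hom Bq Dr).
rewrite !(mulmxBl, mulmxBr) -!(scalemxAl, scalemxAr) !mulmxA.
move: (A *m B *m D) (A *m D *m B) (B *m A *m D) => m1 m2 m3.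
move: (B *m D *m A) (D *m A *m B) (D *m B *m A) => m4 m5 m6.
apply/matrixP => i j; rewrite !mxE.
by case: p q r {Ap Bq Dr AB BD AD} => [] [] []; rewrite /= ?expr0 ?expr1; ring.
Qed.

Lemma str_scalar : scalar str.
Proof.
move=> a A B; rewrite /str /= mulr_sumr -big_split /=.
by apply: eq_bigr => i _; rewrite !mxE; ring.
Qed.
HB.instance Definition _ :=
  GRing.isLinear.Build C 'M[C]_(m + n) C *%R str str_scalar.

Lemma str_odd A : str (mxpart true A) = 0.
Proof. by rewrite /str big1 // => i _; rewrite !mxE addbb mulr0. Qed.

Lemma str_mulC p q A B : mxpart p A = A -> mxpart q B = B ->
  str (A *m B) = (-1) ^+ (p && q) * str (B *m A).
Proof.
move=> Ap Bq; rewrite /str mulr_sumr.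
under eq_bigr do rewrite mxE mulr_sumr.
under [RHS]eq_bigr do rewrite mxE !mulr_sumr.
rewrite exchange_big /=; apply: eq_bigr => k _; apply: eq_bigr => i _.
rewrite -Ap -Bq !mxE; do 2![case: eqP => [|_]; last by rewrite ?(mulr0, mul0r)].
by case: (ipar i) (ipar k) p q {Ap Bq} => [] [] [] [] //= _ _; ring.
Qed.

Lemma mxform_linearl B : scalar (mxform^~ B).
Proof. by move=> a A A'; rewrite /mxform mulmxDl -scalemxAl linearP. Qed.
Lemma mxform_linearr A : scalar (mxform A).
Proof. by move=> a B B'; rewrite /mxform mulmxDr -scalemxAr linearP. Qed.
Lemma mxform_even p A B : mxform (mxpart p A) (mxpart (~~ p) B) = 0.
Proof.
rewrite /mxform -(mxpart_mul (mxpartK p A) (mxpartK (~~ p) B)).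
by rewrite addbN addbb str_odd.
Qed.
Lemma mxform_sym p A B : mxform (mxpart p A) (mxpart p B)
  = (-1) ^+ p * mxform (mxpart p B) (mxpart p A).
Proof. by rewrite /mxform (str_mulC (mxpartK p A) (mxpartK p B)) andbb. Qed.
Lemma mxform_inv A B D : mxform (mxbrk A B) D = mxform A (mxbrk B D).
Proof.
have hom p q r : mxform (mxbrk (mxpart p A) (mxpart q B)) (mxpart r D)
    = mxform (mxpart p A) (mxbrk (mxpart q B) (mxpart r D)).
  have Ap := mxpartK p A; have Bq := mxpartK q B; have Dr := mxpartK r D.
  move: (mxpart p A) (mxpart q B) (mxpart r D) Ap Bq Dr
    => {}A {}B {}D Ap Bq Dr.
  rewrite /mxform (mxbrk_hom Ap Bq) (mxbrk_hom Bq Dr).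
  rewrite mulmxBl mulmxBr -scalemxAl -scalemxAr !linearB !linearZ /= mulmxA.
  congr (_ - _); rewrite -!mulmxA (str_mulC Bq (mxpart_mul Ap Dr)) -mulmxA.
  case: (boolP (p (+) q (+) r)) => pqr.
    rewrite -(mxpart_mul Ap (mxpart_mul Dr Bq)).
    by rewrite [r (+) q]addbC addbA pqr str_odd !mulr0.
  by case: p q r pqr {Ap Bq Dr} => [] [] [] //= _; ring.
have fD X Y Z : mxform X (Y + Z) = mxform X Y + mxform X Z.
  by have := mxform_linearr X 1 Y Z; rewrite scale1r mul1r.
have fDl X Y Z : mxform (Y + Z) X = mxform Y X + mxform Z X.
  by have := mxform_linearl X 1 Y Z; rewrite scale1r mul1r.
have bD X Y Z : mxbrk X (Y + Z) = mxbrk X Y + mxbrk X Z.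
  by have := mxbrk_linearr X 1 Y Z; rewrite !scale1r.
have bDl X Y Z : mxbrk (Y + Z) X = mxbrk Y X + mxbrk Z X.
  by have := mxbrk_linearl X 1 Y Z; rewrite !scale1r.
move: mxbrk mxform hom fD fDl bD bDl => br f hom fD fDl bD bDl.
rewrite -[A]mxpart_sum -[B]mxpart_sum -[D]mxpart_sum.
by rewrite !(bD, bDl) !(fD, fDl) !hom; ring.
Qed.

Definition glmx := 'M[C]_(m + n).
HB.instance Definition _ := Vector.on glmx.
HB.instance Definition _ := isSuperspace.Build C glmx
  mxpart_linear mxpart_sum mxpart_part.
HB.instance Definition _ := isLieSuper.Build C glmx
  mxbrk_linearl mxbrk_linearr mxbrk_even mxbrk_skew mxbrk_jacobi.
HB.instance Definition _ := hasSuperForm.Build C glmx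
  mxform_linearl mxform_linearr mxform_even mxform_sym mxform_inv.

End GeneralLinear.

Record gradedSubalg (C : fieldType) (g : quadLieSuperType C) := GradedSubalg {
  gs_space : {vspace g};
  gs_part : forall p x, x \in gs_space -> part p x \in gs_space;
  gs_brk : forall x y, x \in gs_space -> y \in gs_space ->
    brk x y \in gs_space
}.

Section Subalgebra.
Variables (C : fieldType) (g : quadLieSuperType C) (S : gradedSubalg g).

Definition subLie := subvs_of (gs_space S).
HB.instance Definition _ := Vector.on subLie.
Implicit Types x y z : subLie.

Definition sub_val x : g := vsval x.
Definition sub_proj : g -> subLie := vsproj (gs_space S).
Definition sub_part p x := sub_proj (part p (sub_val x)).
Definition sub_brk x y := sub_proj (brk (sub_val x) (sub_val y)).
Definition sub_form x y := sform (sub_val x) (sub_val y).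

Lemma sub_val_inj : injective sub_val. Proof. exact: subvs_inj. Qed.
Lemma sub_val_linear : linear sub_val. Proof. exact: linearP. Qed.
Lemma sub_val_mem x : sub_val x \in gs_space S. Proof. exact: subvsP. Qed.
Lemma sub_projK v : v \in gs_space S -> sub_val (sub_proj v) = v.
Proof. exact: vsprojK. Qed.
Lemma sub_valD x y : sub_val (x + y) = sub_val x + sub_val y.
Proof. exact: linearD. Qed.
Lemma sub_valZ a x : sub_val (a *: x) = a *: sub_val x.
Proof. exact: linearZ. Qed.
Lemma sub_valN x : sub_val (- x) = - sub_val x.
Proof. exact: linearN. Qed.

Lemma sub_val_part p x : sub_val (sub_part p x) = part p (sub_val x).
Proof. by rewrite sub_projK // gs_part // sub_val_mem. Qed.
Lemma sub_val_brk x y : sub_val (sub_brk x y) = brk (sub_val x) (sub_val y).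
Proof. by rewrite sub_projK // gs_brk // sub_val_mem. Qed.

Lemma sub_part_linear p : linear (sub_part p).
Proof.
by move=> a x y; apply: sub_val_inj; rewrite sub_val_linear !sub_val_part sub_val_linear part_linear.
Qed.
Lemma sub_part_sum x : sub_part false x + sub_part true x = x.
Proof. by apply: sub_val_inj; rewrite sub_valD !sub_val_part part_sum. Qed.
Lemma sub_part_part p q x :
  sub_part p (sub_part q x) = if p == q then sub_part q x else 0.
Proof.
apply: sub_val_inj; rewrite !sub_val_part part_part.
by case: eqP => _; rewrite ?sub_val_part ?linear0.
Qed.
HB.instance Definition _ := isSuperspace.Build C subLie
  sub_part_linear sub_part_sum sub_part_part.

Let sub_partE p x : sub_val (part p x) = part p (sub_val x).
Proof. exact: sub_val_part. Qed.

Lemma sub_brk_linearl y : linear (sub_brk^~ y).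
Proof.
move=> a x x'; apply: sub_val_inj.
by rewrite sub_val_linear !sub_val_brk sub_val_linear brk_linearl.
Qed.
Lemma sub_brk_linearr x : linear (sub_brk x).
Proof.
move=> a y y'; apply: sub_val_inj.
by rewrite sub_val_linear !sub_val_brk sub_val_linear brk_linearr.
Qed.
Lemma sub_brk_even p q x y :
  part (p (+) q) (sub_brk (part p x) (part q y)) = sub_brk (part p x) (part q y).
Proof.
by apply: sub_val_inj; rewrite sub_partE sub_val_brk !sub_partE brk_even.
Qed.
Lemma sub_brk_skew p q x y :
  sub_brk (part p x) (part q y)
  = - ((-1) ^+ (p && q) *: sub_brk (part q y) (part p x)).
Proof.
apply: sub_val_inj; rewrite sub_valN sub_valZ !sub_val_brk !sub_partE.
exact: brk_skew.
Qed.
Lemma sub_brk_jacobi p q x y z :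
  sub_brk (part p x) (sub_brk (part q y) z)
  = sub_brk (sub_brk (part p x) (part q y)) z
    + (-1) ^+ (p && q) *: sub_brk (part q y) (sub_brk (part p x) z).
Proof.
apply: sub_val_inj; rewrite sub_valD sub_valZ !sub_val_brk !sub_partE.
exact: brk_jacobi.
Qed.
HB.instance Definition _ := isLieSuper.Build C subLie
  sub_brk_linearl sub_brk_linearr sub_brk_even sub_brk_skew sub_brk_jacobi.

Lemma sub_form_linearl y : scalar (sub_form^~ y).
Proof. by move=> a x x'; rewrite /sub_form sub_val_linear sform_linearl. Qed.
Lemma sub_form_linearr x : scalar (sub_form x).
Proof. by move=> a y y'; rewrite /sub_form sub_val_linear sform_linearr. Qed.
Lemma sub_form_even p x y : sub_form (part p x) (part (~~ p) y) = 0.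
Proof. by rewrite /sub_form !sub_partE sform_even. Qed.
Lemma sub_form_sym p x y :
  sub_form (part p x) (part p y) = (-1) ^+ p * sub_form (part p y) (part p x).
Proof. by rewrite /sub_form !sub_partE sform_sym. Qed.
Lemma sub_form_inv x y z : sub_form (brk x y) z = sub_form x (brk y z).
Proof. by rewrite /sub_form !sub_val_brk sform_inv. Qed.
HB.instance Definition _ := hasSuperForm.Build C subLie
  sub_form_linearl sub_form_linearr sub_form_even sub_form_sym sub_form_inv.

End Subalgebra.

Section SpecialLinear.
Variables (C : fieldType) (m n : nat).

Definition sl_space : {vspace glmx C m n} :=
  lker (linfun (str (m:=m) (n:=n) : glmx C m n -> C^o)).

Lemma mem_sl A : (A \in sl_space) = (str A == 0).
Proof. by rewrite memv_ker lfunE. Qed.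

Lemma sl_part p A : A \in sl_space -> part p A \in sl_space.
Proof.
rewrite !mem_sl => /eqP sA.
have s1 := str_odd A; have := congr1 (@str C m n) (mxpart_sum A).
rewrite linearD /= s1 addr0 sA => s0.
by case: p; apply/eqP; [apply: s1 | apply: s0].
Qed.

Lemma str_brk A B : str (@mxbrk C m n A B) = 0.
Proof.
have hom p q : str (mxbrk (mxpart p A) (mxpart q B)) = 0.
  rewrite (mxbrk_hom (mxpartK p A) (mxpartK q B)) linearB linearZ /=.
  by rewrite (str_mulC (mxpartK p A) (mxpartK q B)) subrr.
have bD X Y Z : @mxbrk C m n X (Y + Z) = mxbrk X Y + mxbrk X Z.
  by have := mxbrk_linearr X 1 Y Z; rewrite !scale1r.
have bDl X Y Z : @mxbrk C m n (Y + Z) X = mxbrk Y X + mxbrk Z X.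
  by have := mxbrk_linearl X 1 Y Z; rewrite !scale1r.
move: (@mxbrk C m n) hom bD bDl => br hom bD bDl.
rewrite -[A]mxpart_sum -[B]mxpart_sum !(bD, bDl) !linearD /= !hom.
by rewrite !addr0.
Qed.

Lemma sl_brk A B : A \in sl_space -> B \in sl_space -> brk A B \in sl_space.
Proof. by move=> _ _; rewrite mem_sl; apply/eqP/str_brk. Qed.

Definition sl : quadLieSuperType C := subLie (GradedSubalg sl_part sl_brk).

End SpecialLinear.

(* osp(J) consists of the A with st(A) J + J A = 0, st being the
   supertranspose; for homogeneous A and v this says that
   (A v, w) + (-1)^(|A||v|) (v, A w) = 0 where (v, w) = v^T J w. *)
Section Orthosymplectic.
Variables (C : fieldType) (m n : nat) (J : 'M[C]_(m + n)).
Hypothesis Jeven : mxpart false J = J.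
Implicit Types A B : 'M[C]_(m + n).

Definition supertr A : 'M[C]_(m + n) :=
  \matrix_(i, j) ((-1) ^+ (ipar i && ~~ ipar j) * A j i).

Definition osp_eq A : 'M[C]_(m + n) := supertr A *m J + J *m A.

Lemma supertr_linear : linear supertr.
Proof. by move=> a A B; apply/matrixP => i j; rewrite !mxE; ring. Qed.
HB.instance Definition _ := GRing.isLinear.Build C
  'M[C]_(m + n) 'M[C]_(m + n) *:%R supertr supertr_linear.

Lemma osp_eq_linear : linear osp_eq.
Proof.
move=> a A B; rewrite /osp_eq linearP mulmxDl mulmxDr -scalemxAl -scalemxAr.
by rewrite scalerDr addrACA.
Qed.
HB.instance Definition _ := GRing.isLinear.Build C
  'M[C]_(m + n) 'M[C]_(m + n) *:%R osp_eq osp_eq_linear.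

Definition osp_space : {vspace glmx C m n} :=
  lker (linfun (osp_eq : glmx C m n -> 'M[C]_(m + n))).

Lemma mem_osp A : (A \in osp_space) = (osp_eq A == 0).
Proof. by rewrite memv_ker lfunE. Qed.

Lemma supertr_part p A : supertr (mxpart p A) = mxpart p (supertr A).
Proof.
apply/matrixP => i j; rewrite !mxE [ipar j (+) _]addbC.
by case: ifP => //; rewrite mulr0.
Qed.

Lemma mxpart_mulJl p A : mxpart p (A *m J) = mxpart p A *m J.
Proof.
rewrite -[A in LHS]mxpart_sum mulmxDl linearD /=.
rewrite -(mxpart_mul (mxpartK false A) Jeven) -(mxpart_mul (mxpartK true A) Jeven).
rewrite !mxpart_part; case: p => /=; rewrite ?addr0 ?add0r.
  exact: (mxpart_mul (mxpartK true A) Jeven).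
exact: (mxpart_mul (mxpartK false A) Jeven).
Qed.
Lemma mxpart_mulJr p A : mxpart p (J *m A) = J *m mxpart p A.
Proof.
rewrite -[A in LHS]mxpart_sum mulmxDr linearD /=.
rewrite -(mxpart_mul Jeven (mxpartK false A)) -(mxpart_mul Jeven (mxpartK true A)).
rewrite !mxpart_part; case: p => /=; rewrite ?addr0 ?add0r.
  exact: (mxpart_mul Jeven (mxpartK true A)).
exact: (mxpart_mul Jeven (mxpartK false A)).
Qed.

Lemma osp_eq_part p A : osp_eq (mxpart p A) = mxpart p (osp_eq A).
Proof. by rewrite linearD /= mxpart_mulJl mxpart_mulJr -supertr_part. Qed.

Lemma supertr_mul p q A B : mxpart p A = A -> mxpart q B = B ->
  supertr (A *m B) = (-1) ^+ (p && q) *: (supertr B *m supertr A).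
Proof.
move=> Ap Bq; apply/matrixP => i j; rewrite !mxE !mulr_sumr.
apply: eq_bigr => k _; rewrite -Ap -Bq !mxE.
do 2![case: eqP => [|_]; last by rewrite ?(mulr0, mul0r)].
by case: (ipar i) (ipar j) (ipar k) p q {Ap Bq} => [] [] [] [] [] //= _ _; ring.
Qed.

Lemma osp_eq_brk p q A B : mxpart p A = A -> mxpart q B = B ->
  osp_eq A = 0 -> osp_eq B = 0 -> osp_eq (mxbrk A B) = 0.
Proof.
move=> Ap Bq /eqP; rewrite addr_eq0 => /eqP oA /eqP; rewrite addr_eq0 => /eqP oB.
rewrite /osp_eq (mxbrk_hom Ap Bq) linearB linearZ /=.
rewrite (supertr_mul Ap Bq) (supertr_mul Bq Ap) mulmxBl mulmxBr.
rewrite -!scalemxAl -scalemxAr -!mulmxA oA oB !mulmxN !mulmxA oA oB.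
rewrite !mulNmx !opprK scalerA andbC -signr_addb addbb scale1r.
by rewrite addrA subrK subrr.
Qed.

Lemma osp_part p (A : glmx C m n) : A \in osp_space -> part p A \in osp_space.
Proof.
rewrite !mem_osp => /eqP oA; apply/eqP.
by rewrite [LHS]osp_eq_part oA linear0.
Qed.

Lemma osp_brk (A B : glmx C m n) : A \in osp_space -> B \in osp_space ->
  brk A B \in osp_space.
Proof.
move=> oA oB; rewrite -[A]part_sum -[B]part_sum !(brkDl, brkDr).
have hom p q : brk (part p A) (part q B) \in osp_space.
  rewrite mem_osp; apply/eqP/(osp_eq_brk (mxpartK p A) (mxpartK q B)).
    by apply/eqP; have := osp_part p oA; rewrite mem_osp.
  by apply/eqP; have := osp_part q oB; rewrite mem_osp.
by apply: memvD; apply: memvD.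
Qed.

Definition osp : quadLieSuperType C := subLie (GradedSubalg osp_part osp_brk).

End Orthosymplectic.

Definition osp12_form (C : fieldType) : 'M[C]_(1 + 2) :=
  block_mx 1%:M 0 0 (\matrix_(i, j) ((i < j)%N%:R - (j < i)%N%:R)).

Lemma mxpart_block (C : fieldType) m n (a : 'M[C]_m) (d : 'M[C]_n) :
  mxpart false (block_mx a 0 0 d) = block_mx a 0 0 d.
Proof.
apply/matrixP => i j; rewrite [LHS]mxE /ipar.
case: (split_ordP i) => i' ->; case: (split_ordP j) => j' ->.
- by rewrite /= ![(m <= _)%N]leqNgt !ltn_ord.
- by rewrite block_mxEur mxE if_same.
- by rewrite block_mxEdl mxE if_same.
- by rewrite /= !leq_addr.
Qed.

Definition osp12 (C : fieldType) : quadLieSuperType C :=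
  osp (mxpart_block _ _ : mxpart false (osp12_form C) = osp12_form C).

(* ts = s (x) C[xi] + C c; the triple (x, y, a) stands for
   x (x) 1 + y (x) xi + a c.  [sgn y] is (-1)^|y| y. *)
Section Takiff.
Variables (C : fieldType) (s : quadLieSuperType C).

Definition takiff := (s * s * C^o)%type.
HB.instance Definition _ := GRing.Lmodule.on takiff.
Implicit Types u v w : takiff.

Definition sgn (y : s) : s := part false y - part true y.

Definition tak_part (p : bool) u : takiff :=
  (part p u.1.1, part (~~ p) u.1.2, if p then 0 else u.2).

Definition tak_brk u v : takiff :=
  (brk u.1.1 v.1.1,
   brk u.1.1 v.1.2 + brk u.1.2 (sgn v.1.1),
   sform u.1.2 (sgn v.1.2)).

Lemma sgnP a x y : sgn (a *: x + y) = a *: sgn x + sgn y.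
Proof. by rewrite /sgn !part_linear opprD addrACA scalerBr. Qed.
Lemma sgnD x y : sgn (x + y) = sgn x + sgn y.
Proof. by have := sgnP 1 x y; rewrite !scale1r. Qed.
Lemma sgn_part p x : sgn (part p x) = (-1) ^+ p *: part p x.
Proof.
rewrite /sgn !part_part; case: p => /=.
  by rewrite sub0r expr1 scaleN1r.
by rewrite subr0 scale1r.
Qed.

Lemma sgn_brk x y : sgn (brk x y) = brk (sgn x) (sgn y).
Proof.
have hom p q : sgn (brk (part p x) (part q y))
    = brk (sgn (part p x)) (sgn (part q y)).
  rewrite -brk_even !sgn_part brkZl brkZr scalerA brk_even.
  by rewrite signr_addb.
have sD := sgnD; move: sgn sD hom => sg sD hom.
rewrite -[x]part_sum -[y]part_sum !sD !brkDl !brkDr !sD.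
by rewrite !hom.
Qed.

Lemma sgnK x : sgn (sgn x) = x.
Proof. by rewrite /sgn !partB !part_part /= subr0 sub0r opprK part_sum. Qed.

Lemma takP u v : u.1.1 = v.1.1 -> u.1.2 = v.1.2 -> u.2 = v.2 -> u = v.
Proof. by case: u v => [[? ?] ?] [[? ?] ?] /= -> -> ->. Qed.

Lemma tak_part_linear p : linear (tak_part p).
Proof.
move=> a u v; apply: takP => /=; rewrite ?part_linear //.
by case: p; rewrite /= ?scaler0 ?addr0.
Qed.
Lemma tak_part_sum u : tak_part false u + tak_part true u = u.
Proof.
by apply: takP => /=; rewrite ?part_sum ?addr0 // addrC part_sum.
Qed.
Lemma tak_part_part p q u :
  tak_part p (tak_part q u) = if p == q then tak_part q u else 0.
Proof.
by case: p q => [] []; apply: takP; rewrite /= ?part_part.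
Qed.
HB.instance Definition _ := isSuperspace.Build C takiff
  tak_part_linear tak_part_sum tak_part_part.

Lemma tak_brk_linearl v : linear (tak_brk^~ v).
Proof.
move=> a u u'; apply: takP => /=.
- exact: brk_linearl.
- by rewrite !(brkDl, brkZl) scalerDr addrACA.
- exact: (sform_linearl (sgn v.1.2) a u.1.2 u'.1.2).
Qed.
Lemma tak_brk_linearr u : linear (tak_brk u).
Proof.
move=> a v v'; apply: takP => /=.
- exact: brk_linearr.
- by rewrite sgnP !brk_linearr scalerDr addrACA.
- rewrite sgnP; exact: (sform_linearr u.1.2 a (sgn v.1.2) (sgn v'.1.2)).
Qed.

Let fDl (x y z : s) : sform (x + y) z = sform x z + sform y z :> C.
Proof. by have := sform_linearl z 1 x y; rewrite scale1r mul1r. Qed.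
Let fDr (x y z : s) : sform z (x + y) = sform z x + sform z y :> C.
Proof. by have := sform_linearr z 1 x y; rewrite scale1r mul1r. Qed.
Let f0l (y : s) : sform 0 y = 0 :> C.
Proof. by apply: (addrI (sform 0 y)); rewrite -fDl !addr0. Qed.
Let f0r (x : s) : sform x 0 = 0 :> C.
Proof. by apply: (addrI (sform x 0)); rewrite -fDr !addr0. Qed.
Let fZl a (x y : s) : sform (a *: x) y = a * sform x y :> C.
Proof. by have := sform_linearl y a x 0; rewrite !addr0 f0l addr0. Qed.
Let fZr a (x y : s) : sform x (a *: y) = a * sform x y :> C.
Proof. by have := sform_linearr x a y 0; rewrite !addr0 f0r addr0. Qed.

Lemma tak_brk_even p q u v :
  part (p (+) q) (tak_brk (part p u) (part q v)) = tak_brk (part p u) (part q v).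
Proof.
apply: takP => /=.
- exact: brk_even.
- rewrite sgn_part brkZr [LHS]partD [X in _ + X = _]partZ.
  by rewrite -{1}addbN brk_even -addNb brk_even.
- case: ifP => // pq; rewrite sgn_part fZr.
  have -> : q = ~~ p by case: p q pq => [] [].
  by rewrite sform_even mulr0.
Qed.

Lemma tak_brk_skew p q u v :
  tak_brk (part p u) (part q v)
  = - ((-1) ^+ (p && q) *: tak_brk (part q v) (part p u)).
Proof.
apply: takP => /=.
- exact: brk_skew.
- rewrite !sgn_part !brkZr (brk_skew p (~~ q)) (brk_skew (~~ p) q).
  rewrite scalerDr opprD addrC -!scaleNr !scalerA.
  by congr (_ *: _ + _ *: _); case: p q => [] [] /=; ring.
- rewrite !sgn_part !fZr.
  have [->|neq] := eqVneq p q.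
    by rewrite sform_sym; case: q => /=; rewrite /GRing.scale /=; ring.
  have -> : q = ~~ p by case: p q neq => [] [].
  rewrite sform_even negbK sform_even.
  by rewrite /GRing.scale /= !mulr0 oppr0.
Qed.

Lemma tak_brk_jacobi p q u v w :
  tak_brk (part p u) (tak_brk (part q v) w)
  = tak_brk (tak_brk (part p u) (part q v)) w
    + (-1) ^+ (p && q) *: tak_brk (part q v) (tak_brk (part p u) w).
Proof.
apply: takP => /=.
- exact: brk_jacobi.
- have := brk_jacobi p q u.1.1 v.1.1 w.1.2.
  have := brk_jacobi p (~~ q) u.1.1 v.1.2 (sgn w.1.1).
  have := brk_jacobi (~~ p) q u.1.2 v.1.1 (sgn w.1.1).
  rewrite (sgn_brk (part q v.1.1)) (sgn_brk (part p u.1.1)).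
  rewrite (sgn_part q) (sgn_part p).
  move: (part p u.1.1) (part q v.1.1) (part (~~ p) u.1.2) (part (~~ q) v.1.2).
  move: (sgn w.1.1) w.1.2 => w0 w1 u0 v0 u1 v1 J3 J2 J1.
  rewrite !brkDr !brkDl !brkZl !brkZr !brkZl J1 J2 J3 !scalerDr !scalerA -!addrA.
  congr (_ + _); rewrite addrCA; congr (_ + _).
  rewrite [RHS]addrCA; congr (_ + _); rewrite [LHS]addrC -addrA.
  by congr (_ + (_ *: _ + _ *: _)); case: p q {J1 J2 J3} => [] [] /=; ring.
- have := brk_skew p (~~ q) u.1.1 v.1.2.
  have := brk_skew (~~ p) (~~ q) u.1.2 v.1.2.
  rewrite !sgnD (sgn_brk (part q v.1.1)) (sgn_brk (part p u.1.1)).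
  rewrite (sgn_brk _ (sgn w.1.1)) (sgn_brk _ (sgn w.1.1)) sgnK.
  rewrite (sgn_part q) (sgn_part p) (sgn_part (~~ q)) (sgn_part (~~ p)).
  move: (part p u.1.1) (part q v.1.1) (part (~~ p) u.1.2) (part (~~ q) v.1.2).
  move: w.1.1 (sgn w.1.2) => w0 w1 u0 v0 u1 v1 S2 S1.
  rewrite !brkZl !brkZr !fDl !fDr !fZl !fZr -!sform_inv S1 S2.
  rewrite -!scaleN1r !fZl /GRing.scale /=.
  by case: p q {S1 S2} => [] [] /=; ring.
Qed.

HB.instance Definition _ := isLieSuper.Build C takiff
  tak_brk_linearl tak_brk_linearr tak_brk_even tak_brk_skew tak_brk_jacobi.

End Takiff.

(* Terms in the language of Lie superalgebras over a set X of symbols, and the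
   congruence generated by the axioms together with the relations [rel]; the
   quotient is the Lie superalgebra presented by X and [rel]. *)
Section Presentation.
Variables (C : fieldType) (X : Type).

Inductive lterm :=
| TGen of X
| TZero
| TAdd of lterm & lterm
| TOpp of lterm
| TScale of C & lterm
| TPart of bool & lterm
| TBrk of lterm & lterm.

Variable rel : lterm -> lterm -> Prop.

Inductive lcong : lterm -> lterm -> Prop :=
| lc_rel x y : rel x y -> lcong x y
| lc_refl x : lcong x x
| lc_sym x y : lcong x y -> lcong y x
| lc_trans x y z : lcong x y -> lcong y z -> lcong x z
| lc_add x x' y y' : lcong x x' -> lcong y y' -> lcong (TAdd x y) (TAdd x' y')
| lc_opp x x' : lcong x x' -> lcong (TOpp x) (TOpp x')
| lc_scale a x x' : lcong x x' -> lcong (TScale a x) (TScale a x')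
| lc_part p x x' : lcong x x' -> lcong (TPart p x) (TPart p x')
| lc_brk x x' y y' : lcong x x' -> lcong y y' -> lcong (TBrk x y) (TBrk x' y')
| lc_addA x y z : lcong (TAdd x (TAdd y z)) (TAdd (TAdd x y) z)
| lc_addC x y : lcong (TAdd x y) (TAdd y x)
| lc_add0 x : lcong (TAdd TZero x) x
| lc_addN x : lcong (TAdd (TOpp x) x) TZero
| lc_scaleA a b x : lcong (TScale a (TScale b x)) (TScale (a * b) x)
| lc_scale1 x : lcong (TScale 1 x) x
| lc_scaleDr a x y :
    lcong (TScale a (TAdd x y)) (TAdd (TScale a x) (TScale a y))
| lc_scaleDl x a b :
    lcong (TScale (a + b) x) (TAdd (TScale a x) (TScale b x))
| lc_partP p a x y : lcong (TPart p (TAdd (TScale a x) y))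
                           (TAdd (TScale a (TPart p x)) (TPart p y))
| lc_part_sum x : lcong (TAdd (TPart false x) (TPart true x)) x
| lc_part_part p q x :
    lcong (TPart p (TPart q x)) (if p == q then TPart q x else TZero)
| lc_brkPl z a x y : lcong (TBrk (TAdd (TScale a x) y) z)
                           (TAdd (TScale a (TBrk x z)) (TBrk y z))
| lc_brkPr z a x y : lcong (TBrk z (TAdd (TScale a x) y))
                           (TAdd (TScale a (TBrk z x)) (TBrk z y))
| lc_brk_even p q x y : lcong (TPart (p (+) q) (TBrk (TPart p x) (TPart q y)))
                              (TBrk (TPart p x) (TPart q y))
| lc_brk_skew p q x y :
    lcong (TBrk (TPart p x) (TPart q y))
          (TOpp (TScale ((-1) ^+ (p && q)) (TBrk (TPart q y) (TPart p x))))
| lc_brk_jacobi p q x y z :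
    lcong (TBrk (TPart p x) (TBrk (TPart q y) z))
          (TAdd (TBrk (TBrk (TPart p x) (TPart q y)) z)
                (TScale ((-1) ^+ (p && q))
                        (TBrk (TPart q y) (TBrk (TPart p x) z)))).

Definition presentation : lieSetoid C :=
  LieSetoid lc_refl lc_sym lc_trans lc_add lc_opp lc_scale lc_part lc_brk
    lc_addA lc_addC lc_add0 lc_addN lc_scaleA lc_scale1 lc_scaleDr lc_scaleDl
    lc_partP lc_part_sum lc_part_part lc_brkPl lc_brkPr
    lc_brk_even lc_brk_skew lc_brk_jacobi.

Definition presLie : lieSuperType C := lieQuot presentation.

Definition pres_gen (x : X) : presLie := lqpi (TGen x : ls_car presentation).

End Presentation.

Definition quasi_toral (C : fieldType) (h : lieSuperType C) :=
  forall x y : h, brk (part false x) y = 0.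

(* The rank of the symmetric form (x, y) |-> lam [x, y] on the odd part of h,
   as the rank of its Gram matrix on the spanning family formed by the odd
   components of a basis of h. *)
Definition rk (C : fieldType) (h : finLieSuperType C) (lam : h -> C) : nat :=
  let b := vbasis {:h} in
  \rank (\matrix_(i < \dim {:h}, j < \dim {:h})
           lam (brk (part true (b`_i)) (part true (b`_j)))).

(* Semisimplicity of the action of the even part is not recorded here: every
   module below has it acting through a weight. *)
Record hmodule (C : fieldType) (h : finLieSuperType C) := HModule {
  hm_car :> finSuperspaceType C;
  act : h -> hm_car -> hm_car;
  act_linearl : forall v, linear (act^~ v);
  act_linearr : forall x, linear (act x);
  act_even : forall p q x v,
    part (p (+) q) (act (part p x) (part q v)) = act (part p x) (part q v);
  act_brk : forall p q x y v,
    act (brk (part p x) (part q y)) v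
    = act (part p x) (act (part q y) v)
      - (-1) ^+ (p && q) *: act (part q y) (act (part p x) v)
}.

Section ModuleNotions.
Variables (C : fieldType) (h : finLieSuperType C).

Definition is_submod (V : hmodule h) (U : {vspace V}) : Prop :=
  (forall p v, v \in U -> part p v \in U)
  /\ (forall x v, v \in U -> act x v \in U).

Definition irreducible_mod (V : hmodule h) : Prop :=
  {:V}%VS != 0%VS
  /\ forall U : {vspace V}, is_submod U -> U = 0%VS \/ U = {:V}%VS.

Definition is_mod_iso (V W : hmodule h) (f : {linear V -> W}) : Prop :=
  [/\ bijective f,
      forall p v, f (part p v) = part p (f v)
    & forall x v, f (act x v) = act x (f v)].

End ModuleNotions.

Section Vee.
Variables (C : numClosedFieldType) (h : finLieSuperType C).
Hypothesis qt : quasi_toral h.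

Definition omega (x : h) : h := - part false x + 'i *: part true x.
Definition omegaV (x : h) : h := - part false x - 'i *: part true x.

Lemma omegaK : cancel omega omegaV.
Proof.
move=> x; rewrite /omega /omegaV !partD !partZ -!scaleN1r !partZ !part_part /=.
rewrite !scaler0 !addr0 !add0r !scalerA mulrNN mulr1 scale1r.
by rewrite -mulrA -expr2 sqrCi mulrNN mulr1 scale1r part_sum.
Qed.

Lemma omegaVK : cancel omegaV omega.
Proof.
move=> x; have p0 : part false (omegaV x) = - part false x.
  by rewrite /omegaV partB -scaleN1r !partZ !part_part /= scaler0 subr0.
have p1 : part true (omegaV x) = - ('i *: part true x).
  by rewrite /omegaV partB -scaleN1r !partZ !part_part /= scaler0 sub0r.
rewrite /omega p0 p1 opprK scalerN scalerA -expr2 sqrCi scaleN1r opprK.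
exact: part_sum.
Qed.

Variable V : hmodule h.

Definition vee_act (x : h) (v : V) : V := act (omegaV x) v.

Let wt (p : bool) : C := if p then - 'i else -1.

Let omegaV_part p x : omegaV (part p x) = wt p *: part p x.
Proof.
rewrite /omegaV !part_part; case: p => /=.
  by rewrite oppr0 add0r scaleNr.
by rewrite scaler0 subr0 scaleN1r.
Qed.

Let actZ a x v : act (a *: x) v = a *: act x v :> V.
Proof.
have act0 : act 0 v = 0 :> V.
  apply: (addrI (act 0 v)); have := act_linearl v 1 0 0.
  by rewrite !scale1r !addr0 => <-.
by have := act_linearl v a x 0; rewrite /= !addr0 act0 addr0.
Qed.

Let actZr a x v : act x (a *: v) = a *: act x v :> V.
Proof.
have act0 : act x 0 = 0 :> V.
  apply: (addrI (act x 0)); have := act_linearr x 1 (0 : V) 0.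
  by rewrite !scale1r !addr0 => <-.
by have := act_linearr x a v 0; rewrite /= !addr0 act0 addr0.
Qed.

Lemma vee_linearl v : linear (vee_act^~ v).
Proof.
move=> a x y; rewrite /= /vee_act -act_linearl; congr (act _ _).
by rewrite /omegaV !part_linear !(scalerDr, scalerN, opprD) !scalerA
  [a * _]mulrC addrACA.
Qed.
Lemma vee_linearr x : linear (vee_act x).
Proof. exact: act_linearr. Qed.
Lemma vee_even p q x v :
  part (p (+) q) (vee_act (part p x) (part q v)) = vee_act (part p x) (part q v).
Proof. by rewrite /vee_act omegaV_part actZ partZ act_even. Qed.
Lemma vee_brk p q x y v :
  vee_act (brk (part p x) (part q y)) v
  = vee_act (part p x) (vee_act (part q y) v)
    - (-1) ^+ (p && q) *: vee_act (part q y) (vee_act (part p x) v).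
Proof.
rewrite /vee_act !omegaV_part !(actZ, actZr).
transitivity ((wt p * wt q) *: act (brk (part p x) (part q y)) v); last first.
  by rewrite act_brk scalerBr !scalerA; congr (_ - _ *: _); ring.
have [/andP[pT qT]|npq] := boolP (p && q).
  rewrite -[brk _ _]brk_even omegaV_part brk_even actZ pT qT /=.
  by rewrite mulrNN -expr2 sqrCi.
suff -> : brk (part p x) (part q y) = 0.
  have o0 : omegaV 0 = 0.
    have p0 b : part b (0 : h) = 0 by exact: linear0.
    by rewrite /omegaV !p0 scaler0 subr0 oppr0.
  rewrite o0; have := actZ 0 0 v; rewrite !scale0r => ->.
  by rewrite !scaler0.
case: p q npq => [] [] // _; rewrite ?qt //.
by rewrite brk_skew qt scaler0 oppr0.
Qed.

Definition vee : hmodule h :=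
  HModule vee_linearl vee_linearr vee_even vee_brk.

End Vee.

(* Elements of t^* are linear forms on h vanishing on its odd part. *)
Record cartanDatum (C : numClosedFieldType) := CartanDatum {
  cd_h : finLieSuperType C;
  cd_qt : quasi_toral cd_h;
  cd_n : nat;
  alpha : 'I_cd_n -> {scalar cd_h};
  alpha_odd : forall i x, alpha i (part true x) = 0;
  alpha_indep : forall c : 'I_cd_n -> C,
    (forall x, \sum_i c i * alpha i x = 0) -> forall i, c i = 0;
  gpos : 'I_cd_n -> hmodule cd_h;
  gneg : 'I_cd_n -> hmodule cd_h;
  gpos_wt : forall i x (v : gpos i), act (part false x) v = alpha i x *: v;
  gneg_wt : forall i x (v : gneg i), act (part false x) v = - alpha i x *: v;
  rpair : forall i, gpos i -> gneg i -> cd_h;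
  rpair_linearl : forall i y, linear ((@rpair i)^~ y);
  rpair_linearr : forall i x, linear (@rpair i x);
  rpair_even : forall i p q x y,
    part (p (+) q) (@rpair i (part p x) (part q y)) = rpair (part p x) (part q y);
  rpair_act : forall i p q u x y,
    brk (part p u) (@rpair i (part q x) y)
    = rpair (act (part p u) (part q x)) y
      + (-1) ^+ (p && q) *: rpair (part q x) (act (part p u) y);
  rpair_nondegl : forall i (U : {vspace gpos i}),
    is_submod U -> U != 0%VS -> exists x y, x \in U /\ @rpair i x y <> 0;
  rpair_nondegr : forall i (U : {vspace gneg i}),
    is_submod U -> U != 0%VS -> exists x y, y \in U /\ @rpair i x y <> 0
}.

Section KacMoody.
Variables (C : numClosedFieldType) (A : cartanDatum C).

Notation h := (cd_h A).
Notation n := (cd_n A).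

Inductive gens :=
| GH of h
| GP (i : 'I_n) of gpos i
| GM (i : 'I_n) of gneg i.

Notation tH x := (TGen C (GH x)).
Notation tP i x := (TGen C (@GP i x)).
Notation tM i x := (TGen C (@GM i x)).

Inductive gt_rel : lterm C gens -> lterm C gens -> Prop :=
| gt_linH a x y : gt_rel (tH (a *: x + y)) (TAdd (TScale a (tH x)) (tH y))
| gt_linP i a x y : gt_rel (tP i (a *: x + y)) (TAdd (TScale a (tP i x)) (tP i y))
| gt_linM i a x y : gt_rel (tM i (a *: x + y)) (TAdd (TScale a (tM i x)) (tM i y))
| gt_partH p x : gt_rel (tH (part p x)) (TPart p (tH x))
| gt_partP i p x : gt_rel (tP i (part p x)) (TPart p (tP i x))
| gt_partM i p x : gt_rel (tM i (part p x)) (TPart p (tM i x))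
| gt_HH x y : gt_rel (TBrk (tH x) (tH y)) (tH (brk x y))
| gt_HP i x v : gt_rel (TBrk (tH x) (tP i v)) (tP i (act x v))
| gt_HM i x v : gt_rel (TBrk (tH x) (tM i v)) (tM i (act x v))
| gt_PM i x y : gt_rel (TBrk (tP i x) (tM i y)) (tH (rpair x y))
| gt_PM0 i j x y : i != j -> gt_rel (TBrk (tP i x) (tM j y)) (TZero C gens).

Definition gtilde : lieSuperType C := presLie gt_rel.
Definition gt_gen : gens -> gtilde := @pres_gen C gens gt_rel.

(* The unique maximal graded ideal meeting h trivially, constructed as the sum
   of all graded ideals meeting h trivially: every such ideal is contained in
   the sum, and the sum is one of them because ideals are stable under taking
   weight components. *)
Definition meets_h_trivially (I : lieIdeal gtilde) : Prop :=
  forall x : h, I (gt_gen (GH x)) -> gt_gen (GH x) = 0.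

Inductive rad_mem : gtilde -> Prop :=
| rad_in (I : lieIdeal gtilde) x : meets_h_trivially I -> I x -> rad_mem x
| rad_add x y : rad_mem x -> rad_mem y -> rad_mem (x + y).

Lemma zero_lin a (x y : gtilde) : x = 0 -> y = 0 -> a *: x + y = 0.
Proof. by move=> -> ->; rewrite scaler0 addr0. Qed.
Lemma zero_part p (x : gtilde) : x = 0 -> part p x = 0.
Proof. by move=> ->; apply: linear0. Qed.
Lemma zero_brk (x y : gtilde) : y = 0 -> brk x y = 0.
Proof. by move=> ->; apply: linear0. Qed.

Definition zero_ideal : lieIdeal gtilde :=
  @LieIdeal C gtilde (fun x => x = 0) erefl zero_lin zero_part zero_brk.

Lemma rad0 : rad_mem 0.
Proof. by apply: (@rad_in zero_ideal). Qed.

Lemma radP a x y : rad_mem x -> rad_mem y -> rad_mem (a *: x + y).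
Proof.
move=> rx ry; apply: rad_add ry; elim: rx => [I z mI Iz|z t _ rz _ rt].
  by apply: (rad_in mI); apply: liZ.
by rewrite scalerDr; apply: rad_add.
Qed.

Lemma rad_part p x : rad_mem x -> rad_mem (part p x).
Proof.
elim=> [I z mI Iz|z t _ rz _ rt]; first by apply: (rad_in mI); apply: li_part.
by rewrite partD; apply: rad_add.
Qed.

Lemma rad_brk x y : rad_mem y -> rad_mem (brk x y).
Proof.
elim=> [I z mI Iz|z t _ rz _ rt]; first by apply: (rad_in mI); apply: li_brk.
by rewrite brkDr; apply: rad_add.
Qed.

Definition rad : lieIdeal gtilde := LieIdeal rad0 radP rad_part rad_brk.

Definition gKM : lieSuperType C := quotLie rad.

Definition gK_gen (x : gens) : gKM := quot_pi rad (gt_gen x).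

(* The image in g(A) of g_(alpha_i) for [s = false], of g_(-alpha_i) for
   [s = true]. *)
Definition groot (s : bool) (i : 'I_n) (x : gKM) : Prop :=
  if s then exists v, x = gK_gen (@GM i v) else exists v, x = gK_gen (@GP i v).

(* g<alpha_i>; it is graded, being generated by graded subspaces *)
Inductive gsub (i : 'I_n) : gKM -> Prop :=
| gsub_gen s x : groot s i x -> gsub i x
| gsub_lin a x y : gsub i x -> gsub i y -> gsub i (a *: x + y)
| gsub_brk x y : gsub i x -> gsub i y -> gsub i (brk x y).

Definition hroot (i : 'I_n) : {vspace h} :=
  <<[seq rpair x y | x <- vbasis {:gpos i}, y <- vbasis {:gneg i}]>>%VS.

(* [h_(alpha_i), g_(alpha_j)] = 0 *)
Definition hroot_kills (i j : 'I_n) : Prop :=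
  forall x (v : gpos j), x \in hroot i -> act x v = 0.

Definition KM1 : Prop :=
  forall (s : bool) (i : 'I_n) (t : bool) (j : 'I_n), exists N : nat,
  forall (xs : seq gKM) (y : gKM), size xs = N ->
    (forall x, x \in xs -> groot s i x) -> groot t j y ->
    foldr brk y xs = 0.

Definition KM2 : Prop := forall i j : 'I_n, hroot_kills i j -> hroot_kills j i.

Definition KM3 : Prop := forall i : 'I_n, rk (alpha i) = 2%N.

Definition KM4 : Prop := forall i : 'I_n, irreducible_mod (gpos i)
  /\ exists f : {linear vee (@cd_qt C A) (gpos i) -> gneg i}, is_mod_iso f.

Definition KM5 : Prop := forall i : 'I_n,
  ~~ (hroot i <= \sum_(j | j != i) hroot j)%VS.

Definition QKM : Prop := [/\ KM1, KM2, KM3, KM4 & KM5].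

Definition indecomposable : Prop := forall S : {set 'I_n},
  S != set0 -> S != [set: 'I_n] ->
  ~ (forall i j, i \in S -> j \notin S -> hroot_kills i j /\ hroot_kills j i).

Inductive gdeg : int -> gKM -> Prop :=
| gdeg_h x : gdeg 0 (gK_gen (GH x))
| gdeg_p i v : gdeg 1 (gK_gen (@GP i v))
| gdeg_m i v : gdeg (-1) (gK_gen (@GM i v))
| gdeg_0 k : gdeg k 0
| gdeg_lin k a x y : gdeg k x -> gdeg k y -> gdeg k (a *: x + y)
| gdeg_brk k l x y : gdeg k x -> gdeg l y -> gdeg (k + l) (brk x y).

(* dim W <= d *)
Definition dim_le (d : nat) (W : gKM -> Prop) : Prop :=
  exists b : 'I_d -> gKM,
    forall x, W x -> exists c : 'I_d -> C, x = \sum_i c i *: b i.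

Definition finite_growth : Prop :=
  exists P : {poly nat}, forall k : int, dim_le P.[`|k|%N] (gdeg k).

End KacMoody.

Inductive takType := TakSL2 | TakOSP12 | TakSL11.

Definition tak_base (C : fieldType) (t : takType) : quadLieSuperType C :=
  match t with
  | TakSL2 => sl C 2 0
  | TakOSP12 => osp12 C
  | TakSL11 => sl C 1 1
  end.

(* g<alpha_i> is a quotient of ts by an ideal contained in C c: it is the image
   of a morphism from ts whose kernel is contained in C c. *)
Definition has_type (C : numClosedFieldType) (A : cartanDatum C)
    (i : 'I_(cd_n A)) (t : takType) : Prop :=
  exists f : {linear takiff (tak_base C t) -> gKM A},
    [/\ forall p u, f (part p u) = part p (f u),
        forall u v, f (brk u v) = brk (f u) (f v),
        forall x, gsub i x <-> exists u, x = f u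
      & forall u, f u = 0 -> u.1 = 0].

(* [gen_odd t] is the parity of e_i *)
Definition gen_odd (t : takType) : bool := if t is TakSL2 then false else true.

Record generators (C : numClosedFieldType) (A : cartanDatum C) := Generators {
  gtype : 'I_(cd_n A) -> takType;
  gtypeP : forall i, has_type i (gtype i);
  gvee : forall i, {linear vee (@cd_qt C A) (gpos i) -> gneg i};
  gveeP : forall i, is_mod_iso (gvee i);
  ge : forall i, gpos i;
  gE : forall i, gpos i;
  ge_neq0 : forall i, ge i != 0;
  gE_neq0 : forall i, gE i != 0;
  ge_part : forall i, part (gen_odd (gtype i)) (ge i) = ge i;
  gE_part : forall i, part (~~ gen_odd (gtype i)) (gE i) = gE i;
  gf := fun i => (if gen_odd (gtype i) then 'i else 1) *: gvee i (ge i);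
  gF := fun i => (if gen_odd (gtype i) then 1 else 'i) *: gvee i (gE i);
  gh := fun i => rpair (ge i) (gf i);
  gc := fun i => rpair (gE i) (gF i);
  (* Also [e_i, F_i]: for odd x in h with x e_i <> 0 or x E_i <> 0, expand
     0 = [x, h_i] or 0 = [x, c_i]. *)
  gH := fun i => rpair (gE i) (gf i);
  g_scale : forall i, match gtype i with
                      | TakSL2 => alpha i (gh i) = 2
                      | TakOSP12 => alpha i (gh i) = 1
                      | TakSL11 => True
                      end;
  gX : 'M[C]_(cd_n A);
  gY : 'M[C]_(cd_n A);
  gXP : forall i j, act (gH i) (ge j) = gX i j *: gE j;
  gYP : forall i j, act (gH i) (gE j) = gY i j *: ge j
}.

Section Coupling.
Variables (C : numClosedFieldType) (A : cartanDatum C) (G : generators A).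

Definition connected (i j : 'I_(cd_n A)) : Prop :=
  i != j /\ alpha i (gh G j) * alpha j (gh G i) != 0.

Definition coupled (i j : 'I_(cd_n A)) : Prop :=
  [/\ connected i j, alpha i (gc G j) = 0 & alpha j (gc G i) = 0].

Definition completely_X_coupled : Prop := forall i j, i != j -> gX G i j = 0.

Definition completely_Y_coupled : Prop := gY G = 0.

Definition completely_uncoupled : Prop :=
  forall i j, connected i j -> ~ coupled i j.

End Coupling.

(* Main.v *)
(** An odd [x] in [h] acts on the root space spanned by [e_i] and [E_i] through two
    independent linear forms: [x e_i = a_i(x) E_i], [x E_i = b_i(x) e_i].
    Hence [[x, H_i] = b_i(x) h_i + a_i(x) c_i], and evaluating roots on this
    gives linear relations between the [x_ij], [y_ij], [alpha_j(h_i)] and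
    [alpha_j(c_i)].  Integrability makes [alpha_j(h_i)] a nonpositive integer
    when [alpha_i] is not of type [Tak(sl(1|1))], makes [alpha_j(c_i)] vanish when
    it is not of type [Tak(sl(2))], and forces [y_ii = 0].

    A coupled pair with [y_ij <> 0] then has [x_ij = x_ji = 0] and [h_i] is a negative
    multiple of [h_j]; a third simple root joined to it would be nonpositive on
    both, so there is none and the datum is completely X-coupled.
    Otherwise coupled edges have [y = 0], and if uncoupled edges exist as well,
    an uncoupled edge [i - j] meets a coupled edge [j - k].  The relations
    leave only the case where [i - k] is uncoupled too, all three roots are of
    type [Tak(sl(2))], and one of the products
    [alpha_j(h_i) alpha_i(h_j)] of the triangle is at least 4.

    This contradicts finite growth.  For simple roots 1, 2, 3 with
    [alpha_2(h_1) alpha_1(h_2) >= 4], iterating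
    [(beta_1, beta_2) |-> (s_2 beta_1, s_1 beta_2)] gives real roots [beta_1] whose
    coroot takes an unbounded value [- P] on [alpha_3], in degree O(P).  Elements of the
    [beta_1]-string through [alpha_3] that are far apart commute with each
    other's opposites, so iterated brackets of distinct ones, chosen in
    2^(P/12) ways of equal degree, are linearly independent. *)

(* Integrability constrains weights only through vectors known to be nonzero, while $\mathfrak
   g(\mathcal A)$ is a quotient of a presented algebra in which no generator is visibly nonzero. So
   each $\mathfrak g_{\alpha_i}$ must first be shown to embed. By irreducibility it is enough that
   some bracket in $\mathfrak h_{\alpha_i}$ survives. An element of $\mathfrak h$ acting
   nontrivially on some $\mathfrak g_{\alpha_k}$ does survive: $\tilde{\mathfrak g}$ acts on the
   module coinduced from $\mathfrak g_{\alpha_k}$, and the radical has no component there along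
   $\mathfrak g_{\alpha_k}$. Indecomposability supplies such a $k$.

   The growth argument uses no structure theory of the subalgebra generated by the triangle:
   independence is tested by lowering explicit brackets back to $e_3$. The threshold 4 keeps the
   reflected roots crosswise commuting and their Cartan integers negative, so that the iteration
   goes on forever. The 12 in the exponent is the size of a block of positions in the string: four
   positions at mutual distance at least three give one binary choice. *)
From HB Require Import structures.
Require Import Defs.
From mathcomp Require Import all_boot all_order all_algebra.
From mathcomp Require Import ring zify.
From mathcomp Require Import boolp functions.
From mathcomp Require Import reals complex.

Set Implicit Arguments.
Unset Strict Implicit.
Unset Printing Implicit Defensive.

Import Order.TTheory GRing.Theory Num.Theory.
Local Open Scope ring_scope.

(* Reflexive proof of identities between linear combinations in a module: it
   is enough that the coefficients of each atom agree. *)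
Section VectorIdentities.
Variables (C : comRingType) (V : lmodType C).

Inductive vexpr :=
| VAtom of nat
| VZero
| VAdd of vexpr & vexpr
| VOpp of vexpr
| VScale of C & vexpr.

Fixpoint veval (env : seq V) (e : vexpr) : V :=
  match e with
  | VAtom k => nth 0 env k
  | VZero => 0
  | VAdd a b => veval env a + veval env b
  | VOpp a => - veval env a
  | VScale k a => k *: veval env a
  end.

Fixpoint vcoef (e : vexpr) (i : nat) : C :=
  match e with
  | VAtom k => if Nat.eqb k i then 1 else 0
  | VZero => 0
  | VAdd a b => vcoef a i + vcoef b i
  | VOpp a => - vcoef a i
  | VScale k a => k * vcoef a i
  end.

Lemma vevalE env e :
  veval env e = \sum_(i < size env) vcoef e i *: nth 0 env i.
Proof.
elim: e => [k||a IHa b IHb|a IHa|k a IHa] /=.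
- have [ksz|ksz] := ltnP k (size env); last first.
    rewrite nth_default // big1 // => i _.
    by case: (PeanoNat.Nat.eqb_spec k i) => [ki|]; [rewrite ki leqNgt ltn_ord in ksz | rewrite scale0r].
  rewrite (bigD1 (Ordinal ksz)) //= PeanoNat.Nat.eqb_refl scale1r big1 ?addr0 //.
  move=> i /eqP ik; case: (PeanoNat.Nat.eqb_spec k i) => [ki|]; last by rewrite scale0r.
  by case: ik; apply: val_inj.
- by rewrite big1 // => i _; rewrite scale0r.
- by rewrite IHa IHb -big_split; apply: eq_bigr => i _; rewrite scalerDl.
- by rewrite IHa -sumrN; apply: eq_bigr => i _; rewrite scaleNr.
- by rewrite IHa scaler_sumr; apply: eq_bigr => i _; rewrite scalerA.
Qed.

Definition vcheck (e1 e2 : vexpr) (s : seq nat) : Prop :=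
  foldr (fun i P => vcoef e1 i = vcoef e2 i /\ P) True s.

Lemma vcheckP env e1 e2 :
  vcheck e1 e2 (iota 0 (size env)) -> veval env e1 = veval env e2.
Proof.
move=> chk; rewrite !vevalE; apply: eq_bigr => i _; congr (_ *: _).
have : (i : nat) \in iota 0 (size env) by rewrite mem_iota /= ltn_ord.
rewrite /vcheck in chk; move: chk; elim: (iota _ _) => //= j s IH [ej es].
by rewrite inE => /orP[/eqP->//|/(IH es)].
Qed.

End VectorIdentities.

Ltac v_index a env :=
  lazymatch env with
  | a :: _ => constr:(0%N)
  | _ :: ?e => let k := v_index a e in constr:(S k)
  end.
Ltac v_mem a env :=
  lazymatch env with
  | nil => constr:(false)
  | a :: _ => constr:(true)
  | _ :: ?e => v_mem a e
  end.
Ltac v_atoms env t :=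
  lazymatch t with
  | 0%R => env
  | (?a + ?b)%R => let env1 := v_atoms env a in v_atoms env1 b
  | (- ?a)%R => v_atoms env a
  | (_ *: ?a)%R => v_atoms env a
  | _ => lazymatch v_mem t env with
         | true => env
         | false => constr:(t :: env)
         end
  end.
Ltac v_reify C env t :=
  lazymatch t with
  | 0%R => constr:(VZero C)
  | (?a + ?b)%R => let x := v_reify C env a in let y := v_reify C env b in
                   constr:(VAdd x y)
  | (- ?a)%R => let x := v_reify C env a in constr:(VOpp x)
  | (?k *: ?a)%R => let x := v_reify C env a in constr:(VScale (k : C) x)
  | _ => let k := v_index t env in constr:(VAtom C k)
  end.
Ltac vcoefs C :=
  lazymatch goal with
  | |- @eq ?V ?l ?r =>
    let env0 := v_atoms (@nil V) l in
    let env := v_atoms env0 r in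
    let e1 := v_reify C env l in
    let e2 := v_reify C env r in
    apply: (@vcheckP C _ env e1 e2);
    cbv [vcheck foldr iota size vcoef Nat.eqb]; repeat split
  end.
Ltac vring C := vcoefs C; ring.

(* The same instance may be reached along several inheritance paths; [vfold]
   makes such convertible atoms syntactically equal. *)
Ltac vfold_pair a b :=
  tryif constr_eq a b then idtac else tryif unify a b then change b with a else idtac.
Ltac vfold_with a env :=
  lazymatch env with
  | nil => idtac
  | ?b :: ?e => vfold_pair a b; vfold_with a e
  end.
Ltac vfold_atoms env :=
  lazymatch env with
  | nil => idtac
  | ?a :: ?e => vfold_with a e; vfold_atoms e
  end.
Ltac vfold :=
  lazymatch goal with
  | |- @eq ?V ?l ?r =>
    let env0 := v_atoms (@nil V) l in
    let env := v_atoms env0 r in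
    vfold_atoms env
  end.

(** * Modules over a presented Lie superalgebra *)

(* An odd or even operator is tagged by a formal parity, so that the module [M]
   carries no grading of its own; [ML] is the subspace on which the relations
   are required to hold. *)
Section PresentedModules.
Variables (C : fieldType) (X : Type) (M : lmodType C) (ML : M -> Prop).

Definition opfam := bool -> M -> M.

Definition op_ok (A : opfam) : Prop :=
  (forall p, linear (A p)) /\ (forall p f, ML f -> ML (A p f)).

Definition op_eq (A B : opfam) : Prop := forall p f, ML f -> A p f = B p f.

(** The supercommutator sorted by formal parity: parity [r] collects [A false] with [B r] and
    [A true] with [B (~~ r)], and two odd factors meet exactly when [~~ r] holds. *)
Definition opbrk (A B : opfam) : opfam := fun r f =>
  (A false (B r f) - B r (A false f))
  + (A true (B (~~ r) f) - (-1) ^+ (~~ r) *: B (~~ r) (A true f)).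

Variable g : X -> opfam.

Fixpoint tev (t : lterm C X) : opfam :=
  match t with
  | TGen x => g x
  | TZero => fun _ _ => 0
  | TAdd a b => fun p f => tev a p f + tev b p f
  | TOpp a => fun p f => - tev a p f
  | TScale k a => fun p f => k *: tev a p f
  | TPart q a => fun p f => if p == q then tev a p f else 0
  | TBrk a b => opbrk (tev a) (tev b)
  end.

Hypothesis ML0 : ML 0.
Hypothesis MLP : forall a f f', ML f -> ML f' -> ML (a *: f + f').
Hypothesis g_ok : forall x, op_ok (g x).

Let MLD f f' : ML f -> ML f' -> ML (f + f').
Proof. by move=> Mf Mf'; rewrite -[f]scale1r; apply: MLP. Qed.
Let MLZ a f : ML f -> ML (a *: f).
Proof. by move=> Mf; rewrite -[_ *: _]addr0; apply: MLP. Qed.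
Let MLN f : ML f -> ML (- f).
Proof. by move=> Mf; rewrite -scaleN1r; apply: MLZ. Qed.

Lemma opbrk_ok A B : op_ok A -> op_ok B -> op_ok (opbrk A B).
Proof.
move=> [lA mA] [lB mB]; split=> p.
  by move=> a f f'; rewrite /opbrk !lB !lA !lB; vring C.
move=> f Mf; have AB q r : ML (A q (B r f)) by exact: (mA _ _ (mB _ _ Mf)).
have BA q r : ML (B q (A r f)) by exact: (mB _ _ (mA _ _ Mf)).
by do !apply: MLD => //; apply: MLN => //; apply: MLZ.
Qed.

Lemma tev_ok t : op_ok (tev t).
Proof.
elim: t => [x||a [la ma] b [lb mb]|a [la ma]|k a [la ma]|q a [la ma]|a oa b ob] /=.
- exact: g_ok.
- by split=> // p a f f'; rewrite scaler0 addr0.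
- split=> p; first by move=> k f f'; rewrite la lb; vring C.
  by move=> f Mf; apply: MLD; [apply: ma | apply: mb].
- split=> p; first by move=> k f f'; rewrite la; vring C.
  by move=> f Mf; apply/MLN/ma.
- split=> p; first by move=> k' f f'; rewrite la; vring C.
  by move=> f Mf; apply/MLZ/ma.
- split=> p; first by move=> k f f'; case: eqP => _; rewrite ?la ?scaler0 ?addr0.
  by move=> f Mf; case: eqP => _ //; apply: ma.
- exact: opbrk_ok.
Qed.

Let ok0 A p : op_ok A -> A p 0 = 0.
Proof. by case=> lA _; have := lA p (-1) 0 0; rewrite scaler0 addr0 scaleN1r addNr. Qed.
Let okD A p f f' : op_ok A -> A p (f + f') = A p f + A p f'.
Proof. by case=> lA _; have := lA p 1 f f'; rewrite !scale1r. Qed.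
Let okZ A p k f : op_ok A -> A p (k *: f) = k *: A p f.
Proof. by move=> oA; case: (oA) => lA _; have := lA p k f 0; rewrite ok0 // !addr0. Qed.
Let okN A p f : op_ok A -> A p (- f) = - A p f.
Proof. by move=> oA; rewrite -scaleN1r okZ // scaleN1r. Qed.

Lemma op_eq_brk A A' B B' : op_ok A -> op_ok B -> op_ok A' -> op_ok B' ->
  op_eq A A' -> op_eq B B' -> op_eq (opbrk A B) (opbrk A' B').
Proof.
move=> [_ mA] [_ mB] [_ mA'] [_ mB'] eA eB r f Mf; rewrite /opbrk.
have E p q : A p (B q f) = A' p (B' q f) by rewrite eB // eA //; apply: mB'.
have F p q : B q (A p f) = B' q (A' p f) by rewrite eA // eB //; apply: mA'.
by rewrite !E !F.
Qed.

Variable rel : lterm C X -> lterm C X -> Prop.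
Hypothesis rel_ok : forall a b, rel a b -> op_eq (tev a) (tev b).

(** Supercommutators of operators satisfy the axioms of a Lie superalgebra, so only [rel] needs a
    hypothesis; invariance of [ML] lets equalities valid on [ML] be used inside compositions. *)
Lemma tev_cong a b : lcong rel a b -> op_eq (tev a) (tev b).
Proof.
elim=> {a b}.
- exact: rel_ok.
- by [].
- by move=> x y _ xy p f Mf; rewrite xy.
- by move=> x y z _ xy _ yz p f Mf; rewrite xy // yz.
- by move=> x x' y y' _ xx _ yy p f Mf /=; rewrite xx // yy.
- by move=> x x' _ xx p f Mf /=; rewrite xx.
- by move=> a x x' _ xx p f Mf /=; rewrite xx.
- by move=> q x x' _ xx p f Mf /=; rewrite xx.
- by move=> x x' y y' _ xx _ yy /=; apply: op_eq_brk => //; apply: tev_ok.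
- by move=> x y z p f Mf /=; rewrite addrA.
- by move=> x y p f Mf /=; rewrite addrC.
- by move=> x p f Mf /=; rewrite add0r.
- by move=> x p f Mf /=; rewrite addNr.
- by move=> a b x p f Mf /=; rewrite scalerA.
- by move=> x p f Mf /=; rewrite scale1r.
- by move=> a x y p f Mf /=; rewrite scalerDr.
- by move=> x a b p f Mf /=; rewrite scalerDl.
- by move=> p a x y q f Mf /=; case: eqP => _; rewrite ?scaler0 ?addr0.
- by move=> x [] f Mf /=; rewrite ?addr0 ?add0r.
- by move=> [] [] x [] f Mf /=.
- by move=> z a x y r f Mf /=; rewrite /opbrk /= !(okD, okZ) //;
    (try exact: tev_ok); vring C.
- by move=> z a x y r f Mf /=; rewrite /opbrk /= !(okD, okZ) //;
    (try exact: tev_ok); vring C.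
- move=> p q x y r f Mf /=; rewrite /opbrk /=; have [ox oy] := (tev_ok x, tev_ok y).
  by case: p q r => [] [] [] /=; rewrite ?(ok0 _ ox) ?(ok0 _ oy) ?scaler0 ?subr0 ?addr0.
- move=> p q x y r f Mf /=; rewrite /opbrk /=; have [ox oy] := (tev_ok x, tev_ok y).
  by case: p q r => [] [] [] /=; rewrite ?(ok0 _ ox) ?(ok0 _ oy); vring C.
- move=> p q x y z r f Mf /=; rewrite /opbrk /=.
  have [ox oy oz] := And3 (tev_ok x) (tev_ok y) (tev_ok z).
  case: p q r => [] [] [] /=;
  rewrite ?(ok0 _ ox, ok0 _ oy, ok0 _ oz, okD _ _ _ ox, okD _ _ _ oy, okD _ _ _ oz,
    okN _ _ ox, okN _ _ oy, okN _ _ oz, okZ _ _ _ ox, okZ _ _ _ oy, okZ _ _ _ oz);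
  vring C.
Qed.

(** A representative is evaluated; by [tev_cong] its choice does not matter on [ML]. *)
Definition gact (z : presLie rel) : opfam := tev (lqrepr z).

Lemma gact_pi t : op_eq (gact (lqpi (S := presentation rel) t)) (tev t).
Proof. exact/tev_cong/(@lqrepr_pi C (presentation rel)). Qed.

Lemma gact_gen x : op_eq (gact (pres_gen rel x)) (g x).
Proof. exact: gact_pi. Qed.

Lemma gact_ok z : op_ok (gact z).
Proof. exact: tev_ok. Qed.

Lemma gactP a x y p f : ML f -> gact (a *: x + y) p f = a *: gact x p f + gact y p f.
Proof.
move=> Mf; rewrite -[x](lqreprK (S := presentation rel)).
rewrite -[y](lqreprK (S := presentation rel)) -lqpiZ -lqpiD !gact_pi //=.
Qed.

Lemma gact_brk x y : op_eq (gact (brk x y)) (opbrk (gact x) (gact y)).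
Proof.
move=> p f Mf; rewrite -[in LHS](lqreprK (S := presentation rel) x).
rewrite -[in LHS](lqreprK (S := presentation rel) y).
by rewrite [brk _ _]lq_brkE gact_pi.
Qed.

End PresentedModules.

(** * Koszul signs and homogeneous components *)

Section SuperspaceFacts.
Variable C : fieldType.

Lemma part0 (V : superspaceType C) p : part p (0 : V) = 0.
Proof. exact: linear0. Qed.

(** The Koszul sign of moving something of parity [p] past [y], extended linearly to inhomogeneous
    [y]. *)
Definition sgp (V : superspaceType C) (p : bool) (y : V) : V :=
  part false y + (-1) ^+ p *: part true y.

Lemma sgpP (V : superspaceType C) p a (x y : V) :
  sgp p (a *: x + y) = a *: sgp p x + sgp p y.
Proof. by rewrite /sgp !partD !partZ; vring C. Qed.
Lemma sgp_part (V : superspaceType C) p q (y : V) :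
  sgp p (part q y) = (-1) ^+ (p && q) *: part q y.
Proof. by rewrite /sgp !part_part; case: p q => [] [] /=; vring C. Qed.
Lemma sgp_sgp (V : superspaceType C) p q (y : V) :
  sgp p (sgp q y) = sgp (p (+) q) y.
Proof.
by rewrite /sgp !partD !partZ !part_part; case: p q => [] [] /=; vring C.
Qed.
Lemma sgpC (V : superspaceType C) p q (y : V) : sgp p (sgp q y) = sgp q (sgp p y).
Proof. by rewrite !sgp_sgp addbC. Qed.
Lemma sgpK (V : superspaceType C) p (y : V) : sgp p (sgp p y) = y.
Proof. by rewrite sgp_sgp addbb /sgp expr0 scale1r part_sum. Qed.
Lemma part_hom (V : superspaceType C) p q (v : V) :
  part p v = v -> part q v = if q == p then v else 0.
Proof. by move=> <-; rewrite part_part; case: eqP. Qed.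

Lemma part_brk (L : lieSuperType C) r (x y : L) : part r (brk x y)
  = brk (part false x) (part r y) + brk (part true x) (part (~~ r) y).
Proof.
rewrite -[x in LHS]part_sum -[y in LHS]part_sum !brkDl !brkDr !partD.
have E p q : part r (brk (part p x) (part q y))
    = if r == p (+) q then brk (part p x) (part q y) else 0.
  by rewrite -[in LHS]brk_even part_part brk_even.
by rewrite !E; case: r {E} => /=; vring C.
Qed.

Section Act.
Variables (h : finLieSuperType C) (V : hmodule h).

Lemma act0l v : act 0 v = 0 :> V.
Proof. by have := act_linearl v (-1) 0 0; rewrite scaler0 addr0 scaleN1r addNr. Qed.
Lemma act0r x : act x 0 = 0 :> V.
Proof. by have := act_linearr x (-1) (0 : V) 0; rewrite scaler0 addr0 scaleN1r addNr. Qed.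
Lemma actDl x y v : act (x + y) v = act x v + act y v :> V.
Proof. by have := act_linearl v 1 x y; rewrite !scale1r. Qed.
Lemma actDr x v w : act x (v + w) = act x v + act x w :> V.
Proof. by have := act_linearr x 1 v w; rewrite !scale1r. Qed.
Lemma actZl a x v : act (a *: x) v = a *: act x v :> V.
Proof. by have := act_linearl v a x 0; rewrite /= act0l !addr0. Qed.
Lemma actZr a x v : act x (a *: v) = a *: act x v :> V.
Proof. by have := act_linearr x a v 0; rewrite /= act0r !addr0. Qed.

Lemma part_act r x (v : V) : part r (act x v)
  = act (part false x) (part r v) + act (part true x) (part (~~ r) v).
Proof.
rewrite -[x in LHS]part_sum -[v in LHS]part_sum !actDl !actDr !partD.
have E p q : part r (act (part p x) (part q v))
    = if r == p (+) q then act (part p x) (part q v) else 0.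
  by rewrite -[in LHS]act_even part_part act_even.
by rewrite !E; case: r {E} => /=; vring C.
Qed.

Lemma sgp_act p q x (v : V) :
  sgp q (act (part p x) v) = (-1) ^+ (p && q) *: act (part p x) (sgp q v).
Proof.
rewrite /sgp !part_act !part_part actDr actZr.
by case: p q => [] [] /=; rewrite ?act0l; vring C.
Qed.

End Act.
End SuperspaceFacts.

(** * A coinduced module for the presented algebra *)

(* [coind] consists of functions on words in the negative root vectors, a word
   [y :: w] standing for the product [w y] with the last factor first.  It is
   the module coinduced from the [h]-module [N], the positive root vectors
   acting by zero on [N]: the operators are found by moving a generator to the
   left of the word. *)
Section Coinduced.
Variables (C : numClosedFieldType) (A : cartanDatum C).
Notation h := (cd_h A).
Notation n := (cd_n A).
Variable N : hmodule h.

Definition letter := {i : 'I_n & gneg i}.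
Definition neg_letter (i : 'I_n) (y : gneg i) : letter := existT _ i y.
Definition lsg p (z : letter) : letter := neg_letter (sgp p (tagged z)).
Definition lact x (z : letter) : letter := neg_letter (act x (tagged z)).

Definition coind := seq letter -> N.
HB.instance Definition _ := GRing.Lmodule.on coind.

(** Multilinearity in the letters, since words stand for tensors. The ambient space consists of all
    functions on words, which keeps the operators below total. *)
Definition ML (f : coind) : Prop := forall w1 w2 i a (y y' : gneg i),
  f (w1 ++ neg_letter (a *: y + y') :: w2) = a *: f (w1 ++ neg_letter y :: w2) + f (w1 ++ neg_letter y' :: w2).

Definition Mop (z : letter) (f : coind) : coind := fun w => f (z :: w).

(** From [(x f)(w z) = f(w z x)] and [z x = x z' - [x, z']], where [z'] is [z] with the sign for
    passing an operator of parity [p]. *)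
Fixpoint Hop_at p (x : h) (f : coind) (w : seq letter) : N :=
  match w with
  | [::] => act x (f [::])
  | z :: w => Hop_at p x (Mop (lsg p z) f) w - f (lact x (lsg p z) :: w)
  end.
Definition Hop p x (f : coind) : coind := Hop_at p x f.

Definition Htot (x : h) (f : coind) : coind :=
  Hop false (part false x) f + Hop true (part true x) f.

(** The default value [0] encodes the relation that opposite root vectors of different simple roots
    commute. *)
Definition lpair i (v : gpos i) (z : letter) : h :=
  untag 0 (fun y : gneg i => rpair v y) z.

(** The rule of [Hop_at] with [[v, z']] now in [h] and possibly of mixed parity, hence [Htot]; the
    empty word gives [0] because positive root vectors kill [N]. *)
Fixpoint Pop_at p i (v : gpos i) (f : coind) (w : seq letter) : N :=
  match w with
  | [::] => 0
  | z :: w => Pop_at p v (Mop (lsg p z) f) w - Htot (lpair v (lsg p z)) f w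
  end.
Definition Pop p i v (f : coind) : coind := @Pop_at p i v f.

Lemma coindD (f f' : coind) w : (f + f') w = f w + f' w. Proof. by []. Qed.
Lemma coindZ a (f : coind) w : (a *: f) w = a *: f w. Proof. by []. Qed.
Lemma coindN (f : coind) w : (- f) w = - f w. Proof. by []. Qed.

Lemma ML0 : ML 0. Proof. by move=> w1 w2 i a y y'; rewrite scaler0 addr0. Qed.
Lemma MLP a f f' : ML f -> ML f' -> ML (a *: f + f').
Proof.
by move=> Mf Mf' w1 w2 i b y y'; rewrite !(coindD, coindZ) Mf Mf'; vring C.
Qed.
Lemma ML_Mop z f : ML f -> ML (Mop z f).
Proof. by move=> Mf w1 w2; apply: (Mf (z :: w1) w2). Qed.

Lemma MopP i a (y y' : gneg i) f : ML f ->
  Mop (neg_letter (a *: y + y')) f = a *: Mop (neg_letter y) f + Mop (neg_letter y') f.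
Proof. by move=> Mf; apply: funext => w; apply: (Mf [::] w). Qed.
Lemma Mop0 i f : ML f -> Mop (neg_letter (0 : gneg i)) f = 0.
Proof.
move=> Mf; have := MopP (-1) (0 : gneg i) 0 Mf.
by rewrite scaler0 addr0 scaleN1r addNr.
Qed.
Lemma MopZ i a (y : gneg i) f : ML f -> Mop (neg_letter (a *: y)) f = a *: Mop (neg_letter y) f.
Proof. by move=> Mf; have := MopP a y 0 Mf; rewrite Mop0 // !addr0. Qed.
Lemma MopD i (y y' : gneg i) f : ML f ->
  Mop (neg_letter (y + y')) f = Mop (neg_letter y) f + Mop (neg_letter y') f.
Proof. by move=> Mf; have := MopP 1 y y' Mf; rewrite !scale1r. Qed.

Lemma MopBZ i a (y y' : gneg i) f : ML f ->
  Mop (neg_letter (y - a *: y')) f = Mop (neg_letter y) f - a *: Mop (neg_letter y') f.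
Proof. by move=> Mf; rewrite -scaleNr addrC MopP // scaleNr addrC. Qed.

Lemma Hop_lin p x : linear (Hop p x).
Proof.
move=> a f f'; apply: funext => w; rewrite coindD coindZ /Hop.
elim: w f f' => [|z w IH] f f' /=; first by rewrite actDr actZr.
have -> : Mop (lsg p z) (a *: f + f') = a *: Mop (lsg p z) f + Mop (lsg p z) f' by [].
by rewrite IH !(coindD, coindZ); vring C.
Qed.
Lemma HopD p x f f' : Hop p x (f + f') = Hop p x f + Hop p x f'.
Proof. by have := Hop_lin p x 1 f f'; rewrite !scale1r. Qed.
Lemma Hop0 p x : Hop p x 0 = 0.
Proof. by have := Hop_lin p x (-1) 0 0; rewrite scaler0 addr0 scaleN1r addNr. Qed.
Lemma HopZ p x a f : Hop p x (a *: f) = a *: Hop p x f.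
Proof. by have := Hop_lin p x a f 0; rewrite Hop0 !addr0. Qed.
Lemma HopN p x f : Hop p x (- f) = - Hop p x f.
Proof. by rewrite -scaleN1r HopZ scaleN1r. Qed.

Lemma Hop_linx p a x x' f : ML f ->
  Hop p (a *: x + x') f = a *: Hop p x f + Hop p x' f.
Proof.
move=> Mf; apply: funext => w; rewrite coindD coindZ /Hop.
elim: w f Mf => [|z w IH] f Mf /=; first by rewrite actDl actZl.
rewrite IH; last exact: ML_Mop.
rewrite {1}/lact actDl actZl -[f (neg_letter _ :: w)]/(Mop (neg_letter _) f w) MopP //.
by rewrite coindD coindZ /Mop /lact; vring C.
Qed.
Lemma Hopx0 p f : ML f -> Hop p 0 f = 0.
Proof.
by move=> Mf; have := Hop_linx p (-1) 0 0 Mf; rewrite scaler0 addr0 scaleN1r addNr.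
Qed.
Lemma HopxD p x x' f : ML f -> Hop p (x + x') f = Hop p x f + Hop p x' f.
Proof. by move=> Mf; have := Hop_linx p 1 x x' Mf; rewrite !scale1r. Qed.

Lemma ML_Hop p x f : ML f -> ML (Hop p x f).
Proof.
move=> + w1 w2 i a y y'; rewrite /Hop.
elim: w1 f => [|z w1 IH] f Mf /=; last first.
  by rewrite IH; [rewrite (Mf (_ :: w1)) /=; vring C | apply: ML_Mop].
rewrite /lsg /= sgpP MopP // -[Hop_at p x (_ + _) _]/(Hop p x _ _) Hop_lin coindD coindZ.
rewrite {1}/lact /= actDr actZr -[f (neg_letter _ :: w2)]/(Mop (neg_letter _) f w2) MopP //.
by rewrite coindD coindZ /Hop /Mop /lact /=; vring C.
Qed.

Lemma Mop_Hop z p x f :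
  Mop z (Hop p x f) = Hop p x (Mop (lsg p z) f) - Mop (lact x (lsg p z)) f.
Proof. by []. Qed.

Lemma Htot_lin x : linear (Htot x).
Proof. by move=> a f f'; rewrite /Htot !Hop_lin; vring C. Qed.
Lemma Htot_linx a x x' f : ML f -> Htot (a *: x + x') f = a *: Htot x f + Htot x' f.
Proof. by move=> Mf; rewrite /Htot !partD !partZ !Hop_linx //; vring C. Qed.
Lemma Htotx0 f : ML f -> Htot 0 f = 0.
Proof. by move=> Mf; rewrite /Htot !part0 !Hopx0 // addr0. Qed.
Lemma HtotxZ a x f : ML f -> Htot (a *: x) f = a *: Htot x f.
Proof. by move=> Mf; have := Htot_linx a x 0 Mf; rewrite Htotx0 // !addr0. Qed.
Lemma HtotxD x x' f : ML f -> Htot (x + x') f = Htot x f + Htot x' f.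
Proof. by move=> Mf; have := Htot_linx 1 x x' Mf; rewrite !scale1r. Qed.
Lemma ML_Htot x f : ML f -> ML (Htot x f).
Proof.
move=> Mf; rewrite /Htot -[X in ML (X + _)]scale1r.
by apply: MLP; apply: ML_Hop.
Qed.
Lemma Htot_hom r x f : ML f -> part r x = x -> Htot x f = Hop r x f.
Proof.
move=> Mf xr; rewrite /Htot !(part_hom _ xr).
by case: r {xr} => /=; rewrite Hopx0 // ?addr0 ?add0r.
Qed.

Lemma lpair_letter i (v : gpos i) (y : gneg i) : lpair v (neg_letter y) = rpair v y.
Proof. by rewrite /lpair (untagE _ _ (erefl : tag (neg_letter y) = i)). Qed.
Lemma lpair_ne i j (v : gpos i) (y : gneg j) : j != i -> lpair v (neg_letter y) = 0.
Proof. by move=> ji; rewrite /lpair untag_dflt. Qed.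

Lemma letterW i (P : letter -> Prop) : (forall y : gneg i, P (neg_letter y)) ->
  (forall j (y : gneg j), j != i -> P (neg_letter y)) -> forall z, P z.
Proof.
move=> Pi Pj [j y]; have [ji|] := eqVneq j i; last exact: Pj.
by subst j; apply: Pi.
Qed.

Lemma rpair0l (i : 'I_n) (y : gneg i) : rpair (0 : gpos i) y = 0.
Proof.
by have := rpair_linearl y (-1) 0 0; rewrite /= scaler0 addr0 scaleN1r addNr.
Qed.
Lemma rpair0r (i : 'I_n) (v : gpos i) : rpair v (0 : gneg i) = 0.
Proof.
by have := rpair_linearr v (-1) 0 0; rewrite /= scaler0 addr0 scaleN1r addNr.
Qed.
Lemma rpairDl (i : 'I_n) (v v' : gpos i) (y : gneg i) : rpair (v + v') y = rpair v y + rpair v' y.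
Proof. by have := rpair_linearl y 1 v v'; rewrite /= !scale1r. Qed.
Lemma rpairDr (i : 'I_n) (v : gpos i) (y y' : gneg i) : rpair v (y + y') = rpair v y + rpair v y'.
Proof. by have := rpair_linearr v 1 y y'; rewrite /= !scale1r. Qed.
Lemma rpairZl (i : 'I_n) a (v : gpos i) (y : gneg i) : rpair (a *: v) y = a *: rpair v y.
Proof. by have := rpair_linearl y a v 0; rewrite /= rpair0l !addr0. Qed.
Lemma rpairZr (i : 'I_n) a (v : gpos i) (y : gneg i) : rpair v (a *: y) = a *: rpair v y.
Proof. by have := rpair_linearr v a y 0; rewrite /= rpair0r !addr0. Qed.

Lemma part_rpair (i : 'I_n) r (v : gpos i) (y : gneg i) : part r (rpair v y)
  = rpair (part false v) (part r y) + rpair (part true v) (part (~~ r) y).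
Proof.
rewrite -[v in LHS]part_sum -[y in LHS]part_sum !rpairDl !rpairDr !partD.
have E p q : part r (rpair (part p v) (part q y))
    = if r == p (+) q then rpair (part p v) (part q y) else 0.
  by rewrite -[in LHS]rpair_even part_part rpair_even.
by rewrite !E; case: r {E} => /=; vring C.
Qed.

Lemma lpair_linl i a (v v' : gpos i) z :
  lpair (a *: v + v') z = a *: lpair v z + lpair v' z.
Proof.
elim/(@letterW i): z => [y|j y ji]; first by rewrite !lpair_letter rpairDl rpairZl.
by rewrite !lpair_ne // scaler0 addr0.
Qed.
Lemma lpair_linr i a (v : gpos i) j (y y' : gneg j) :
  lpair v (neg_letter (a *: y + y')) = a *: lpair v (neg_letter y) + lpair v (neg_letter y').
Proof.
have [ji|ji] := eqVneq j i; last by rewrite !lpair_ne // scaler0 addr0.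
by subst j; rewrite !lpair_letter rpairDr rpairZr.
Qed.
Lemma lpairZr i a (v : gpos i) j (y : gneg j) :
  lpair v (neg_letter (a *: y)) = a *: lpair v (neg_letter y).
Proof.
have [ji|ji] := eqVneq j i; last by rewrite !lpair_ne // scaler0.
by subst j; rewrite !lpair_letter rpairZr.
Qed.
Lemma sgp_lpair i p q (v : gpos i) z :
  sgp p (lpair (part q v) z) = (-1) ^+ (p && q) *: lpair (part q v) (lsg p z).
Proof.
elim/(@letterW i): z => [y|j y ji]; last first.
  by rewrite /lsg !lpair_ne // /sgp !part0 !scaler0 addr0.
rewrite /lsg !lpair_letter /= /sgp !part_rpair !part_part rpairDr rpairZr.
by case: p q => [] [] /=; rewrite ?rpair0l; vring C.
Qed.
Lemma brk_lpair i p q x (v : gpos i) z : brk (part p x) (lpair (part q v) z)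
  = lpair (act (part p x) (part q v)) z
    + (-1) ^+ (p && q) *: lpair (part q v) (lact (part p x) z).
Proof.
elim/(@letterW i): z => [y|j y ji]; last first.
  by rewrite /lact !lpair_ne // linear0 scaler0 addr0.
by rewrite /lact !lpair_letter rpair_act.
Qed.

Lemma Pop_lin p i (v : gpos i) : linear (Pop p v).
Proof.
move=> a f f'; apply: funext => w; rewrite coindD coindZ /Pop.
elim: w f f' => [|z w IH] f f' /=; first by rewrite scaler0 addr0.
have -> : Mop (lsg p z) (a *: f + f') = a *: Mop (lsg p z) f + Mop (lsg p z) f' by [].
by rewrite IH Htot_lin !(coindD, coindZ); vring C.
Qed.
Lemma Pop0 p i (v : gpos i) : Pop p v 0 = 0.
Proof. by have := Pop_lin p v (-1) 0 0; rewrite scaler0 addr0 scaleN1r addNr. Qed.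
Lemma PopZ p i (v : gpos i) a f : Pop p v (a *: f) = a *: Pop p v f.
Proof. by have := Pop_lin p v a f 0; rewrite Pop0 !addr0. Qed.
Lemma PopD p i (v : gpos i) f f' : Pop p v (f + f') = Pop p v f + Pop p v f'.
Proof. by have := Pop_lin p v 1 f f'; rewrite !scale1r. Qed.

Lemma Pop_linx p i a (v v' : gpos i) f : ML f ->
  Pop p (a *: v + v') f = a *: Pop p v f + Pop p v' f.
Proof.
move=> Mf; apply: funext => w; rewrite coindD coindZ /Pop.
elim: w f Mf => [|z w IH] f Mf /=; first by rewrite scaler0 addr0.
rewrite IH; last exact: ML_Mop.
by rewrite lpair_linl Htot_linx // coindD coindZ; vring C.
Qed.
Lemma Popx0 p i f : ML f -> Pop p (0 : gpos i) f = 0.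
Proof.
move=> Mf; have := Pop_linx p (-1) (0 : gpos i) 0 Mf.
by rewrite scaler0 addr0 scaleN1r addNr.
Qed.
Lemma PopxD p i (v v' : gpos i) f : ML f ->
  Pop p (v + v') f = Pop p v f + Pop p v' f.
Proof. by move=> Mf; have := Pop_linx p 1 v v' Mf; rewrite !scale1r. Qed.

Lemma ML_Pop p i (v : gpos i) f : ML f -> ML (Pop p v f).
Proof.
move=> + w1 w2 j a y y'; rewrite /Pop.
elim: w1 f => [|z w1 IH] f Mf /=; last first.
  rewrite IH; last exact: ML_Mop.
  by rewrite (ML_Htot _ Mf w1); vring C.
rewrite /lsg /= sgpP MopP // -[Pop_at p v (_ + _) _]/(Pop p v _ _) Pop_lin coindD coindZ.
by rewrite lpair_linr Htot_linx // coindD coindZ /Pop; vring C.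
Qed.

Lemma Mop_Pop z p i (v : gpos i) f :
  Mop z (Pop p v f) = Pop p v (Mop (lsg p z) f) - Htot (lpair v (lsg p z)) f.
Proof. by []. Qed.

Lemma HopHop p q x y f : ML f ->
  Hop p (part p x) (Hop q (part q y) f)
  - (-1) ^+ (p && q) *: Hop q (part q y) (Hop p (part p x) f)
  = Hop (p (+) q) (brk (part p x) (part q y)) f.
Proof.
move=> Mf; apply: funext => w; rewrite coindD coindN coindZ.
elim: w f Mf => [|[i z] w IH] f Mf; first by rewrite /Hop /= act_brk.
rewrite -![Hop _ _ _ (_ :: w)]/(Mop _ (Hop _ _ _) w) !Mop_Hop.
rewrite !HopD !HopN /lsg /lact /=.
rewrite !sgp_act [sgp p (sgp q z)]sgpC !actZr !MopZ // !HopZ.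
rewrite [p (+) q]addbC -sgp_sgp act_brk MopBZ //.
have := IH (Mop (neg_letter (sgp q (sgp p z))) f) (ML_Mop _ Mf).
rewrite [q (+) p]addbC !(coindD, coindN, coindZ) => <-.
by case: p q {IH} => [] [] /=; vfold; vring C.
Qed.

Lemma HopHtot p x u f : ML f -> Hop p (part p x) (Htot u f)
  = Htot (sgp p u) (Hop p (part p x) f) + Htot (brk (part p x) u) f.
Proof.
move=> Mf; have Mf' := ML_Hop p (part p x) Mf.
rewrite {1}/Htot HopD.
have E q : Hop p (part p x) (Hop q (part q u) f)
    = (-1) ^+ (p && q) *: Hop q (part q u) (Hop p (part p x) f)
      + Htot (brk (part p x) (part q u)) f.
  by rewrite (Htot_hom Mf (brk_even p q x u)) -HopHop // addrC subrK.
rewrite !E -[in brk _ u](part_sum u) brkDr HtotxD // /sgp HtotxD // HtotxZ //.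
have hp q : part q (part q u) = part q u by rewrite part_part eqxx.
rewrite (Htot_hom Mf' (hp false)) (Htot_hom Mf' (hp true)).
by case: p {E Mf' hp} => /=; vfold; vring C.
Qed.

(** Induction on the word. The correction terms involve values of the pairing, and [HopHtot]
    together with the invariance [brk_lpair] matches them on both sides. *)
Lemma HopPop p q x i (v : gpos i) f : ML f ->
  Hop p (part p x) (Pop q (part q v) f)
  - (-1) ^+ (p && q) *: Pop q (part q v) (Hop p (part p x) f)
  = Pop (p (+) q) (act (part p x) (part q v)) f.
Proof.
move=> Mf; apply: funext => w; rewrite coindD coindN coindZ.
elim: w f Mf => [|[j z] w IH] f Mf; first by rewrite /Hop /Pop /= act0r scaler0 subr0.
rewrite -[Hop _ _ _ (_ :: w)]/(Mop _ (Hop _ _ _) w).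
rewrite -![Pop _ _ _ (_ :: w)]/(Mop _ (Pop _ _ _) w) !Mop_Pop !Mop_Hop !Mop_Pop.
rewrite !HopD !HopN HopHtot // !PopD -[- Mop _ _]scaleN1r !PopZ.
have -> : lsg q (lact (part p x) (lsg p (existT _ j z)))
    = neg_letter ((-1) ^+ (p && q) *: act (part p x) (sgp q (sgp p z))).
  by rewrite /lsg /lact /= sgp_act.
rewrite MopZ // PopZ lpairZr HtotxZ //.
rewrite sgp_lpair /lsg /lact /= [sgp p (sgp q _)]sgpC sgpK.
rewrite HtotxZ; last exact: ML_Hop.
rewrite [sgp p (sgp q z)]sgpC [p (+) q]addbC -sgp_sgp brk_lpair HtotxD // HtotxZ //.
have := IH (Mop (neg_letter (sgp q (sgp p z))) f) (ML_Mop _ Mf).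
rewrite [q (+) p]addbC !(coindD, coindN, coindZ) /lact /= => <-.
by case: p q {IH} => [] [] /=; vfold; vring C.
Qed.

Definition gop (g : gens A) : opfam coind :=
  match g with
  | GH x => fun p => Hop p (part p x)
  | GP i v => fun p => Pop p (part p v)
  | GM i y => fun p => Mop (neg_letter (part p y))
  end.

Lemma gop_ok g : op_ok ML (gop g).
Proof.
case: g => [x|i v|i y]; split=> p.
- exact: Hop_lin.
- by move=> f; apply: ML_Hop.
- exact: Pop_lin.
- by move=> f; apply: ML_Pop.
- by [].
- by move=> f; apply: ML_Mop.
Qed.

(** Beyond linearity and parity, no defining relation involves two positive or two negative root
    vectors, so it suffices to commute [Hop] with [Hop], [Pop] and [Mop], and [Pop] with [Mop]. *)
Lemma gop_rel a b : gt_rel a b -> op_eq ML (tev gop a) (tev gop b).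
Proof.
case=> {a b}.
- by move=> a x y p f Mf /=; rewrite partD partZ Hop_linx.
- by move=> i a x y p f Mf /=; rewrite partD partZ Pop_linx.
- by move=> i a x y p f Mf /=; rewrite partD partZ MopP.
- by move=> p x q f Mf /=; rewrite part_part; case: eqP => [->|] //; rewrite Hopx0.
- by move=> i p x q f Mf /=; rewrite part_part; case: eqP => [->|] //; rewrite Popx0.
- by move=> i p x q f Mf /=; rewrite part_part; case: eqP => [->|] //; rewrite Mop0.
- move=> x y r f Mf /=; rewrite /opbrk /= part_brk HopxD //.
  have := HopHop true (~~ r) x y Mf; have := HopHop false r x y Mf.
  by case: r => /= <- <-; vring C.
- move=> i x v r f Mf /=; rewrite /opbrk /= part_act PopxD //.
  have := HopPop true (~~ r) x v Mf; have := HopPop false r x v Mf.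
  by case: r => /= <- <-; vring C.
- move=> i x v r f Mf /=; rewrite /opbrk /= part_act MopD //.
  rewrite !Mop_Hop /lsg /lact /= !sgp_part /= !actZr !MopZ // !HopZ.
  by case: r => /=; vring C.
- move=> i v y r f Mf /=; rewrite /opbrk /= part_rpair HopxD //.
  rewrite !Mop_Pop /lsg /= !sgp_part /= !lpairZr !MopZ // !PopZ !HtotxZ // !lpair_letter.
  rewrite (Htot_hom Mf (rpair_even false r v y)) (Htot_hom Mf (rpair_even true (~~ r) v y)).
  by case: r => /=; vring C.
- move=> i j v y ij r f Mf /=; rewrite /opbrk /=.
  rewrite !Mop_Pop /lsg /= !sgp_part /= !lpairZr !MopZ // !PopZ !HtotxZ //.
  rewrite !lpair_ne 1?eq_sym // Htotx0 //.
  by case: r => /=; vring C.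
Qed.

Definition coact : gtilde A -> opfam coind := gact gop (rel := @gt_rel C A).

Definition vac (m : N) : coind := fun w => if w is [::] then m else 0.

Lemma ML_vac m : ML (vac m).
Proof. by move=> [|z w1] w2 i a y y' /=; rewrite scaler0 addr0. Qed.

(* The component along [N] of the action on [N]; it only sees the part of
   [gtilde] of weight zero. *)
Definition vev (z : gtilde A) (m : N) : N :=
  coact z false (vac m) [::] + coact z true (vac m) [::].

Lemma vevP a x y m : vev (a *: x + y) m = a *: vev x m + vev y m.
Proof.
rewrite /vev /coact !(gactP ML0 MLP gop_ok gop_rel); try exact: ML_vac.
by rewrite !(coindD, coindZ) scalerDr addrACA.
Qed.

Lemma vev_GH x m : vev (gt_gen (GH x)) m = act x m.
Proof.
rewrite /vev /coact !(gact_gen ML0 MLP gop_ok gop_rel) /=; try exact: ML_vac.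
by rewrite -[in RHS](part_sum x) actDl.
Qed.

(** Both [vac m] and the value at the empty word are multiplied by the same [c], so the two terms of
    the commutator cancel. Hence elements of nonzero weight are invisible to [vev]. *)
Lemma vev_torus t z m (c : C) : (forall m : N, act (part false t) m = c *: m) ->
  vev (brk (gt_gen (GH (part false t))) z) m = 0.
Proof.
move=> tc; rewrite /vev /coact !(gact_brk ML0 MLP gop_ok gop_rel); try exact: ML_vac.
have Mv : ML (vac m) by exact: ML_vac.
have okz := gact_ok (rel := @gt_rel C A) ML0 MLP gop_ok z.
have ok0 p : gact gop z p 0 = 0.
  by have := okz.1 p (-1) 0 0; rewrite scaler0 addr0 scaleN1r addNr.
have okZ p k f : gact gop z p (k *: f) = k *: gact gop z p f.
  by have := okz.1 p k f 0; rewrite ok0 !addr0.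
have tE p f : ML f -> gact gop (gt_gen (GH (part false t))) p f
    = Hop p (part p (part false t)) f.
  by move=> Mf; rewrite (gact_gen ML0 MLP gop_ok gop_rel).
rewrite /opbrk !tE; try exact: ML_vac; try exact: okz.2.
rewrite !part_part /= !(Hopx0 _ Mv) !(Hopx0 true (okz.2 _ _ Mv)) !ok0 !scaler0 !subr0 !addr0.
have -> : Hop false (part false t) (vac m) = c *: vac m.
  apply: funext => -[|z' w]; first by rewrite coindZ /Hop /= tc.
  rewrite coindZ -[vac m (z' :: w)]/(0 : N) scaler0.
  rewrite -[Hop _ _ _ _]/(Mop z' (Hop _ _ _) w) Mop_Hop.
  have M0 z0 : Mop z0 (vac m) = 0 by [].
  by rewrite !M0 Hop0 subr0.
by rewrite !okZ !(coindD, coindN, coindZ) /Hop /= !tc !subrr addr0.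
Qed.

End Coinduced.

(** * Generators and weights in the presented algebra and its quotient *)

Section QuotientMap.
Variables (C : fieldType) (g : lieSuperType C) (I : lieIdeal g).

Lemma quot_piP a x y : quot_pi I (a *: x + y) = a *: quot_pi I x + quot_pi I y.
Proof. by rewrite /quot_pi -lqpiZ -lqpiD. Qed.
Lemma quot_pi_part p x : quot_pi I (part p x) = part p (quot_pi I x).
Proof. by rewrite /quot_pi -lqpi_part. Qed.
Lemma quot_pi_brk x y : quot_pi I (brk x y) = brk (quot_pi I x) (quot_pi I y).
Proof. by rewrite /quot_pi [RHS]lq_brkE. Qed.
Lemma quot_pi_eq0 x : quot_pi I x = 0 -> I x.
Proof. by move/(lqpiP (S := ideal_setoid I)); rewrite /= /li_eq subr0. Qed.

End QuotientMap.

Section LieFacts.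
Variables (C : fieldType) (g : lieSuperType C).
Implicit Types x y z : g.

Lemma brk0r x : brk x 0 = 0 :> g. Proof. exact: linear0. Qed.
Lemma brkNr x y : brk x (- y) = - brk x y. Proof. exact: linearN. Qed.
Lemma brkNl x y : brk (- x) y = - brk x y.
Proof. by rewrite -scaleN1r brkZl scaleN1r. Qed.
Lemma brkBr x y z : brk x (y - z) = brk x y - brk x z. Proof. exact: linearB. Qed.
Lemma part_idem p x : part p (part p x) = part p x.
Proof. by rewrite part_part eqxx. Qed.

Lemma hom_brk p q x y : part p x = x -> part q y = y ->
  part (p (+) q) (brk x y) = brk x y.
Proof. by move=> <- <-; rewrite brk_even. Qed.
Lemma hom_skew p q x y : part p x = x -> part q y = y ->
  brk x y = - ((-1) ^+ (p && q) *: brk y x).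
Proof. by move=> <- <-; apply: brk_skew. Qed.
Lemma hom_jacobi p q x y z : part p x = x -> part q y = y ->
  brk x (brk y z) = brk (brk x y) z + (-1) ^+ (p && q) *: brk y (brk x z).
Proof. by move=> <- <-; apply: brk_jacobi. Qed.
Lemma even_jacobi x y z : part false x = x ->
  brk x (brk y z) = brk (brk x y) z + brk y (brk x z).
Proof.
move=> x0; have E q : brk x (brk (part q y) z)
    = brk (brk x (part q y)) z + brk (part q y) (brk x z).
  by rewrite (hom_jacobi _ x0 (part_idem q y)) /= scale1r.
by rewrite -[y]part_sum !(brkDl, brkDr) !E addrACA.
Qed.
Lemma even_skew x y : part false x = x -> brk y x = - brk x y.
Proof.
move=> x0; rewrite -[y]part_sum !(brkDl, brkDr) opprD.
by congr (_ + _); rewrite (hom_skew (part_idem _ y) x0) andbF scale1r.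
Qed.

End LieFacts.

(** * Spanning by triangular parts, and survival of elements of [h] in the quotient *)

Section Tilde.
Variables (C : numClosedFieldType) (A : cartanDatum C).
Notation h := (cd_h A).
Notation n := (cd_n A).
Notation tH x := (gt_gen (GH x) : gtilde A).
Notation tP v := (gt_gen (GP v) : gtilde A).
Notation tM v := (gt_gen (GM v) : gtilde A).

Let piP := @lqpiP C (presentation (@gt_rel C A)).

Lemma tH_lin a x y : tH (a *: x + y) = a *: tH x + tH y.
Proof. by rewrite /gt_gen /pres_gen -lqpiZ -lqpiD; apply/piP/lc_rel; constructor. Qed.
Lemma tP_lin i a (x y : gpos i) : tP (a *: x + y) = a *: tP x + tP y.
Proof. by rewrite /gt_gen /pres_gen -lqpiZ -lqpiD; apply/piP/lc_rel; constructor. Qed.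
Lemma tM_lin i a (x y : gneg i) : tM (a *: x + y) = a *: tM x + tM y.
Proof. by rewrite /gt_gen /pres_gen -lqpiZ -lqpiD; apply/piP/lc_rel; constructor. Qed.
Lemma tH_part p x : tH (part p x) = part p (tH x).
Proof. by rewrite /gt_gen /pres_gen -lqpi_part; apply/piP/lc_rel; constructor. Qed.
Lemma tP_part i p (x : gpos i) : tP (part p x) = part p (tP x).
Proof. by rewrite /gt_gen /pres_gen -lqpi_part; apply/piP/lc_rel; constructor. Qed.
Lemma tM_part i p (x : gneg i) : tM (part p x) = part p (tM x).
Proof. by rewrite /gt_gen /pres_gen -lqpi_part; apply/piP/lc_rel; constructor. Qed.
Lemma tHH x y : brk (tH x) (tH y) = tH (brk x y).
Proof. by rewrite /gt_gen /pres_gen [LHS]lq_brkE; apply/piP/lc_rel; constructor. Qed.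
Lemma tHP i x (v : gpos i) : brk (tH x) (tP v) = tP (act x v).
Proof. by rewrite /gt_gen /pres_gen [LHS]lq_brkE; apply/piP/lc_rel; constructor. Qed.
Lemma tHM i x (v : gneg i) : brk (tH x) (tM v) = tM (act x v).
Proof. by rewrite /gt_gen /pres_gen [LHS]lq_brkE; apply/piP/lc_rel; constructor. Qed.
Lemma tPM i (v : gpos i) (y : gneg i) : brk (tP v) (tM y) = tH (rpair v y).
Proof. by rewrite /gt_gen /pres_gen [LHS]lq_brkE; apply/piP/lc_rel; constructor. Qed.
Lemma tPM0 i j (v : gpos i) (y : gneg j) : i != j -> brk (tP v) (tM y) = 0.
Proof.
by move=> ij; rewrite /gt_gen /pres_gen [LHS]lq_brkE -lqpi0; apply/piP/lc_rel; constructor.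
Qed.

Lemma tH0 : tH 0 = 0.
Proof. by have := tH_lin (-1) 0 0; rewrite scaler0 addr0 scaleN1r addNr. Qed.
Lemma tP0 i : tP (0 : gpos i) = 0.
Proof. by have := tP_lin (-1) (0 : gpos i) 0; rewrite scaler0 addr0 scaleN1r addNr. Qed.
Lemma tM0 i : tM (0 : gneg i) = 0.
Proof. by have := tM_lin (-1) (0 : gneg i) 0; rewrite scaler0 addr0 scaleN1r addNr. Qed.
Lemma tHZ a x : tH (a *: x) = a *: tH x.
Proof. by have := tH_lin a x 0; rewrite tH0 !addr0. Qed.
Lemma tHD x y : tH (x + y) = tH x + tH y.
Proof. by have := tH_lin 1 x y; rewrite !scale1r. Qed.
Lemma tPZ i a (v : gpos i) : tP (a *: v) = a *: tP v.
Proof. by have := tP_lin a v 0; rewrite tP0 !addr0. Qed.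
Lemma tMZ i a (v : gneg i) : tM (a *: v) = a *: tM v.
Proof. by have := tM_lin a v 0; rewrite tM0 !addr0. Qed.

Definition tR (s : bool) (z : gtilde A) : Prop :=
  if s then exists i (y : gneg i), z = tM y else exists i (v : gpos i), z = tP v.

Lemma tR_part s p z : tR s z -> tR s (part p z).
Proof.
by case: s => -[i [v ->]]; [rewrite -tM_part | rewrite -tP_part]; do 2!eexists.
Qed.
Lemma tR_H s x z : tR s z -> tR s (brk (tH x) z).
Proof. by case: s => -[i [v ->]]; [rewrite tHM | rewrite tHP]; do 2!eexists. Qed.
Lemma tMP i j (v : gpos i) (y : gneg j) : exists x, brk (tM y) (tP v) = tH x.
Proof.
have E p q : exists x, brk (part p (tM y)) (part q (tP v)) = tH x.
  rewrite (hom_skew (part_idem p _) (part_idem q _)) -tM_part -tP_part.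
  have [ij|ij] := eqVneq i j.
    subst j; rewrite tPM; exists (- (-1) ^+ (p && q) *: rpair (part q v) (part p y)).
    by rewrite tHZ scaleNr.
  by rewrite tPM0 // scaler0 oppr0; exists 0; rewrite tH0.
rewrite -[tM y]part_sum -[tP v]part_sum !(brkDl, brkDr).
have [x1 ->] := E false false; have [x2 ->] := E false true.
have [x3 ->] := E true false; have [x4 ->] := E true true.
by exists (x1 + x2 + (x3 + x4)); rewrite !tHD.
Qed.
Lemma tR_opp s y z : tR (~~ s) y -> tR s z -> exists x, brk y z = tH x.
Proof.
case: s => /= -[i [v ->]] [j [u ->]]; last exact: tMP.
have [ij|ij] := eqVneq i j; last by rewrite tPM0 //; exists 0; rewrite tH0.
by subst j; rewrite tPM; eexists.
Qed.

(** Combinations of right-normed brackets of [d.+1] root vectors of one sign; with [d] as an index,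
    each level lies in a single eigenspace of the grading element. *)
Inductive tri (s : bool) : nat -> gtilde A -> Prop :=
| tri_gen z : tR s z -> tri s 0 z
| tri_lin d a x y : tri s d x -> tri s d y -> tri s d (a *: x + y)
| tri_brk d x z : tR s x -> tri s d z -> tri s d.+1 (brk x z).

Lemma triZ s d a x : tri s d x -> tri s d (a *: x).
Proof.
by move=> tx; rewrite -[a](subrK 1) scalerDl scale1r; apply: tri_lin.
Qed.
Lemma triD s d x y : tri s d x -> tri s d y -> tri s d (x + y).
Proof. by move=> tx ty; rewrite -[x]scale1r; apply: tri_lin. Qed.

Lemma tri_part s d p z : tri s d z -> tri s d (part p z).
Proof.
move=> tz; elim: tz p => {d z} [z Rz|d a x y _ IHx _ IHy|d x z Rx _ IH] p.
- exact/tri_gen/tR_part.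
- by rewrite partD partZ; apply: tri_lin.
- by rewrite part_brk; apply: triD; apply: tri_brk; rewrite ?IH //; apply: tR_part.
Qed.

Lemma triH s d x z : tri s d z -> tri s d (brk (tH x) z).
Proof.
move=> tz; elim: tz x => {d z} [z Rz|d a y z _ IHy _ IHz|d y z Ry tz IH] x.
- exact/tri_gen/tR_H.
- by rewrite brkDr brkZr; apply: tri_lin.
have E p q : tri s d.+1 (brk (tH (part p x)) (brk (part q y) z)).
  rewrite tH_part brk_jacobi -tH_part; apply: triD; first apply: tri_brk => //.
    exact/tR_H/tR_part.
  by apply/triZ/tri_brk; [apply: tR_part | apply: IH].
rewrite -[y]part_sum -[x]part_sum.
by rewrite tHD !(brkDl, brkDr); do !apply: triD.
Qed.

Lemma tri_Hr s x z : tR s z -> tri s 0 (brk z (tH x)).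
Proof.
move=> Rz; rewrite -[z]part_sum -[tH x]part_sum !(brkDl, brkDr).
have E p q : tri s 0 (brk (part p z) (part q (tH x))).
  rewrite brk_skew -scaleNr; apply/triZ; rewrite -tH_part.
  exact/tri_gen/tR_H/tR_part.
by do !apply: triD.
Qed.

Definition lowers s d (u : gtilde A) : Prop :=
  if d is d'.+1 then tri s d' u else exists x, u = tH x.

Lemma lowers_lin s d a u v : lowers s d u -> lowers s d v -> lowers s d (a *: u + v).
Proof.
case: d => [[x ->] [y ->]|d] /=; last exact: tri_lin.
by exists (a *: x + y); rewrite tH_lin.
Qed.

Lemma tri_opp s d y z : tR (~~ s) y -> tri s d z -> lowers s d (brk y z).
Proof.
move=> Ry tz; elim: tz y Ry => {d z} [z Rz|d a x z _ IHx _ IHz|d x z Rx tz IH] y Ry.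
- exact: tR_opp Ry Rz.
- by rewrite brkDr brkZr; apply: lowers_lin; [apply: IHx | apply: IHz].
have E p q : tri s d (brk (part p y) (brk (part q x) z)).
  rewrite brk_jacobi; apply: triD.
    by have [u ->] := tR_opp (tR_part p Ry) (tR_part q Rx); apply: triH.
  apply: triZ; have := IH _ (tR_part p Ry); case: (d) => [[u ->]|d'] /=.
    exact/tri_Hr/tR_part.
  exact/tri_brk/tR_part.
rewrite /= -[y]part_sum -[x]part_sum !(brkDl, brkDr).
by do !apply: triD.
Qed.

Inductive trispan : gtilde A -> Prop :=
| trispan_H x : trispan (tH x)
| trispan_tri s d z : tri s d z -> trispan z
| trispan_lin a x y : trispan x -> trispan y -> trispan (a *: x + y).

Lemma trispan0 : trispan 0. Proof. by rewrite -tH0; apply: trispan_H. Qed.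
Lemma trispanD x y : trispan x -> trispan y -> trispan (x + y).
Proof. by move=> tx ty; rewrite -[x]scale1r; apply: trispan_lin. Qed.
Lemma trispanZ a x : trispan x -> trispan (a *: x).
Proof.
by move=> tx; rewrite -[_ *: _]addr0; apply: trispan_lin => //; apply: trispan0.
Qed.
Lemma trispanN x : trispan x -> trispan (- x).
Proof. by move=> tx; rewrite -scaleN1r; apply: trispanZ. Qed.

Lemma trispan_brkR s y z : tR s y -> trispan z -> trispan (brk y z).
Proof.
move=> Ry; elim=> {z} [x|s' d z tz|a u v _ IHu _ IHv].
- exact: (trispan_tri (tri_Hr x Ry)).
- have [ss|ss] := eqVneq s s'; first by subst s'; exact: (trispan_tri (tri_brk Ry tz)).
  have Ry' : tR (~~ s') y by case: s s' Ry {tz} ss => [] [].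
  have := tri_opp Ry' tz; case: d {tz} => [[x ->]|d]; first exact: trispan_H.
  by move=> tz; apply: (trispan_tri (tz : tri s' d _)).
- by rewrite brkDr brkZr; apply: trispan_lin.
Qed.

Lemma trispan_brkH x z : trispan z -> trispan (brk (tH x) z).
Proof.
elim=> {z} [y|s d z tz|a u v _ IHu _ IHv].
- by rewrite tHH; apply: trispan_H.
- exact: (trispan_tri (triH x tz)).
- by rewrite brkDr brkZr; apply: trispan_lin.
Qed.

Lemma trispan_part p z : trispan z -> trispan (part p z).
Proof.
elim=> {z} [y|s d z tz|a u v _ IHu _ IHv].
- by rewrite -tH_part; apply: trispan_H.
- exact: (trispan_tri (tri_part p tz)).
- by rewrite partD partZ; apply: trispan_lin.
Qed.

(** The spanning half of the triangular decomposition. The induction on terms also carries that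
    bracketing with a homogeneous part of the term preserves the span; the Jacobi identity passes
    this on to brackets. *)
Lemma trispan_all z : trispan z.
Proof.
pose pi (t : lterm C (gens A)) : gtilde A := lqpi (S := presentation (@gt_rel C A)) t.
suff H t : trispan (pi t) /\ forall p u, trispan u -> trispan (brk (part p (pi t)) u).
  by elim/(@lqW C (presentation (@gt_rel C A))): z => t; case: (H t).
elim: t => [x||a [ta Ba] b [tb Bb]|a [ta Ba]|k a [ta Ba]|q a [ta Ba]|a [ta Ba] b [tb Bb]].
- rewrite -[pi _]/(gt_gen x); split.
    by case: x => [x|i v|i y]; [apply: trispan_H | apply: (@trispan_tri false 0)
      | apply: (@trispan_tri true 0)]; apply: tri_gen; do 2!eexists.
  move=> p u tu; case: x => [x|i v|i y].
  + by rewrite -tH_part; apply: trispan_brkH.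
  + by rewrite -tP_part; apply: (@trispan_brkR false) => //; do 2!eexists.
  + by rewrite -tM_part; apply: (@trispan_brkR true) => //; do 2!eexists.
- have -> : pi (TZero C (gens A)) = 0 by [].
  by split=> [|p u _]; rewrite ?part0 ?brk0l; apply: trispan0.
- have -> : pi (TAdd a b) = pi a + pi b by rewrite /pi -lqpiD.
  split=> [|p u tu]; first exact: trispanD.
  by rewrite partD brkDl; apply: trispanD; [apply: Ba | apply: Bb].
- have -> : pi (TOpp a) = - pi a by rewrite /pi -lqpiN.
  split=> [|p u tu]; first exact: trispanN.
  by rewrite -scaleN1r partZ scaleN1r brkNl; apply/trispanN/Ba.
- have -> : pi (TScale k a) = k *: pi a by rewrite /pi -lqpiZ.
  split=> [|p u tu]; first exact: trispanZ.
  by rewrite partZ brkZl; apply/trispanZ/Ba.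
- have -> : pi (TPart q a) = part q (pi a) by rewrite /pi -lqpi_part.
  split=> [|p u tu]; first exact: trispan_part.
  by rewrite part_part; case: eqP => _; [apply: Ba | rewrite brk0l; apply: trispan0].
- have -> : pi (TBrk a b) = brk (pi a) (pi b) by rewrite /pi [RHS]lq_brkE.
  split=> [|r u tu].
    by rewrite -[pi a]part_sum brkDl; apply: trispanD; apply: Ba.
  have E p q : trispan (brk (brk (part p (pi a)) (part q (pi b))) u).
    have := brk_jacobi p q (pi a) (pi b) u => /eqP; rewrite -subr_eq => /eqP <-.
    apply: trispanD; first by apply/Ba/Bb.
    by apply/trispanN/trispanZ/Bb/Ba.
  by rewrite part_brk brkDl; apply: trispanD.
Qed.

Variable t : h.
Hypothesis t_even : part false t = t.
Hypothesis t_alpha : forall i, alpha i t = 1.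

Lemma tri_wt s d z : tri s d z ->
  brk (tH t) z = (if s then - d.+1%:R else d.+1%:R) *: z.
Proof.
have te : part false (tH t) = tH t by rewrite -tH_part t_even.
elim=> {d z} [z|d a x y _ IHx _ IHy|d x z Rx tz IH].
- case: s => -[i [v ->]]; rewrite ?tHM ?tHP -t_even.
    by rewrite gneg_wt t_alpha tMZ.
  by rewrite gpos_wt t_alpha tPZ.
- by rewrite brkDr brkZr IHx IHy; vring C.
- rewrite even_jacobi // IH brkZr.
  have -> : brk (tH t) x = (if s then -1 else 1) *: x.
    case: s Rx {tz IH} => -[i [v ->]]; rewrite ?tHM ?tHP -t_even.
      by rewrite gneg_wt t_alpha tMZ.
    by rewrite gpos_wt t_alpha tPZ.
  by rewrite brkZl -scalerDl; case: (s); congr (_ *: _); ring.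
Qed.

(** Weights are separated by killing them with products of [ad t - d] instead of projecting, so
    directness of the weight decomposition never comes up. *)
Definition shift_wt (d : C) (u : gtilde A) := brk (tH t) u - d *: u.
Definition shifts (ds : seq C) (u : gtilde A) := foldr shift_wt u ds.

Lemma shift_wtP d a u v : shift_wt d (a *: u + v) = a *: shift_wt d u + shift_wt d v.
Proof. by rewrite /shift_wt brkDr brkZr; vring C. Qed.
Lemma shiftsP ds a u v : shifts ds (a *: u + v) = a *: shifts ds u + shifts ds v.
Proof. by elim: ds => //= d ds ->; rewrite shift_wtP. Qed.
Lemma shifts0 ds : shifts ds 0 = 0.
Proof. by have := shiftsP ds (-1) 0 0; rewrite scaler0 addr0 scaleN1r addNr. Qed.
Lemma shift_wtC d e u : shift_wt d (shift_wt e u) = shift_wt e (shift_wt d u).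
Proof. by rewrite /shift_wt !brkBr !brkZr; vring C. Qed.
Lemma shift_shifts d ds u : shift_wt d (shifts ds u) = shifts ds (shift_wt d u).
Proof. by elim: ds => //= e ds IH; rewrite shift_wtC IH. Qed.
Lemma shiftsC ds es u : shifts ds (shifts es u) = shifts es (shifts ds u).
Proof. by elim: ds => //= d ds IH; rewrite IH shift_shifts. Qed.

(** The spanning elements outside [h] are eigenvectors of [ad t] with nonzero integral eigenvalues;
    the killing operators commute, so the lists of two summands can be concatenated. *)
Lemma weight_zero_part z : exists x ds,
  all (fun d => d != 0) ds /\ shifts ds (z - tH x) = 0.
Proof.
elim: (trispan_all z) => {z} [x|s d z tz|a u v _ [x [ds [d0 Eu]]] _ [y [es [e0 Ev]]]].
- by exists x, [::]; rewrite subrr.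
- exists 0, [:: if s then - d.+1%:R else d.+1%:R]; split.
    by rewrite /= andbT; case: (s); rewrite ?oppr_eq0 pnatr_eq0.
  by rewrite tH0 subr0 /shifts /= /shift_wt (tri_wt tz) subrr.
- exists (a *: x + y), (ds ++ es); split; first by rewrite all_cat d0.
  rewrite tH_lin opprD addrACA -scalerBr /shifts foldr_cat -/(shifts es _).
  by rewrite -/(shifts ds _) !shiftsP shiftsC Eu Ev !shifts0 scaler0 addr0.
Qed.

Lemma shiftsH ds x : shifts ds (tH x) = (\prod_(d <- ds) - d) *: tH x.
Proof.
elim: ds => [|d ds IH] /=; first by rewrite big_nil scale1r.
rewrite IH big_cons /shift_wt brkZr tHH -t_even cd_qt tH0 scaler0 sub0r.
by rewrite scalerA mulNr scaleNr.
Qed.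

Section Ideal.
Variables (N : hmodule h) (c : C).
Hypothesis tN : forall m : N, act t m = c *: m.

Lemma vev_shift d z (m : N) : vev (shift_wt d z) m = - d *: vev z m.
Proof.
have := vevP (- d) z (brk (tH t) z) m; rewrite addrC scaleNr => ->.
rewrite -[X in brk (tH X)]t_even (@vev_torus _ _ _ _ _ _ c) ?addr0 // => m'.
by rewrite t_even tN.
Qed.

Lemma vev_shifts ds z (m : N) : all (fun d => d != 0) ds ->
  shifts ds z = 0 -> vev z m = 0.
Proof.
move=> d0 Ez; have v0 : vev 0 m = 0.
  by have := vevP (-1) 0 0 m; rewrite scaler0 addr0 scaleN1r addNr.
have : vev (shifts ds z) m = 0 by rewrite Ez.
elim: ds d0 {Ez} => //= d ds IH /andP[d0 ds0].
by rewrite vev_shift => /eqP; rewrite scaler_eq0 oppr_eq0 (negbTE d0) => /eqP/IH->.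
Qed.

(** An ideal is stable under [ad t], so killing the nonzero weights of [z] leaves a nonzero multiple
    of [tH x] in [I]. Then [tH x = 0], and [z] has only weights that [vev] ignores. *)
Lemma vev_ideal (I : lieIdeal (gtilde A)) z (m : N) :
  meets_h_trivially I -> I z -> vev z m = 0.
Proof.
move=> mI Iz; have [x [ds [d0 Ez]]] := weight_zero_part z.
have Is u : I u -> I (shifts ds u).
  elim: (ds) => //= d es IH Iu; have Ies := IH Iu.
  by apply: liD; [apply: li_brk | apply/liN/liZ].
have Es : shifts ds z = shifts ds (tH x).
  by rewrite -[z](subrK (tH x)) -[z - _]scale1r shiftsP Ez scaler0 add0r.
have Hx : tH x = 0.
  apply: mI; have := Is z Iz; rewrite Es shiftsH => /(liZ (\prod_(d <- ds) - d)^-1).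
  rewrite scalerA mulVf ?scale1r //; elim: (ds) d0 => [|d es IH] /=.
    by rewrite big_nil oner_eq0.
  by case/andP=> d0 es0; rewrite big_cons mulf_neq0 ?oppr_eq0 // IH.
by apply: (vev_shifts m d0); move: Ez; rewrite Hx subr0.
Qed.

Lemma vev_rad z (m : N) : Defs.rad A z -> vev z m = 0.
Proof.
elim=> {z} [I z mI Iz|z u _ Ez _ Eu]; first exact: vev_ideal mI Iz.
by have := vevP 1 z u m; rewrite !scale1r Ez Eu addr0.
Qed.

Lemma gK_GH_eq0 x (m : N) : gK_gen (GH x) = 0 :> gKM A -> act x m = 0.
Proof. by move/quot_pi_eq0 => xI; rewrite -vev_GH; apply: vev_rad. Qed.

End Ideal.
End Tilde.

(** * Irreducible modules of rank two *)

Section RankTwoForm.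
Variables (C : numClosedFieldType) (h : vectType C) (oform : h -> h -> C).
Hypothesis oformPl : forall a x y z, oform (a *: x + y) z = a * oform x z + oform y z.
Hypothesis oformC : forall x y, oform x y = oform y x.

Let oformPr a x y z : oform z (a *: x + y) = a * oform z x + oform z y.
Proof. by rewrite oformC oformPl !(oformC z). Qed.

Let b := vbasis {:h}.
Let G := \matrix_(i < \dim {:h}, j < \dim {:h}) oform b`_i b`_j.
Let co (x : h) : 'rV[C]_(\dim {:h}) := \row_i coord b i x.

Let coE x : x = \sum_i co x 0 i *: b`_i.
Proof.
rewrite {1}(coord_vbasis (memvf x)); apply: eq_bigr => i _; by rewrite mxE.
Qed.

Let oform_suml (c : 'I_(\dim {:h}) -> C) z :
  oform (\sum_i c i *: b`_i) z = \sum_i c i * oform b`_i z.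
Proof.
have o0 : oform 0 z = 0.
  by have := oformPl (-1) 0 0 z; rewrite scaler0 addr0 mulN1r addNr.
elim/big_rec2: _ => // i x y _ IH; by rewrite oformPl IH.
Qed.
Let oform_sumr (c : 'I_(\dim {:h}) -> C) z :
  oform z (\sum_i c i *: b`_i) = \sum_i c i * oform z b`_i.
Proof. by rewrite oformC oform_suml; apply: eq_bigr => i _; rewrite oformC. Qed.

Let oformE x y : oform x y = (co x *m G *m (co y)^T) 0 0.
Proof.
rewrite {1}(coE x) oform_suml [RHS]mxE.
under [RHS]eq_bigr => j _ do rewrite mxE mulr_suml.
rewrite exchange_big /=; apply: eq_bigr => i _.
rewrite {1}(coE y) oform_sumr mulr_sumr; apply: eq_bigr => j _.
by rewrite !mxE; ring.
Qed.

Let polarization (psi : h -> h -> C) :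
  (forall a x y z, psi (a *: x + y) z = a * psi x z + psi y z) ->
  (forall x y, psi x y = psi y x) -> (forall x, psi x x = 0) ->
  forall x y, psi x y = 0.
Proof.
move=> lin sym psi0 x y; have := psi0 (1 *: x + y).
rewrite lin (sym x) (sym y (_ + _)) !lin !psi0 (sym y x) => /eqP.
rewrite !(mul1r, add0r, addr0) -mulr2n -mulr_natl mulf_eq0 pnatr_eq0 /=.
by move/eqP.
Qed.

Hypothesis rkG : \rank G = 2%N.

(** Two steps of Gram-Schmidt give orthogonal anisotropic [x], [y']; the form has nothing left
    beyond them, and over a closed field the pair can be turned into a hyperbolic one. *)
Lemma rank_two_form : exists p q : h,
  [/\ oform p p = 0, oform q q = 0, oform p q = 1
    & forall x y, oform x y = oform x q * oform p y + oform x p * oform q y].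
Proof.
have [x xx] : exists x, oform x x != 0.
  apply: contrapT => nex; suff G0 : G = 0 by have := rkG; rewrite G0 mxrank0.
  apply/matrixP => i j; rewrite !mxE; apply: polarization.
  - exact: oformPl.
  - exact: oformC.
  - by move=> x; apply/eqP/negPn/negP => xx; apply: nex; exists x.
pose psi u v := oform u v - oform u x * oform x v / oform x x.
have psiP a u v w : psi (a *: u + v) w = a * psi u w + psi v w.
  by rewrite /psi !oformPl; field.
have psiC u v : psi u v = psi v u.
  by rewrite /psi oformC (oformC u x) (oformC x v); congr (_ - _); ring.
have [y yy] : exists y, psi y y != 0.
  apply: contrapT => nex; suff : (\rank G <= 1)%N by rewrite rkG.
  have -> : G = (\col_i oform b`_i x) *m (\row_j (oform x b`_j / oform x x)).
    apply/matrixP => i j; rewrite !mxE big_ord1 !mxE.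
    have /eqP := polarization psiP psiC
      (fun z => contrapT (fun zz => nex (ex_intro _ z (introN eqP zz)))) b`_i b`_j.
    by rewrite /psi subr_eq0 => /eqP ->; rewrite mulrA.
  exact: leq_trans (mxrankM_maxl _ _) (rank_leq_col _).
have [y' y'E] : exists y', y' = (- (oform x y / oform x x)) *: x + y by eexists.
have xy' : oform x y' = 0 by rewrite y'E oformPr; field.
have y'y' : oform y' y' = psi y y.
  by rewrite y'E /psi oformPl !oformPr (oformC y x); field.
have B0 : oform y' y' != 0 by rewrite y'y'.
pose chi u v := oform u v - oform u x * oform x v / oform x x
  - oform u y' * oform y' v / oform y' y'.
have chiP a u v w : chi (a *: u + v) w = a * chi u w + chi v w.
  by rewrite /chi !oformPl; field; rewrite ?xx ?B0.
have chiC u v : chi u v = chi v u.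
  rewrite /chi oformC (oformC u x) (oformC x v) (oformC u y') (oformC y' v).
  by field; rewrite ?xx ?B0.
have chi0 w : chi w w = 0.
  apply/eqP/negPn/negP => ww.
  have [w' w'E] : exists w', w' = (- (oform x w / oform x x)) *: x
      + ((- (oform y' w / oform y' y')) *: y' + w) by eexists.
  have xw' : oform x w' = 0.
    by rewrite w'E !oformPr xy'; field; rewrite ?xx ?B0.
  have yw' : oform y' w' = 0.
    by rewrite w'E !oformPr (oformC y' x) xy'; field; rewrite ?xx ?B0.
  have w'w' : oform w' w' = chi w w.
    rewrite {1}w'E !oformPl xw' yw' w'E !oformPr /chi (oformC w x) (oformC w y').
    by field; rewrite ?xx ?B0.
  (* Three orthogonal anisotropic vectors would have an invertible Gram matrix of size 3, against
     rank two. *)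
  pose f (i : 'I_3) := nth 0 [:: x; y'; w'] i.
  pose P : 'M[C]_(3, \dim {:h}) := \matrix_(i, j) co (f i) 0 j.
  have PGE : P *m G *m P^T = diag_mx (\row_i oform (f i) (f i)).
    apply/matrixP => i j; transitivity (oform (f i) (f j)).
      rewrite oformE !mxE; apply: eq_bigr => k _; rewrite !mxE; congr (_ * _).
      by apply: eq_bigr => l _; rewrite !mxE.
    rewrite !mxE; case: eqP => [->|ij]; first by rewrite mulr1n.
    rewrite mulr0n /f.
    case: i j ij => [[|[|[|i]]] lti] [[|[|[|j]]] ltj] //= ij;
      try (by case: ij; apply: val_inj); rewrite ?xy' ?xw' ?yw' //.
    + by rewrite oformC.
    + by rewrite oformC.
    + by rewrite oformC.
  have : (\rank (P *m G *m P^T) <= 2)%N.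
    rewrite -[X in (_ <= X)%N]rkG; apply: leq_trans (mxrankM_maxl _ _) _.
    exact: mxrankM_maxr.
  rewrite PGE mxrank_unit // unitmxE det_diag unitfE.
  apply/prodf_neq0 => i _; rewrite mxE /f.
  by case: i => [[|[|[|i]]] lti] //=; rewrite w'w'.
have formE u v : oform u v = oform u x * oform x v / oform x x
    + oform u y' * oform y' v / oform y' y'.
  have := polarization chiP chiC chi0 u v; rewrite /chi => /eqP.
  by rewrite -addrA -opprD subr_eq0 => /eqP.
(* Scaled so that [s x] and [r y'] both have norm 1/2: then $s x \pm i r y'$ are isotropic and pair
   to 1. *)
pose s := sqrtC ((2 * oform x x)^-1); pose r := sqrtC ((2 * oform y' y')^-1).
have s2 : s ^+ 2 = (2 * oform x x)^-1 by rewrite sqrtCK.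
have r2 : r ^+ 2 = (2 * oform y' y')^-1 by rewrite sqrtCK.
have i2 : 'i ^+ 2 = -1 :> C by rewrite sqrCi.
have yx : oform y' x = 0 by rewrite oformC.
have o0r u : oform u 0 = 0.
  by have := oformPr (-1) 0 0 u; rewrite scaler0 addr0 mulN1r addNr.
have oZr a u v : oform u (a *: v) = a * oform u v.
  by have := oformPr a v 0 u; rewrite o0r !addr0.
have oZl a u v : oform (a *: u) v = a * oform u v by rewrite oformC oZr oformC.
exists (s *: x + ('i * r) *: y'), (s *: x + (- ('i * r)) *: y').
have E (c d c' d' : C) : oform (c *: x + d *: y') (c' *: x + d' *: y')
    = c * c' * oform x x + d * d' * oform y' y'.
  by rewrite oformPl !oformPr !oZl !oZr xy' yx; ring.
have sA : s * s * oform x x = 2^-1.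
  by rewrite -expr2 s2 invfM -mulrA mulVf ?mulr1.
have rB : 'i * r * ('i * r) * oform y' y' = - 2^-1.
  have -> : 'i * r * ('i * r) * oform y' y' = 'i ^+ 2 * (r ^+ 2 * oform y' y') by ring.
  by rewrite i2 r2 invfM -mulrA mulVf ?mulr1 // mulN1r.
have h2 : 2^-1 + 2^-1 = 1 :> C by field.
split.
- by rewrite E sA rB subrr.
- by rewrite E mulrNN sA rB subrr.
- by rewrite E mulrN mulNr sA rB opprK.
- move=> u v; rewrite {1}formE !oformPl !oformPr !oZl !oZr.
  have -> : oform u x * oform x v / oform x x
      = (s ^+ 2 + s ^+ 2) * (oform u x * oform x v).
    by rewrite s2; field.
  have -> : oform u y' * oform y' v / oform y' y'
      = - ('i ^+ 2) * (r ^+ 2 + r ^+ 2) * (oform u y' * oform y' v).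
    by rewrite i2 r2; field.
  by ring.
Qed.

End RankTwoForm.

HB.instance Definition _ (C : fieldType) (h : finLieSuperType C) (V : hmodule h) x :=
  GRing.isLinear.Build C V V *:%R (@act C h V x) (@act_linearr C h V x).

Section RankTwoModule.
Variables (C : numClosedFieldType) (h : finLieSuperType C) (lam : {scalar h}).
Variable V : hmodule h.
Hypothesis wt : forall x (v : V), act (part false x) v = lam x *: v.
Hypothesis rk2 : rk lam = 2%N.
Hypothesis irr : irreducible_mod V.

Let oform (x y : h) : C := lam (brk (part true x) (part true y)).

Let oformPl a x y z : oform (a *: x + y) z = a * oform x z + oform y z.
Proof. by rewrite /oform partD partZ brkDl brkZl linearP. Qed.
Let oformC x y : oform x y = oform y x.
Proof. by rewrite /oform brk_skew /= scaleN1r opprK. Qed.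

Let anticomm x y (v : V) :
  act (part true x) (act (part true y) v)
  = oform x y *: v - act (part true y) (act (part true x) v).
Proof.
rewrite /oform -wt (brk_even true true) act_brk /= expr1 scaleN1r opprK.
by rewrite addrK.
Qed.

Let square x (v : V) :
  act (part true x) (act (part true x) v) = (oform x x / 2) *: v.
Proof.
set X := act _ _; have E : X + X = oform x x *: v by rewrite {1}/X anticomm subrK.
by rewrite mulrC -scalerA -E; vcoefs C; field.
Qed.

Let split_act x (v : V) : act x v = lam x *: v + act (part true x) v.
Proof. by rewrite -[in LHS](part_sum x) actDl wt. Qed.

(** A radical [z] anticommutes with all odd elements and squares to zero, so its image is a
    submodule; by irreducibility it is zero or everything, and in the latter case
    [z V = z z V = 0]. *)
Let rad_act z : (forall u, oform z u = 0) -> forall v : V, act (part true z) v = 0.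
Proof.
move=> z0 v; pose U := limg (linfun (act (part true z) : V -> V)).
have memU w : act (part true z) w \in U.
  by have := memv_img (linfun (act (part true z) : V -> V)) (memvf w); rewrite lfunE.
have subU : is_submod U.
  split=> [p|x] _ /memv_imgP[w _ ->]; rewrite lfunE /=.
    by rewrite part_act !part_part act0l add0r.
  by rewrite split_act anticomm oformC z0 scale0r sub0r memvB ?memvZ.
case: irr => V0 /(_ U subU)[U0|UV].
  by apply/eqP; rewrite -memv0 -U0.
case/negP: V0; rewrite -UV -subv0; apply/subvP => _ /memv_imgP[w _ ->].
have /memv_imgP[w' _ ->] : w \in U by rewrite UV memvf.
by rewrite !lfunE /= square z0 mul0r scale0r mem0v.
Qed.

Variables (ep : bool) (e E : V).
Hypotheses (e0 : e != 0) (E0 : E != 0).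
Hypotheses (e_par : part ep e = e) (E_par : part (~~ ep) E = E).

(** Modulo the radical the odd part acts as a Clifford algebra with annihilator [p] and creator [q].
    A vector [v] killed by [p] spans with [q v] a submodule, hence all of [V], and parity makes [e],
    [E] multiples of these two. *)
Lemma rank_two_module :
  (forall v : V, exists s r, v = s *: e + r *: E)
  /\ exists u1 u2 : h,
    [/\ act (part true u1) e = E, act (part true u1) E = 0,
        act (part true u2) e = 0 & act (part true u2) E = e].
Proof.
have [p [q [pp qq pq formE]]] := rank_two_form oformPl oformC rk2.
have decomp u (v : V) : act (part true u) v
    = oform u q *: act (part true p) v + oform u p *: act (part true q) v.
  apply/eqP; rewrite -subr_eq0.
  pose z := (- oform u q) *: p + ((- oform u p) *: q + u).
  have /rad_act/(_ v) : forall w, oform z w = 0.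
    by move=> w; rewrite /z !oformPl (formE u w); ring.
  rewrite /z !partD !partZ !actDl !actZl => <-; apply/eqP.
  by vring C.
have PP (v : V) : act (part true p) (act (part true p) v) = 0.
  by rewrite square pp mul0r scale0r.
have QQ (v : V) : act (part true q) (act (part true q) v) = 0.
  by rewrite square qq mul0r scale0r.
have PQ (v : V) : act (part true p) (act (part true q) v)
    = v - act (part true q) (act (part true p) v).
  by rewrite anticomm pq scale1r.
have odd_par r x (v : V) : part r v = v ->
    part (~~ r) (act (part true x) v) = act (part true x) v.
  by move=> rv; rewrite part_act !part_part act0l add0r negbK rv.
(* Either [e] itself or [p e], since [p] acts with square zero. *)
have [d [v [v0 v_par Pv]]] : exists d (v : V),
    [/\ v != 0, part d v = v & act (part true p) v = 0].
  have [Pe|Pe] := eqVneq (act (part true p) e) 0; first by exists ep, e.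
  by exists (~~ ep), (act (part true p) e); rewrite PP odd_par.
pose w := act (part true q) v.
have w_par : part (~~ d) w = w by apply: odd_par.
have Pw : act (part true p) w = v by rewrite PQ Pv act0r subr0.
have Qw : act (part true q) w = 0 by rewrite QQ.
have w0 : w != 0.
  by apply: contra_neq v0 => w0; rewrite -Pw w0 act0r.
pose U := (<[v]> + <[w]>)%VS.
have memU s r : s *: v + r *: w \in U by rewrite memv_add ?memvZ ?memv_line.
have inU x : x \in U -> exists s r, x = s *: v + r *: w.
  by case/memv_addP=> _ /vlineP[s ->] [_ /vlineP[r ->] ->]; exists s, r.
have subU : is_submod U.
  split=> [r|x] _ /inU[s [t ->]].
    rewrite partD !partZ (part_hom _ v_par) (part_hom _ w_par).
    have := memU s 0; have := memU 0 t; rewrite !scale0r add0r addr0.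
    by case: d r {v_par w_par} => [] [] /=; rewrite ?scaler0 ?addr0 ?add0r.
  rewrite split_act decomp !actDr !actZr Pv Pw Qw -/w.
  have -> : lam x *: (s *: v + t *: w) + (oform x q *: (s *: 0 + t *: v)
      + oform x p *: (s *: w + t *: 0))
    = (lam x * s + oform x q * t) *: v + (lam x * t + oform x p * s) *: w.
    by vring C.
  exact: memU.
have UV : U = fullv.
  case: irr => _ /(_ U subU)[U0|//].
  have := memU 1 0; rewrite U0 memv0 scale1r scale0r addr0 => vz.
  by rewrite vz in v0.
have all_vw x : exists s r, x = s *: v + r *: w by apply: inU; rewrite UV memvf.
have line_v x : part d x = x -> exists s, x = s *: v.
  move=> xd; have [s [r xE]] := all_vw x; exists s.
  rewrite -xd xE partD !partZ v_par (part_hom _ w_par).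
  by case: (d) => /=; rewrite scaler0 addr0.
have line_w x : part (~~ d) x = x -> exists s, x = s *: w.
  move=> xd; have [s [r xE]] := all_vw x; exists r.
  rewrite -xd xE partD !partZ w_par (part_hom _ v_par).
  by case: (d) => /=; rewrite scaler0 add0r.
have [dep|dep] := eqVneq d ep.
  subst d; have [a ea] := line_v e e_par; have [b Eb] := line_w E E_par.
  have a0 : a != 0 by apply: contra_neq e0 => a0; rewrite ea a0 scale0r.
  have b0 : b != 0 by apply: contra_neq E0 => b0; rewrite Eb b0 scale0r.
  split=> [x|].
    have [s [r ->]] := all_vw x; exists (s / a), (r / b); rewrite ea Eb !scalerA.
    by rewrite !divfK.
  exists ((b / a) *: q), ((a / b) *: p); rewrite !partZ !actZl ea Eb !actZr.
  by rewrite Pv Pw Qw -/w !scaler0 !scalerA !divfK.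
have dE : ~~ d = ep by case: (d) (ep) dep => [] [].
have dE' : d = ~~ ep by rewrite -dE negbK.
have [a ea] := line_w e (etrans (congr1 (part^~ e) dE) e_par).
have [b Eb] := line_v E (etrans (congr1 (part^~ E) dE') E_par).
have a0 : a != 0 by apply: contra_neq e0 => a0; rewrite ea a0 scale0r.
have b0 : b != 0 by apply: contra_neq E0 => b0; rewrite Eb b0 scale0r.
split=> [x|].
  have [s [r ->]] := all_vw x; exists (r / a), (s / b); rewrite ea Eb !scalerA.
  by rewrite !divfK // addrC.
exists ((b / a) *: p), ((a / b) *: q); rewrite !partZ !actZl ea Eb !actZr.
by rewrite Pv Pw Qw -/w !scaler0 !scalerA !divfK.
Qed.

End RankTwoModule.

(** * Root vectors in a QKM algebra *)

Section CartanFacts.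
Variables (C : numClosedFieldType) (A : cartanDatum C).
Notation h := (cd_h A).
Notation n := (cd_n A).

(** Independence of the simple roots makes the matrix of their values on a basis right invertible.
    Passing to the even part is harmless, as roots vanish on the odd part. *)
Lemma grading_element :
  exists t : h, part false t = t /\ forall i, alpha i t = 1.
Proof.
pose b := vbasis {:h}.
pose M : 'M[C]_(n, \dim {:h}) := \matrix_(i, l) alpha i b`_l.
have fM : row_free M.
  apply: inj_row_free => v vM; apply/rowP => i; rewrite mxE.
  apply: (@alpha_indep C A (fun i => v 0 i)) => x.
  rewrite (coord_vbasis (memvf x)).
  under eq_bigr => k _ do rewrite linear_sum mulr_sumr.
  rewrite exchange_big big1 //= => l _.
  have := congr1 (fun u : 'rV_(\dim {:h}) => u 0 l) vM; rewrite !mxE => vMl.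
  under eq_bigr => k _ do rewrite linearZ /= mulrCA.
  rewrite -mulr_sumr -[RHS](mulr0 (coord (vbasis fullv) l x)); congr (_ * _).
  by rewrite -[RHS]vMl; apply: eq_bigr => k _; rewrite mxE.
pose u := pinvmx M *m (const_mx 1 : 'cV_n).
pose t := \sum_l u l 0 *: b`_l.
have ta i : alpha i t = 1.
  rewrite linear_sum; have := congr1 (fun w : 'cV_n => w i 0)
    (mulmxA M (pinvmx M) (const_mx 1)).
  rewrite mulmxVp // mul1mx !mxE => <-; apply: eq_bigr => l _.
  by rewrite linearZ /= [M _ _]mxE mulrC.
exists (part false t); rewrite part_part; split=> // i.
by have := ta i; rewrite -{1}[t]part_sum linearD /= alpha_odd addr0.
Qed.

Notation kH x := (gK_gen (GH x) : gKM A).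
Notation kP v := (gK_gen (GP v) : gKM A).
Notation kM v := (gK_gen (GM v) : gKM A).

Lemma kH_lin a x y : kH (a *: x + y) = a *: kH x + kH y.
Proof. by rewrite /gK_gen tH_lin quot_piP. Qed.
Lemma kP_lin i a (x y : gpos i) : kP (a *: x + y) = a *: kP x + kP y.
Proof. by rewrite /gK_gen tP_lin quot_piP. Qed.
Lemma kM_lin i a (x y : gneg i) : kM (a *: x + y) = a *: kM x + kM y.
Proof. by rewrite /gK_gen tM_lin quot_piP. Qed.
Lemma kH_part p x : kH (part p x) = part p (kH x).
Proof. by rewrite /gK_gen tH_part quot_pi_part. Qed.
Lemma kP_part i p (x : gpos i) : kP (part p x) = part p (kP x).
Proof. by rewrite /gK_gen tP_part quot_pi_part. Qed.
Lemma kM_part i p (x : gneg i) : kM (part p x) = part p (kM x).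
Proof. by rewrite /gK_gen tM_part quot_pi_part. Qed.
Lemma kHP i x (v : gpos i) : brk (kH x) (kP v) = kP (act x v).
Proof. by rewrite /gK_gen -quot_pi_brk tHP. Qed.
Lemma kHM i x (v : gneg i) : brk (kH x) (kM v) = kM (act x v).
Proof. by rewrite /gK_gen -quot_pi_brk tHM. Qed.
Lemma kPM i (v : gpos i) (y : gneg i) : brk (kP v) (kM y) = kH (rpair v y).
Proof. by rewrite /gK_gen -quot_pi_brk tPM. Qed.
Lemma kPM0 i j (v : gpos i) (y : gneg j) : i != j -> brk (kP v) (kM y) = 0.
Proof. by move=> ij; rewrite /gK_gen -quot_pi_brk tPM0 // /quot_pi lqpi0. Qed.

Lemma kP0 i : kP (0 : gpos i) = 0.
Proof. by have := kP_lin (-1) (0 : gpos i) 0; rewrite scaler0 addr0 scaleN1r addNr. Qed.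
Lemma kM0 i : kM (0 : gneg i) = 0.
Proof. by have := kM_lin (-1) (0 : gneg i) 0; rewrite scaler0 addr0 scaleN1r addNr. Qed.
Lemma kPZ i a (v : gpos i) : kP (a *: v) = a *: kP v.
Proof. by have := kP_lin a v 0; rewrite kP0 !addr0. Qed.
Lemma kPD i (v w : gpos i) : kP (v + w) = kP v + kP w.
Proof. by have := kP_lin 1 v w; rewrite !scale1r. Qed.
Lemma kMZ i a (v : gneg i) : kM (a *: v) = a *: kM v.
Proof. by have := kM_lin a v 0; rewrite kM0 !addr0. Qed.

Lemma kMP0 i j (v : gpos i) (y : gneg j) : i != j -> brk (kM y) (kP v) = 0.
Proof.
move=> ij; rewrite -[kM y]part_sum -[kP v]part_sum !(brkDl, brkDr).
have E p q : brk (part p (kM y)) (part q (kP v)) = 0.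
  by rewrite brk_skew -kM_part -kP_part kPM0 // scaler0 oppr0.
by rewrite !E !addr0.
Qed.

Lemma kH_act_eq0 x k (v : gpos k) : kH x = 0 -> act x v = 0.
Proof.
have [t [te ta]] := grading_element; apply: (gK_GH_eq0 te ta (c := 1)) => m.
by rewrite -te gpos_wt ta.
Qed.

Lemma rpair_hroot (i : 'I_n) (v : gpos i) (y : gneg i) : rpair v y \in hroot i.
Proof.
rewrite (coord_vbasis (memvf v)) (coord_vbasis (memvf y)).
have suml (I : finType) (F : I -> gpos i) z :
    rpair (\sum_l F l) z = \sum_l rpair (F l) z.
  by elim/big_rec2: _ => [|l a b _ <-]; rewrite ?rpair0l ?rpairDl.
have sumr (I : finType) (F : I -> gneg i) z :
    rpair z (\sum_l F l) = \sum_l rpair z (F l).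
  by elim/big_rec2: _ => [|l a b _ <-]; rewrite ?rpair0r ?rpairDr.
rewrite suml; apply: memv_suml => l _; rewrite sumr; apply: memv_suml => m _.
rewrite rpairZl rpairZr; do 2!apply: memvZ; apply: memv_span.
by apply/allpairsP; exists ((vbasis fullv)`_l, (vbasis fullv)`_m);
  rewrite !mem_nth ?size_tuple.
Qed.

Lemma hroot_killsP (i j : 'I_n) :
  hroot_kills i j <-> forall (v : gpos i) (y : gneg i) (w : gpos j), act (rpair v y) w = 0.
Proof.
split=> [kij v y w|kij x w]; first exact/kij/rpair_hroot.
set bs := [seq rpair x y | x <- vbasis {:gpos i}, y <- vbasis {:gneg i}].
move=> xin; rewrite (coord_span (X := in_tuple bs) xin).
have suml (I : finType) (F : I -> h) :
    act (\sum_l F l) w = \sum_l act (F l) w.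
  by elim/big_rec2: _ => [|l a b _ <-]; rewrite ?act0l ?actDl.
rewrite suml big1 // => l _; rewrite actZl.
have /allpairsP[[v y] [_ _ ->]] : (in_tuple bs)`_l \in bs by rewrite mem_nth.
by rewrite kij scaler0.
Qed.

End CartanFacts.

Section Structure.
Variables (C : numClosedFieldType) (A : cartanDatum C) (G : generators A).
Notation h := (cd_h A).
Notation n := (cd_n A).
Hypotheses (km3 : KM3 A) (km4 : KM4 A).

Let par i := gen_odd (gtype G i).

Lemma gpos_structure i :
  (forall v : gpos i, exists s r, v = s *: ge G i + r *: gE G i)
  /\ exists u1 u2 : h,
    [/\ act (part true u1) (ge G i) = gE G i, act (part true u1) (gE G i) = 0,
        act (part true u2) (ge G i) = 0 & act (part true u2) (gE G i) = ge G i].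
Proof.
exact: (@rank_two_module _ _ _ _ (@gpos_wt _ _ i) (km3 i) (km4 i).1 (par i) _ _
  (ge_neq0 G i) (gE_neq0 G i) (ge_part G i) (gE_part G i)).
Qed.

Lemma gpos_line p i (v w : gpos i) : (w = ge G i \/ w = gE G i) ->
  part p w = w -> part p v = v -> exists c, v = c *: w.
Proof.
move=> wE pw pv; have [s [r vE]] := (gpos_structure i).1 v.
have eq_par q : part q w = w -> p = q.
  move=> qw; apply/eqP/negPn/negP => npq; case: wE => wE.
    by have := ge_neq0 G i; rewrite -wE -pw -qw part_part (negbTE npq) eqxx.
  by have := gE_neq0 G i; rewrite -wE -pw -qw part_part (negbTE npq) eqxx.
rewrite -pv vE partD !partZ; case: wE => wE.
  have pE : p = par i by apply: eq_par; rewrite wE ge_part.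
  exists s; rewrite wE pE ge_part (part_hom _ (gE_part G i)).
  by rewrite -/(par i); case: (par i) => /=; rewrite scaler0 addr0.
have pE : p = ~~ par i by apply: eq_par; rewrite wE gE_part.
exists r; rewrite wE pE gE_part (part_hom _ (ge_part G i)).
by rewrite -/(par i); case: (par i) => /=; rewrite scaler0 add0r.
Qed.

Lemma act_ge i x : exists c, act (part true x) (ge G i) = c *: gE G i.
Proof.
apply: (@gpos_line (~~ par i)); [by right | exact: gE_part |].
by rewrite part_act !part_part act0l add0r negbK ge_part.
Qed.
Lemma act_gE i x : exists c, act (part true x) (gE G i) = c *: ge G i.
Proof.
apply: (@gpos_line (par i)); [by left | exact: ge_part |].
by rewrite part_act !part_part act0l add0r gE_part.
Qed.

(** [fa] and [fb] are the linear forms $a_i$ and $b_i$, applied to the odd part of [x]. *)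
Definition fa i x : C := projT1 (cid (act_ge i x)).
Definition fb i x : C := projT1 (cid (act_gE i x)).

Lemma faE i x : act (part true x) (ge G i) = fa i x *: gE G i.
Proof. by rewrite /fa; case: cid. Qed.
Lemma fbE i x : act (part true x) (gE G i) = fb i x *: ge G i.
Proof. by rewrite /fb; case: cid. Qed.

Lemma gE_inj i a b : a *: gE G i = b *: gE G i -> a = b.
Proof.
move/eqP; rewrite -subr_eq0 -scalerBl scaler_eq0 (negbTE (gE_neq0 G i)) orbF.
by rewrite subr_eq0 => /eqP.
Qed.
Lemma ge_inj i a b : a *: ge G i = b *: ge G i -> a = b.
Proof.
move/eqP; rewrite -subr_eq0 -scalerBl scaler_eq0 (negbTE (ge_neq0 G i)) orbF.
by rewrite subr_eq0 => /eqP.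
Qed.

Lemma fab_units i : exists u1 u2 : h,
  [/\ fa i u1 = 1, fb i u1 = 0, fa i u2 = 0 & fb i u2 = 1].
Proof.
have [_ [u1 [u2 [u1e u1E u2e u2E]]]] := gpos_structure i.
by exists u1, u2; split; [apply: (@gE_inj i); rewrite -faE u1e scale1r
  | apply: (@ge_inj i); rewrite -fbE u1E scale0r | apply: (@gE_inj i); rewrite -faE u2e scale0r
  | apply: (@ge_inj i); rewrite -fbE u2E scale1r].
Qed.

Lemma gf_part i : part (par i) (gf G i) = gf G i.
Proof.
have [_ vp _] := gveeP G i.
by rewrite /gf partZ -vp; congr (_ *: gvee G i _); apply: ge_part.
Qed.
Lemma gF_part i : part (~~ par i) (gF G i) = gF G i.
Proof.
have [_ vp _] := gveeP G i.
by rewrite /gF partZ -vp; congr (_ *: gvee G i _); apply: gE_part.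
Qed.

Lemma omegaV_odd (x : h) : omegaV (part true x) = - 'i *: part true x.
Proof. by rewrite /omegaV !part_part /= oppr0 add0r scaleNr. Qed.

(** The dual action multiplies an odd element by $-\sqrt{-1}$; the factors $\sqrt{-1}$ in [gf] and
    [gF] absorb this up to the displayed sign. *)
Lemma act_gf i x :
  act (part true x) (gf G i) = ((-1) ^+ (~~ par i) * fa i x) *: gF G i.
Proof.
have [_ _ va] := gveeP G i.
rewrite /gf /gF actZr -va -[act _ _]/(act (omegaV (part true x)) (ge G i)).
rewrite omegaV_odd actZl faE !linearZ /= !scalerA -/(par i).
have i2 := sqrCi C; congr (_ *: _); case: (par i) => /=; rewrite ?expr0 ?expr1.
  by transitivity (- 'i ^+ 2 * fa i x); [ring | rewrite i2; ring].
by ring.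
Qed.

Lemma gneg_span i (y : gneg i) : exists s r, y = s *: gf G i + r *: gF G i.
Proof.
have [[w wK Kw] _ _] := gveeP G i; have [s [r wE]] := (gpos_structure i).1 (w y).
pose k := if par i then 'i else 1 : C; pose k' := if par i then 1 else 'i : C.
have k0 : k != 0 by rewrite /k; case: (par i); rewrite ?neq0Ci ?oner_eq0.
have k'0 : k' != 0 by rewrite /k'; case: (par i); rewrite ?neq0Ci ?oner_eq0.
exists (s / k), (r / k'); rewrite /gf /gF -/(par i) -/k -/k' !scalerA !divfK //.
by rewrite -[LHS]Kw wE linearD !linearZ.
Qed.

Lemma gh_part i : part false (gh G i) = gh G i.
Proof.
have := rpair_even (par i) (par i) (ge G i) (gf G i).
by rewrite addbb ge_part gf_part.
Qed.
Lemma gc_part i : part false (gc G i) = gc G i.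
Proof.
have := rpair_even (~~ par i) (~~ par i) (gE G i) (gF G i).
by rewrite addbb gE_part gF_part.
Qed.
Lemma gH_part i : part true (gH G i) = gH G i.
Proof.
have := rpair_even (~~ par i) (par i) (gE G i) (gf G i).
by rewrite addNb addbb gE_part gf_part.
Qed.

Lemma fa_gH i j : fa j (gH G i) = gX G i j.
Proof. by apply: (@gE_inj j); rewrite -faE gH_part gXP. Qed.
Lemma fb_gH i j : fb j (gH G i) = gY G i j.
Proof. by apply: (@ge_inj j); rewrite -fbE gH_part gYP. Qed.

Lemma brk_gH i x :
  brk (part true x) (gH G i) = fb i x *: gh G i + fa i x *: gc G i.
Proof.
rewrite /gH -(gE_part G i) rpair_act gE_part fbE act_gf rpairZl [rpair _ (_ *: gF G i)]rpairZr.
rewrite -/(gh G i) -/(gc G i) -/(par i).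
by case: (par i) => /=; vring C.
Qed.

Lemma rpair_ge_gF i : rpair (ge G i) (gF G i) = gH G i.
Proof.
have [u1 [_ [u1a _ _ _]]] := fab_units i.
have : brk (part true u1) (gh G i) = 0.
  by rewrite -gh_part brk_skew cd_qt scaler0 oppr0.
rewrite /gh -(ge_part G i) rpair_act ge_part faE act_gf u1a mulr1 [rpair _ (_ *: gF G i)]rpairZr scale1r.
rewrite -/(gH G i) -/(par i) => /eqP; rewrite addr_eq0 => /eqP ->.
by case: (par i) => /=; vring C.
Qed.

Lemma alpha_brk i x y : alpha i (brk (part true x) (part true y))
  = fa i x * fb i y + fa i y * fb i x.
Proof.
apply: (@ge_inj i); rewrite -gpos_wt (brk_even true true) act_brk !faE.
by rewrite !actZr !fbE /= !scalerA; vring C.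
Qed.

Lemma gH_comm i j : gY G j i *: gh G i + gX G j i *: gc G i
  = gY G i j *: gh G j + gX G i j *: gc G j.
Proof.
rewrite -!fa_gH -!fb_gH -!brk_gH !gH_part -(gH_part j) -(gH_part i) brk_skew /=.
by rewrite scaleN1r opprK.
Qed.

(* The alpha_k-value of [H_i, H_j] = [H_j, H_i]. *)
Lemma gH_comm_alpha i j k :
  gY G j i * alpha k (gh G i) + gX G j i * alpha k (gc G i)
  = gY G i j * alpha k (gh G j) + gX G i j * alpha k (gc G j).
Proof.
by have := congr1 (alpha k) (gH_comm i j); rewrite !linearD !linearZ.
Qed.

(** Two evaluations of [alpha j] on $[x, H_i]$: the right side comes from [brk_gH], the left side
    from the action on [ge G j]. *)
Lemma fab_rel i j x : gX G i j * fb j x + gY G i j * fa j x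
  = alpha j (gh G i) * fb i x + alpha j (gc G i) * fa i x.
Proof.
have := congr1 (alpha j) (brk_gH i x); rewrite linearD !linearZ /= -{1}(gH_part i).
by rewrite alpha_brk fa_gH fb_gH => E; transitivity (fa j x * gY G i j + gX G i j * fb j x);
  [ring | rewrite E; ring].
Qed.

Lemma fab_rel_gH i j k : gX G i j * gY G k j + gY G i j * gX G k j
  = alpha j (gh G i) * gY G k i + alpha j (gc G i) * gX G k i.
Proof. by have := fab_rel i j (gH G k); rewrite !fa_gH !fb_gH. Qed.

Lemma alpha_gh i : alpha i (gh G i) = gX G i i.
Proof.
have [_ [u [_ _ ua ub]]] := fab_units i.
by have := fab_rel i i u; rewrite ua ub !mulr0 !mulr1 !addr0 => ->.
Qed.
Lemma alpha_gc i : alpha i (gc G i) = gY G i i.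
Proof.
have [u [_ [ua ub _ _]]] := fab_units i.
by have := fab_rel i i u; rewrite ua ub !mulr0 !mulr1 !add0r => ->.
Qed.

Lemma gXY_eq0 i j : alpha j (gh G i) = 0 -> alpha j (gc G i) = 0 ->
  gX G i j = 0 /\ gY G i j = 0.
Proof.
move=> n0 c0; have [u [v [ua ub va vb]]] := fab_units j; split.
  by have := fab_rel i j v; rewrite va vb n0 c0 !mulr0 !mulr1 !addr0 !mul0r addr0.
by have := fab_rel i j u; rewrite ua ub n0 c0 !mulr0 !mulr1 !add0r !mul0r addr0.
Qed.
Lemma gXY_alpha i j : gX G i j = 0 -> gY G i j = 0 ->
  alpha j (gh G i) = 0 /\ alpha j (gc G i) = 0.
Proof.
move=> x0 y0; have [u [v [ua ub va vb]]] := fab_units i; split.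
  by have := fab_rel i j v; rewrite va vb x0 y0 !mulr0 !mulr1 !addr0 !mul0r addr0.
by have := fab_rel i j u; rewrite ua ub x0 y0 !mulr0 !mulr1 !add0r !mul0r addr0.
Qed.

(** $\mathfrak h_{\alpha_i}$ is spanned by $h_i$, $c_i$, $H_i$, and by [gXY_alpha] the action of
    $H_i$ on the root space of $\alpha_j$ controls the other two. *)
Lemma gXY_kills i j : gX G i j = 0 /\ gY G i j = 0 <-> hroot_kills i j.
Proof.
rewrite hroot_killsP; split=> [[x0 y0] v y w|kij]; last first.
  by split; [apply: (@gE_inj j) | apply: (@ge_inj j)]; rewrite ?scale0r -?gXP -?gYP;
    apply: kij.
have [n0 c0] := gXY_alpha x0 y0.
have [s [r ->]] := (gpos_structure i).1 v; have [s' [r' ->]] := gneg_span y.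
have [a [b ->]] := (gpos_structure j).1 w.
have R (e E : gpos i) (f F : gneg i) : rpair (s *: e + r *: E) (s' *: f + r' *: F)
    = (s * s') *: rpair e f + (s * r') *: rpair e F
      + ((r * s') *: rpair E f + (r * r') *: rpair E F).
  by rewrite !(rpairDl, rpairDr, rpairZl, rpairZr); vring C.
rewrite R rpair_ge_gF -/(gh G i) -/(gc G i) -/(gH G i) !(actDl, actZl, actDr, actZr).
rewrite gXP gYP x0 y0 !scale0r -(gh_part i) -(gc_part i) !gpos_wt n0 c0 !scale0r.
by vring C.
Qed.

(* The pairing with [gneg i] reduces this to the part of [h] that acts
   nontrivially on some [gpos k], which the coinduced module detects. *)
Lemma kP_inj : (forall i : 'I_n, exists k, ~ hroot_kills i k) ->
  forall i (v : gpos i), gK_gen (GP v) = 0 :> gKM A -> v = 0.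
Proof.
move=> nk i v kv; have [s [r vE]] := (gpos_structure i).1 v.
have kpart p : gK_gen (GP (part p v)) = 0 :> gKM A by rewrite kP_part kv part0.
have kact x (w : gpos i) : gK_gen (GP w) = 0 :> gKM A -> gK_gen (GP (act x w)) = 0 :> gKM A.
  by move=> kw; rewrite -kHP kw brk0r.
have [u1 [u2 [u1e u1E u2e u2E]]] := (gpos_structure i).2.
have ke0 : gK_gen (GP (ge G i)) = 0 :> gKM A -> False.
  move=> ke; have kE : gK_gen (GP (gE G i)) = 0 :> gKM A by rewrite -u1e; apply: kact.
  have [k] := nk i; apply; apply/hroot_killsP => w y z; apply: kH_act_eq0.
  have [a [b ->]] := (gpos_structure i).1 w.
  by rewrite -kPM kPD !kPZ ke kE !scaler0 addr0 brk0l.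
have kE0 : gK_gen (GP (gE G i)) = 0 :> gKM A -> False.
  by move=> kE; apply: ke0; rewrite -u2E; apply: kact.
have sE : part (par i) v = s *: ge G i.
  rewrite vE partD !partZ ge_part (part_hom _ (gE_part G i)) -/(par i).
  by case: (par i) => /=; rewrite scaler0 addr0.
have rE : part (~~ par i) v = r *: gE G i.
  rewrite vE partD !partZ gE_part (part_hom _ (ge_part G i)) -/(par i).
  by case: (par i) => /=; rewrite scaler0 add0r.
have [s0|s0] := eqVneq s 0; last first.
  case: ke0; have := kpart (par i); rewrite sE kPZ => /eqP.
  by rewrite scaler_eq0 (negbTE s0) => /eqP.
have [r0|r0] := eqVneq r 0; last first.
  case: kE0; have := kpart (~~ par i); rewrite rE kPZ => /eqP.
  by rewrite scaler_eq0 (negbTE r0) => /eqP.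
by rewrite vE s0 r0 !scale0r addr0.
Qed.

End Structure.

(** * Consequences of integrability *)

Section LowestWeight.
Variables (C : numFieldType) (g : lieSuperType C).
Implicit Types e f v : g.

(** At the last nonzero vector of the string, lowering the next one, which is zero, forces the
    coefficient to vanish. *)
Lemma lowering_coef0 e f v (c : nat -> C) N :
  (forall m, brk f (iter m.+1 (brk e) v) = c m *: iter m (brk e) v) ->
  v != 0 -> iter N (brk e) v = 0 -> exists m, c m = 0.
Proof.
move=> fe v0; elim: N => [|N IH] eN; first by rewrite -eN eqxx in v0.
have := fe N; rewrite eN brk0r => /esym/eqP; rewrite scaler_eq0.
by case/orP => /eqP; [exists N | apply: IH].
Qed.

Variables (e f hh v : g) (kappa lam : C) (N : nat).
Hypotheses (efh : brk e f = hh) (hev : part false hh = hh).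
Hypotheses (he : brk hh e = kappa *: e) (hv : brk hh v = lam *: v).
Hypotheses (fv : brk f v = 0) (v0 : v != 0) (nil : iter N (brk e) v = 0).

Let h_iter m : brk hh (iter m (brk e) v) = (lam + m%:R * kappa) *: iter m (brk e) v.
Proof.
elim: m => [|m IH] /=; first by rewrite hv mul0r addr0.
by rewrite even_jacobi // he IH brkZl brkZr -scalerDl; congr (_ *: _); ring.
Qed.

Lemma lowest_weight_even : part false e = e -> part false f = f ->
  exists m : nat, lam + kappa * m%:R / 2 = 0.
Proof.
move=> ee fe; have fe_h : brk f e = - hh by rewrite -efh even_skew.
have [|m cm] := @lowering_coef0 e f v
    (fun m => - (m.+1%:R * (lam + kappa * m%:R / 2))) N _ v0 nil.
  elim=> [|m IH] /=.
    by rewrite even_jacobi // fe_h brkNl hv fv brk0r addr0 mulr0 mul0r addr0 mul1r scaleNr.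
  rewrite even_jacobi // fe_h brkNl -[brk e (iter m _ _)]/(iter m.+1 (brk e) v).
  rewrite h_iter IH brkZr -[brk e (iter m _ _)]/(iter m.+1 (brk e) v) -scaleNr -scalerDl.
  by congr (_ *: _); field.
exists m; apply/eqP; move/eqP: cm; rewrite oppr_eq0 mulf_eq0 pnatr_eq0 /=.
by [].
Qed.

Lemma lowest_weight_odd : part true e = e -> part true f = f -> kappa != 0 ->
  exists m : nat, lam + kappa * m%:R = 0.
Proof.
move=> eo fo k0; have fe_h : brk f e = hh.
  by rewrite -efh (hom_skew fo eo) /= scaleN1r opprK.
(* For odd [e], [f] the lowering coefficients alternate, as in [osp(1|2)]; those at odd [m] are
   nonzero multiples of [kappa], so the vanishing one sits at even [m]. *)
pose c m : C := if odd m then (uphalf m)%:R * kappa else lam + (m./2)%:R * kappa.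
have [|m cm] := @lowering_coef0 e f v c N _ v0 nil.
  elim=> [|m IH] /=.
    by rewrite (hom_jacobi _ fo eo) fe_h hv fv brk0r scaler0 addr0 /c /= mul0r addr0.
  rewrite (hom_jacobi _ fo eo) fe_h -[brk e (iter m _ _)]/(iter m.+1 (brk e) v).
  rewrite h_iter IH brkZr -[brk e (iter m _ _)]/(iter m.+1 (brk e) v) scalerA -scalerDl.
  congr (_ *: _); rewrite /c /= -[in m.+1%:R](odd_double_half m) uphalf_half.
  by case: (odd m) => /=; rewrite ?add0n ?add1n -?addnn -addn1 !natrD /=; ring.
move: cm; rewrite /c; case: ifP => [om /eqP|_ E]; last first.
  by exists m./2; rewrite -[RHS]E; ring.
rewrite mulf_eq0 (negbTE k0) pnatr_eq0 orbF => /eqP u0.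
by have := uphalf_half m; rewrite om u0.
Qed.

End LowestWeight.

Section TwoParameters.
Variables (C : numFieldType) (g : lieSuperType C).
Variables (X Y X' Y' a c H : g) (kappa mu : C) (N : nat).
Hypotheses (Xe : part false X = X) (X'e : part false X' = X').
Hypotheses (Yo : part true Y = Y) (Y'o : part true Y' = Y').
Hypotheses (ae : part false a = a) (ce : part false c = c).
Hypotheses (XX : brk X X' = a) (YY : brk Y Y' = c) (XY : brk X Y' = H) (YX : brk Y X' = H).
Hypotheses (aX : brk a X = kappa *: X) (aY : brk a Y = kappa *: Y).
Hypotheses (cX : brk c X = mu *: X) (HX : brk H X = kappa *: Y) (HY : brk H Y = mu *: X).
Hypothesis nil : iter N (brk X) Y = 0.

(* If mu <> 0 then w = [X, Y] is a lowest vector of weight 2 kappa for the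
   triple X, X', a. *)
Lemma two_parameters : X != 0 -> kappa != 0 -> mu = 0.
Proof.
move=> X0 k0; pose w := brk X Y.
have X'X : brk X' X = - a by rewrite -XX even_skew.
have X'Y : brk X' Y = - H by rewrite -YX (even_skew Y X'e) opprK.
have XH : brk X H = - (kappa *: Y) by rewrite -HX (even_skew H Xe) opprK.
have X'w : brk X' w = 0.
  by rewrite even_jacobi // X'X X'Y brkNl brkNr aY XH; vring C.
have aw : brk a w = (2 * kappa) *: w.
  by rewrite even_jacobi // aX aY brkZl brkZr /w; vring C.
have w0 : w = 0.
  apply/eqP/negPn/negP => wn0.
  have nilw : iter N (brk X) w = 0.
    by rewrite -[w]/(brk X Y) -iterSr iterS nil brk0r.
  (* In units of [kappa / 2] the lowest weight is 4, so [4 + m] would have to vanish. *)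
  have [m /eqP] := lowest_weight_even XX ae aX aw X'w wn0 nilw Xe X'e.
  have -> : 2 * kappa + kappa * m%:R / 2 = (4 + m)%:R * (kappa / 2).
    by rewrite natrD; field.
  by rewrite mulf_eq0 pnatr_eq0 mulf_eq0 invr_eq0 pnatr_eq0 (negbTE k0).
(* Expanded by the Jacobi identity, this bracket is [-2 mu X]. *)
have : brk Y' w = 0 by rewrite w0 brk0r.
rewrite (hom_jacobi _ Y'o Xe) /= scale1r (even_skew Y' Xe) XY brkNl HY.
rewrite (hom_skew Y'o Yo) YY /= scaleN1r opprK.
have -> : brk X c = - (mu *: X) by rewrite -cX (even_skew X ce).
rewrite -opprD => /eqP; rewrite oppr_eq0 -scalerDl scaler_eq0 (negbTE X0) orbF.
by rewrite -mulr2n -mulr_natl mulf_eq0 pnatr_eq0 => /eqP.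
Qed.

End TwoParameters.

Lemma takiff_nilp (C : fieldType) (s : quadLieSuperType C) :
  (forall x y z : s, brk x (brk y z) = 0) ->
  (forall x y z : s, sform x (brk y z) = 0) ->
  forall u v w : takiff s, brk u (brk v w) = 0.
Proof.
move=> nil form u v w.
have fD (x y z : s) : sform x (y + z) = sform x y + sform x z :> C.
  by have := sform_linearr x 1 y z; rewrite scale1r mul1r.
apply: takP => /=.
- exact: nil.
- by rewrite sgn_brk nil addr0 brkDr !nil addr0.
- by rewrite sgnD !sgn_brk fD !form addr0.
Qed.

(** * Nilpotency in type Tak(sl(1|1)) *)

Section TakiffSL11.
Variable C : fieldType.
Implicit Types A B : 'M[C]_(1 + 1).

Let i0 : 'I_(1 + 1) := ord0.
Let i1 : 'I_(1 + 1) := ord_max.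

(** Supertraceless matrices of this size have scalar diagonal, so only off-diagonal entries
    contribute. *)
Lemma sl11_brk A B : str (m:=1) (n:=1) A = 0 -> str (m:=1) (n:=1) B = 0 ->
  mxbrk (m:=1) (n:=1) A B = (A i0 i1 * B i1 i0 + A i1 i0 * B i0 i1)%:M.
Proof.
have enum (F : 'I_(1 + 1) -> C) : \sum_i F i = F i0 + F i1.
  rewrite big_ord_recl big_ord1; congr (F _ + F _); exact: val_inj.
rewrite /str !enum /= !expr0 !expr1 !mul1r !mulN1r => /eqP; rewrite subr_eq0 => /eqP EA.
move/eqP; rewrite subr_eq0 => /eqP EB.
have ord_case (i : 'I_(1 + 1)) : i = i0 \/ i = i1.
  by case: i => [[|[|//]] lti]; [left | right]; apply: val_inj.
apply/matrixP => i j; rewrite /mxbrk !big_bool !mxE !enum.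
by case: (ord_case i) => ->; case: (ord_case j) => ->;
  rewrite !mxE /= ?EA ?EB ?mulr1n ?mulr0n; ring.
Qed.

Lemma scalar_str (k : C) : str (m:=1) (n:=1) k%:M = 0.
Proof.
by rewrite /str big_ord_recl big_ord1 !mxE /= !mulr1n expr0 expr1 mul1r mulN1r subrr.
Qed.

Let str0 (x : sl C 1 1) : str (sub_val x) = 0.
Proof. by apply/eqP; rewrite -mem_sl sub_val_mem. Qed.

Lemma sl11_nilp (x y z : sl C 1 1) : brk x (brk y z) = 0.
Proof.
apply: sub_val_inj; rewrite [LHS]sub_val_brk.
rewrite -[brk _ _]/(mxbrk (m:=1) (n:=1) (sub_val x) (sub_val (brk y z))).
rewrite [X in mxbrk _ X]sub_val_brk.
rewrite -[X in mxbrk _ X]/(mxbrk (m:=1) (n:=1) (sub_val y) (sub_val z)).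
rewrite (sl11_brk (str0 y) (str0 z)) (sl11_brk (str0 x) (scalar_str _)) !mxE /=.
rewrite !mulr0n !mulr0 addr0; transitivity (0 : glmx C 1 1).
  by apply/matrixP => i j; rewrite !mxE mul0rn.
by have E := sub_valD x (- x); rewrite sub_valN !subrr in E; rewrite -[LHS]E.
Qed.

Lemma sl11_form (x y z : sl C 1 1) : sform x (brk y z) = 0.
Proof.
rewrite -[sform _ _]/(mxform (m:=1) (n:=1) (sub_val x) (sub_val (brk y z))).
rewrite [X in mxform _ X]sub_val_brk.
rewrite -[X in mxform _ X]/(mxbrk (m:=1) (n:=1) (sub_val y) (sub_val z)).
rewrite (sl11_brk (str0 y) (str0 z)) /mxform mul_mx_scalar linearZ /=.
by rewrite str0 mulr0.
Qed.

(** Hence, in type Tak(sl(1|1)), $h_i$ and $c_i$ commute with $e_i$, being brackets in the root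
    subalgebra. *)
Lemma takiff_sl11_nilp (u v w : takiff (sl C 1 1)) : brk u (brk v w) = 0.
Proof. exact: takiff_nilp sl11_nilp sl11_form u v w. Qed.

End TakiffSL11.

Section Integrable.
Variables (C : numClosedFieldType) (A : cartanDatum C) (G : generators A).
Notation h := (cd_h A).
Notation n := (cd_n A).
Notation kH x := (gK_gen (GH x) : gKM A).
Notation kP v := (gK_gen (GP v) : gKM A).
Notation kM v := (gK_gen (GM v) : gKM A).
Hypotheses (km1 : KM1 A) (km3 : KM3 A) (km4 : KM4 A).
Hypothesis nk : forall i : 'I_n, exists k, ~ hroot_kills i k.

Let par i := gen_odd (gtype G i).

Lemma kP_neq0 i (v : gpos i) : v != 0 -> kP v != 0.
Proof. by apply: contra_neq => /(kP_inj G km3 km4 nk). Qed.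

Lemma ad_nilpotent s (i : 'I_n) t (j : 'I_n) x y : groot s i x -> groot t j y ->
  exists N, iter N (brk x) y = 0.
Proof.
move=> gx gy; have [N nil] := @km1 s i t j; exists N.
have -> : iter N (brk x) y = foldr brk y (nseq N x) by elim: (N) => //= m ->.
by apply: nil; rewrite ?size_nseq // => z; rewrite mem_nseq => /andP[_ /eqP->].
Qed.

Let gP i (v : gpos i) : groot false i (kP v). Proof. by exists v. Qed.
Let gM i (v : gneg i) : groot true i (kM v). Proof. by exists v. Qed.

Lemma kHP_even i x (v : gpos i) : part false x = x -> brk (kH x) (kP v) = alpha i x *: kP v.
Proof. by move=> xe; rewrite kHP -[in LHS]xe gpos_wt kPZ. Qed.

Lemma kh_part i : part false (kH (gh G i)) = kH (gh G i).
Proof. by rewrite -kH_part gh_part. Qed.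
Lemma kc_part i : part false (kH (gc G i)) = kH (gc G i).
Proof. by rewrite -kH_part gc_part. Qed.
Lemma ke_part i : part (par i) (kP (ge G i)) = kP (ge G i).
Proof. by rewrite -kP_part ge_part. Qed.
Lemma kE_part i : part (~~ par i) (kP (gE G i)) = kP (gE G i).
Proof. by rewrite -kP_part gE_part. Qed.
Lemma kf_part i : part (par i) (kM (gf G i)) = kM (gf G i).
Proof. by rewrite -kM_part gf_part. Qed.
Lemma kF_part i : part (~~ par i) (kM (gF G i)) = kM (gF G i).
Proof. by rewrite -kM_part gF_part. Qed.

Lemma kh_act i j (v : gpos j) : brk (kH (gh G i)) (kP v) = alpha j (gh G i) *: kP v.
Proof. exact/kHP_even/gh_part. Qed.
Lemma kc_act i j (v : gpos j) : brk (kH (gc G i)) (kP v) = alpha j (gc G i) *: kP v.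
Proof. exact/kHP_even/gc_part. Qed.
Lemma kh_diag i (v : gpos i) : brk (kH (gh G i)) (kP v) = gX G i i *: kP v.
Proof. by rewrite kh_act (alpha_gh G km3 km4). Qed.
Lemma kc_diag i (v : gpos i) : brk (kH (gc G i)) (kP v) = gY G i i *: kP v.
Proof. by rewrite kc_act (alpha_gc G km3 km4). Qed.

Let gX_act i : brk (kH (gH G i)) (kP (ge G i)) = gX G i i *: kP (gE G i).
Proof. by rewrite kHP gXP kPZ. Qed.
Let gY_act i : brk (kH (gH G i)) (kP (gE G i)) = gY G i i *: kP (ge G i).
Proof. by rewrite kHP gYP kPZ. Qed.

Lemma diag_sl2 i : gtype G i = TakSL2 -> gX G i i = 2 /\ gY G i i = 0.
Proof.
move=> ti; have p0 : par i = false by rewrite /par ti.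
have x2 : gX G i i = 2.
  by rewrite -(alpha_gh G km3 km4); have := g_scale G i; rewrite ti.
have [N nil] := ad_nilpotent (gP (ge G i)) (gP (gE G i)); split=> //.
apply: (@two_parameters C _ (kP (ge G i)) (kP (gE G i)) (kM (gf G i)) (kM (gF G i))
  (kH (gh G i)) (kH (gc G i)) (kH (gH G i)) (gX G i i) (gY G i i) N);
  rewrite ?gX_act ?gY_act ?kh_part ?kc_part ?kPM ?(rpair_ge_gF G km3 km4) //.
- by have := ke_part i; rewrite p0.
- by have := kf_part i; rewrite p0.
- by have := kE_part i; rewrite p0.
- by have := kF_part i; rewrite p0.
- exact: kh_diag.
- exact: kh_diag.
- exact: kc_diag.
- exact/kP_neq0/ge_neq0.
- by rewrite x2 pnatr_eq0.
Qed.

(** Here $E_i$ is the even generator, so [two_parameters] applies with $e_i$ and $E_i$ exchanged: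
    $y_{ii} \ne 0$ would force $x_{ii} = 0$. *)
Lemma diag_osp i : gtype G i = TakOSP12 -> gX G i i = 1 /\ gY G i i = 0.
Proof.
move=> ti; have p1 : par i = true by rewrite /par ti.
have x1 : gX G i i = 1.
  by rewrite -(alpha_gh G km3 km4); have := g_scale G i; rewrite ti.
have [N nil] := ad_nilpotent (gP (gE G i)) (gP (ge G i)); split=> //.
apply/eqP/negPn/negP => y0; suff : gX G i i = 0 by rewrite x1; apply/eqP/oner_neq0.
apply: (@two_parameters C _ (kP (gE G i)) (kP (ge G i)) (kM (gF G i)) (kM (gf G i))
  (kH (gc G i)) (kH (gh G i)) (kH (gH G i)) (gY G i i) (gX G i i) N);
  rewrite ?gX_act ?gY_act ?kh_part ?kc_part ?kPM ?(rpair_ge_gF G km3 km4) //.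
- by have := kE_part i; rewrite p1.
- by have := kF_part i; rewrite p1.
- by have := ke_part i; rewrite p1.
- by have := kf_part i; rewrite p1.
- exact: kc_diag.
- exact: kc_diag.
- exact: kh_diag.
- exact/kP_neq0/gE_neq0.
Qed.

Lemma diag_sl11 i : gtype G i = TakSL11 -> gX G i i = 0 /\ gY G i i = 0.
Proof.
move=> ti; have := gtypeP G i; rewrite ti => -[f [_ fbrk fsub _]].
have inf x s : groot s i x -> exists u, x = f u by move=> gx; apply/fsub/(gsub_gen gx).
have [ue ueE] := inf _ _ (gP (ge G i)); have [uE uEE] := inf _ _ (gP (gE G i)).
have [uf ufE] := inf _ _ (gM (gf G i)); have [uF uFE] := inf _ _ (gM (gF G i)).
have nil3 u v w : brk (f u) (brk (f v) (f w)) = 0.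
  by rewrite -!fbrk takiff_sl11_nilp linear0.
have e0 := kP_neq0 (ge_neq0 G i).
have aux x : part false x = x -> brk (kP (ge G i)) (kH x) = 0 -> alpha i x = 0.
  move=> xe; have kxe : part false (kH x) = kH x by rewrite -kH_part xe.
  rewrite (even_skew _ kxe) kHP_even // => /eqP.
  by rewrite oppr_eq0 scaler_eq0 (negbTE e0) orbF => /eqP.
split.
  rewrite -(alpha_gh G km3 km4); apply: aux; first exact: gh_part.
  by rewrite /gh -kPM ueE ufE nil3.
rewrite -(alpha_gc G km3 km4); apply: aux; first exact: gc_part.
by rewrite /gc -kPM uEE uFE ueE nil3.
Qed.

Lemma gY_diag i : gY G i i = 0.
Proof.
case ti: (gtype G i); first exact: (diag_sl2 ti).2; first exact: (diag_osp ti).2.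
exact: (diag_sl11 ti).2.
Qed.

Lemma lowest_nat i v lam N : gtype G i <> TakSL11 ->
  brk (kM (gf G i)) v = 0 -> brk (kH (gh G i)) v = lam *: v -> v != 0 ->
  iter N (brk (kP (ge G i))) v = 0 -> exists m : nat, lam = - m%:R.
Proof.
move=> ti fv hv v0 nil.
have he : brk (kH (gh G i)) (kP (ge G i)) = gX G i i *: kP (ge G i).
  exact: kh_diag.
have ef : brk (kP (ge G i)) (kM (gf G i)) = kH (gh G i) by rewrite kPM.
have [kep kfp] := (ke_part i, kf_part i); rewrite /par in kep kfp.
case tE: (gtype G i) ti kep kfp => // _ kep kfp.
  rewrite (diag_sl2 tE).1 in he.
  have [m Em] := lowest_weight_even ef (kh_part i) he hv fv v0 nil kep kfp.
  by exists m; apply/eqP; rewrite -addr_eq0 -[X in _ == X]Em; apply/eqP; field.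
rewrite (diag_osp tE).1 in he.
have [m Em] := lowest_weight_odd ef (kh_part i) he hv fv v0 nil kep kfp (oner_neq0 _).
by exists m; apply/eqP; rewrite -addr_eq0 -[X in _ == X]Em mul1r.
Qed.

Lemma alpha_gh_nat i j : gtype G i <> TakSL11 -> i != j ->
  exists m : nat, alpha j (gh G i) = - m%:R.
Proof.
move=> ti ij; have [N nil] := ad_nilpotent (gP (ge G i)) (gP (ge G j)).
apply: (lowest_nat ti _ _ (kP_neq0 (ge_neq0 G j)) nil).
  by rewrite kMP0 // eq_sym.
exact: kh_act.
Qed.

(** Now $E_i$, $F_i$ are even and $c_i$ commutes with $E_i$ because $y_{ii} = 0$: a Heisenberg
    triple, for which a finite string forces weight zero. *)
Lemma alpha_gc_eq0 i j : gtype G i <> TakSL2 -> i != j -> alpha j (gc G i) = 0.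
Proof.
move=> ti ij; have [N nil] := ad_nilpotent (gP (gE G i)) (gP (ge G j)).
have pE : par i = true by rewrite /par; case: (gtype G i) ti.
have kEp := kE_part i; have kFp := kF_part i; rewrite pE in kEp kFp.
have EF : brk (kP (gE G i)) (kM (gF G i)) = kH (gc G i) by rewrite kPM.
have cE : brk (kH (gc G i)) (kP (gE G i)) = 0 *: kP (gE G i).
  by rewrite kc_diag gY_diag.
have cv : brk (kH (gc G i)) (kP (ge G j)) = alpha j (gc G i) *: kP (ge G j).
  exact: kc_act.
have Fv : brk (kM (gF G i)) (kP (ge G j)) = 0 by rewrite kMP0 // eq_sym.
have [m] := lowest_weight_even EF (kc_part i) cE cv Fv (kP_neq0 (ge_neq0 G j)) nil kEp kFp.
by rewrite !mul0r addr0.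
Qed.

(** If $\alpha_i$ is not of type Tak(sl(1|1)), then $[e_i, w]$ would itself be a lowest vector of
    the positive weight $x_{ii}$, so it vanishes. In type Tak(sl(1|1)) also $\alpha_j(c_i) = 0$. *)
Lemma alpha_gh_eq0 i j : i != j -> alpha j (gh G i) = 0 ->
  gX G i j = 0 /\ gY G i j = 0.
Proof.
move=> ij n0; have [tE|tn] : gtype G i = TakSL11 \/ gtype G i <> TakSL11.
- by case: (gtype G i); [right | right | left].
- apply: (gXY_eq0 km3 km4 n0); apply: alpha_gc_eq0 => //; by rewrite tE.
have ji : j != i by rewrite eq_sym.
have ew0 (w : gpos j) : brk (kP (ge G i)) (kP w) = 0.
  have [N nil] := ad_nilpotent (gP (ge G i)) (gP w).
  apply/eqP/negPn/negP => v0.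
  have nil' : iter N (brk (kP (ge G i))) (brk (kP (ge G i)) (kP w)) = 0.
    by rewrite -iterSr iterS nil brk0r.
  have hw : brk (kH (gh G i)) (kP w) = 0.
    by rewrite kh_act n0 scale0r.
  have hv : brk (kH (gh G i)) (brk (kP (ge G i)) (kP w))
      = gX G i i *: brk (kP (ge G i)) (kP w).
    by rewrite (even_jacobi _ _ (kh_part i)) hw brk0r addr0 kh_diag brkZl.
  have fv : brk (kM (gf G i)) (brk (kP (ge G i)) (kP w)) = 0.
    rewrite (hom_jacobi _ (kf_part i) (ke_part i)) (kMP0 w _ ji) brk0r scaler0 addr0.
    rewrite (hom_skew (kf_part i) (ke_part i)) kPM -/(gh G i) -scaleNr brkZl hw.
    by rewrite scaler0.
  have [m] := lowest_nat tn fv hv v0 nil'.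
  case tE: (gtype G i) tn => // _.
    rewrite (diag_sl2 tE).1 => /eqP; rewrite -addr_eq0 -natrD pnatr_eq0.
    by [].
  rewrite (diag_osp tE).1 => /eqP; rewrite -addr_eq0 -[1]/(1%:R) -natrD pnatr_eq0.
  by [].
(* Applying $F_i$ to $[e_i, w] = 0$ gives $H_i w$ up to sign. *)
have Hw (w : gpos j) : act (gH G i) w = 0.
  apply: (kP_inj G km3 km4 nk); rewrite -kHP.
  have : brk (kM (gF G i)) (brk (kP (ge G i)) (kP w)) = 0 by rewrite ew0 brk0r.
  rewrite (hom_jacobi _ (kF_part i) (ke_part i)) (kMP0 w _ ji) brk0r scaler0 addr0.
  rewrite (hom_skew (kF_part i) (ke_part i)) kPM (rpair_ge_gF G km3 km4).
  rewrite -scaleNr brkZl => /eqP; rewrite scaler_eq0 oppr_eq0 signr_eq0.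
  by move/eqP.
split; first by apply: (@gE_inj _ _ G j); rewrite -gXP Hw scale0r.
by apply: (@ge_inj _ _ G j); rewrite -gYP Hw scale0r.
Qed.

End Integrable.

(** * Growth of algebras with long root strings *)

Lemma poly_nat_bound (p : {poly nat}) :
  exists K e : nat, forall k, (p.[k] <= K * k.+1 ^ e)%N.
Proof.
elim/poly_ind: p => [|p c [K [e pK]]].
  by exists 0%N, 0%N => k; rewrite horner0.
exists (K + c)%N, e.+1 => k; rewrite hornerMXaddC.
rewrite -[(_ + _)%R]/(p.[k] * k + c)%N.
have := pK k; rewrite expnS; have := expn_gt0 k.+1 e; rewrite /= => e0.
nia.
Qed.

(** With [r] half of [q], one factor [2 ^ r] absorbs [r.+1] and the other is left to the induction
    hypothesis with a larger constant. *)
Lemma exp_beats_poly e K : exists q0 : nat, forall q, (q0 <= q)%N -> (K * q.+1 ^ e < 2 ^ q)%N.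
Proof.
elim: e K => [|e IH] K.
  exists K => q Kq; rewrite expn0 muln1.
  by apply: leq_ltn_trans Kq _; apply: ltn_expl.
have [r0 Hr] := IH (K * 2 ^ e.+1)%N; exists (2 * r0)%N => q qr.
pose r := q./2; have r0r : (r0 <= r)%N by rewrite /r; lia.
have q1 : (q.+1 <= 2 * r.+1)%N by rewrite /r; lia.
apply: (@leq_ltn_trans (K * (2 * r.+1) ^ e.+1)).
  by rewrite leq_mul2l leq_exp2r // q1 orbT.
rewrite expnMn mulnA [(r.+1 ^ e.+1)%N]expnSr mulnA.
apply: (@leq_trans (2 ^ r * 2 ^ r)); last by rewrite -expnD leq_exp2l // /r; lia.
have le1 := Hr r r0r; have le2 : (r.+1 <= 2 ^ r)%N by apply: ltn_expl.
by apply: (@leq_trans (2 ^ r * r.+1)); [rewrite ltn_pmul2r | rewrite leq_mul2l le2 orbT].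
Qed.

(** * Even real root vectors and their strings *)

Section RootPairs.
Variables (C : numFieldType) (T : lmodType C) (g : lieSuperType C) (th : T -> g).
Hypothesis th_lin : forall a s t, th (a *: s + t) = a *: th s + th t.
Hypothesis th_even : forall t, part false (th t) = th t.

(** An [sl(2)]-triple of a real root [be] with coroot [et], together with the weights of its root
    vectors under the whole torus [th]. *)
Record rootpair (be : T -> C) (et : T) (x y : g) : Prop := Rootpair {
  rp_lin : forall a s t, be (a *: s + t) = a * be s + be t;
  rp_x : part false x = x;
  rp_y : part false y = y;
  rp_wx : forall t, brk (th t) x = be t *: x;
  rp_wy : forall t, brk (th t) y = - be t *: y;
  rp_xy : brk x y = th et;
  rp_2 : be et = 2
}.

Let th0 : th 0 = 0.
Proof. by have := th_lin (-1) 0 0; rewrite scaler0 addr0 scaleN1r addNr. Qed.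
Let thZ a t : th (a *: t) = a *: th t.
Proof. by have := th_lin a t 0; rewrite th0 !addr0. Qed.
Let thN t : th (- t) = - th t.
Proof. by rewrite -scaleN1r thZ scaleN1r. Qed.

Lemma rootpair_opp be et x y : rootpair be et x y ->
  rootpair (fun t => - be t) (- et) y x.
Proof.
case=> lin xe ye wx wy xy b2; split=> //.
- by move=> a s t; rewrite lin; ring.
- by move=> t; rewrite opprK.
- by rewrite (even_skew y xe) xy thN.
- have b0 : be 0 = 0 by have := lin (-1) 0 0; rewrite scaler0 addr0 mulN1r addNr.
  by have := lin (-1) et 0; rewrite b0 !addr0 scaleN1r b2 mulN1r => ->; rewrite opprK.
Qed.

Lemma brk_xx (x : g) : part false x = x -> brk x x = 0.
Proof.
move=> xe; have /eqP := even_skew x xe; rewrite -addr_eq0 -mulr2n.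
by rewrite -scaler_nat scaler_eq0 pnatr_eq0 => /eqP.
Qed.

Lemma even_iter (x z : g) m : part false x = x -> part false z = z ->
  part false (iter m (brk x) z) = iter m (brk x) z.
Proof. by move=> xe ze; elim: m => //= m IH; rewrite (hom_brk xe IH). Qed.

Section Strings.
Variables (b1 b2 : T -> C) (e1 e2 : T) (x1 y1 x2 y2 : g) (a b : nat).
Hypotheses (r1 : rootpair b1 e1 x1 y1) (r2 : rootpair b2 e2 x2 y2).
Hypotheses (x1y2 : brk x1 y2 = 0) (x2y1 : brk x2 y1 = 0).
Hypotheses (b2e1 : b2 e1 = - a%:R) (b1e2 : b1 e2 = - b%:R).

Definition ustr m := iter m (brk x1) x2.
Definition vstr m := iter m (brk y1) y2.

Let x1e := rp_x r1. Let y1e := rp_y r1. Let x2e := rp_x r2. Let y2e := rp_y r2.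

Lemma ustrS m : ustr m.+1 = brk x1 (ustr m). Proof. by []. Qed.
Lemma vstrS m : vstr m.+1 = brk y1 (vstr m). Proof. by []. Qed.
Lemma ustr_even m : part false (ustr m) = ustr m. Proof. exact: even_iter. Qed.
Lemma vstr_even m : part false (vstr m) = vstr m. Proof. exact: even_iter. Qed.

Lemma ustr_wt m t : brk (th t) (ustr m) = (b2 t + m%:R * b1 t) *: ustr m.
Proof.
elim: m => [|m IH] /=; first by rewrite mul0r addr0 (rp_wx r2).
rewrite even_jacobi // (rp_wx r1) IH brkZl brkZr -/(ustr m) -scalerDl.
by congr (_ *: _); ring.
Qed.
Lemma vstr_wt m t : brk (th t) (vstr m) = - (b2 t + m%:R * b1 t) *: vstr m.
Proof.
elim: m => [|m IH] /=; first by rewrite mul0r addr0 (rp_wy r2).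
rewrite even_jacobi // (rp_wy r1) IH brkZl brkZr -/(vstr m) -scalerDl.
by congr (_ *: _); ring.
Qed.

(** The lowering coefficients of an [sl(2)]-string of lowest weight [- a]. *)
Definition scoef m : C := m.+1%:R * (a%:R - m%:R).

Lemma y1_ustr0 : brk y1 (ustr 0) = 0.
Proof. by rewrite (even_skew y1 x2e) x2y1 oppr0. Qed.
Lemma y1_ustr m : brk y1 (ustr m.+1) = scoef m *: ustr m.
Proof.
have y1x1 : brk y1 x1 = - th e1 by rewrite (even_skew y1 x1e) (rp_xy r1).
elim: m => [|m IH]; rewrite ustrS even_jacobi // y1x1 brkNl.
  by rewrite ustr_wt b2e1 (rp_2 r1) y1_ustr0 brk0r /scoef; vring C.
rewrite ustr_wt b2e1 (rp_2 r1) IH brkZr -[brk x1 (ustr m)]/(ustr m.+1) /scoef.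
by vring C.
Qed.
Lemma x1_vstr m : brk x1 (vstr m.+1) = scoef m *: vstr m.
Proof.
have x1v0 : brk x1 (vstr 0) = 0 by [].
elim: m => [|m IH]; rewrite vstrS even_jacobi // (rp_xy r1).
  by rewrite vstr_wt b2e1 (rp_2 r1) x1v0 brk0r /scoef; vring C.
rewrite vstr_wt b2e1 (rp_2 r1) IH brkZr -[brk y1 (vstr m)]/(vstr m.+1) /scoef.
by vring C.
Qed.

(** Normalised by $[x_2, y_2] = e_2$: the bracket of opposite string elements is [kap m] times $a
    e_2 + m b e_1$, which is proportional to the torus element dual to $\beta_2 + m \beta_1$. *)
Fixpoint kap m : C := if m is m'.+1 then - (scoef m' * kap m') else a%:R^-1.

Hypothesis a_gt0 : (0 < a)%N.
Let a0 : a%:R != 0 :> C. Proof. by rewrite pnatr_eq0 -lt0n. Qed.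

Lemma kap_neq0 m : (m <= a)%N -> kap m != 0.
Proof.
elim: m => [|m IH] ma; first by rewrite /= invr_neq0.
rewrite /= oppr_eq0 mulf_neq0 ?(IH (ltnW ma)) // /scoef mulf_neq0 ?pnatr_eq0 //.
by rewrite -natrB ?(ltnW ma) // pnatr_eq0 subn_eq0 -ltnNge.
Qed.

(** The Jacobi identity expresses each of the two brackets through the other one, so they are proved
    together. *)
Lemma string_bracket m :
  brk (ustr m) (vstr m) = th (kap m *: (a%:R *: e2 + (m%:R * b%:R) *: e1))
  /\ brk (ustr m.+1) (vstr m) = (scoef m * kap m * b%:R) *: x1.
Proof.
have br_x1 u v : brk (brk x1 u) v = brk x1 (brk u v) - brk u (brk x1 v).
  by rewrite even_jacobi // addrK.
have x1th t : brk x1 (th t) = - (b1 t *: x1).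
  by rewrite (even_skew x1 (th_even t)) (rp_wx r1).
elim: m => [|m [IH1 IH2]].
  split; first by rewrite /= (rp_xy r2) !mul0r scale0r addr0 scalerA mulVf // scale1r.
  rewrite -[ustr 1]/(brk x1 x2) br_x1 -[vstr 0]/y2 x1y2 brk0r subr0 (rp_xy r2) x1th b1e2.
  by rewrite /scoef /=; vcoefs C; field.
have A1 : brk (ustr m.+1) (vstr m.+1)
    = th (kap m.+1 *: (a%:R *: e2 + (m.+1%:R * b%:R) *: e1)).
  rewrite -[vstr m.+1]/(brk y1 (vstr m)) even_jacobi ?ustr_even //.
  rewrite (even_skew (ustr m.+1) y1e) y1_ustr brkNl brkZl IH1 IH2 brkZr.
  rewrite (even_skew y1 x1e) (rp_xy r1) -thN -!thZ -thN.
  have -> t s : th s + th t = th (s + t) by have := th_lin 1 s t; rewrite !scale1r.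
  by congr th; rewrite /=; vring C.
split=> //; rewrite -[ustr m.+2]/(brk x1 (ustr m.+1)) br_x1 A1 x1th x1_vstr brkZr IH2.
have b1Z k t : b1 (k *: t) = k * b1 t.
  have b10 : b1 0 = 0 by have := rp_lin r1 (-1) 0 0; rewrite scaler0 addr0 mulN1r addNr.
  by have := rp_lin r1 k t 0; rewrite b10 !addr0.
rewrite b1Z (rp_lin r1) b1Z b1e2 (rp_2 r1) /= /scoef; vring C.
Qed.

(** Lowering reduces to [l = 0], where the bracket is [ad x1] applied at least twice to a torus
    element, and $[x_1, x_1] = 0$. *)
Lemma string_far m l : (l.+2 <= m)%N -> brk (ustr m) (vstr l) = 0.
Proof.
elim: l m => [|l IH] [|m] // lm.
  have E k : brk (ustr k) y2 = iter k (brk x1) (th e2).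
    elim: k => [|k IHk] /=; first exact: (rp_xy r2).
    have := even_jacobi (ustr k) y2 x1e; rewrite x1y2 brk0r addr0 => <-.
    by rewrite IHk.
  case: m lm => // m _; rewrite E !iterSr (even_skew x1 (th_even e2)) (rp_wx r1).
  by rewrite brkNr brkZr brk_xx // scaler0 oppr0; elim: m => //= m ->; rewrite brk0r.
rewrite -[vstr l.+1]/(brk y1 (vstr l)) even_jacobi ?ustr_even //.
rewrite (even_skew (ustr m.+1) y1e) y1_ustr brkNl brkZl IH //.
by rewrite IH ?(leq_trans _ lm) // ?scaler0 ?oppr0 ?brk0r ?addr0.
Qed.

Lemma x2_vstr m : brk x2 (vstr m) = iter m (brk y1) (th e2).
Proof.
elim: m => [|m IH]; first exact: (rp_xy r2).
by rewrite vstrS even_jacobi // x2y1 brk0l add0r IH.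
Qed.
Lemma x2_vstr1 : brk x2 (vstr 1) = b1 e2 *: y1.
Proof. by rewrite x2_vstr /= (even_skew _ (th_even e2)) (rp_wy r1) scaleNr opprK. Qed.
Lemma x2_vstr2 m : brk x2 (vstr m.+2) = 0.
Proof.
rewrite x2_vstr !iterSr (even_skew _ (th_even e2)) (rp_wy r1) scaleNr opprK brkZr.
by rewrite brk_xx // scaler0; elim: m => //= m ->; rewrite brk0r.
Qed.

(** Since [x2] kills [vstr a], the bracket is a multiple of [ad x2] applied [b] times to
    [vstr a.-1]. One application kills this when [a > 2]; for [a = 2] the first gives a multiple of
    [y1] and the second kills it. *)
Lemma reflected_comm_aux : (1 < a)%N -> (2 < a)%N || (1 < b)%N -> (0 < b)%N ->
  brk (iter b (brk x2) x1) (vstr a) = 0.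
Proof.
case: (a) (x1_vstr) => [|[|a']] // x1v _ ab b0.
have br_x2 u v : brk (brk x2 u) v = brk x2 (brk u v) - brk u (brk x2 v).
  by rewrite even_jacobi // addrK.
have E k : brk (iter k (brk x2) x1) (vstr a'.+2) = iter k (brk x2) (brk x1 (vstr a'.+2)).
  elim: k => //= k IH; by rewrite br_x2 IH x2_vstr2 brk0r subr0.
rewrite E x1v; case: (b) ab b0 => // b' ab _; rewrite iterSr brkZr.
have i0 k : iter k (brk x2) 0 = 0 by elim: k => //= k ->; rewrite brk0r.
case: a' ab {x1v E} => [|a'] ab; last by rewrite x2_vstr2 scaler0 i0.
case: b' ab => // b' _; rewrite iterSr x2_vstr1 !brkZr x2y1 !scaler0; exact: i0.
Qed.

(** The triple of $s_1 \beta_2$, at the top of the string: $a e_2 + a b e_1$ is [a] times the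
    reflected coroot, whence the scaling factor. *)
Lemma reflect_pair : rootpair (fun t => b2 t + a%:R * b1 t) (e2 + b%:R *: e1)
  (ustr a) ((kap a * a%:R)^-1 *: vstr a).
Proof.
have k0 : kap a * a%:R != 0 by rewrite mulf_neq0 // kap_neq0.
split.
- by move=> k s t; rewrite (rp_lin r1) (rp_lin r2); ring.
- exact: ustr_even.
- by rewrite partZ vstr_even.
- exact: ustr_wt.
- by move=> t; rewrite brkZr vstr_wt !scalerA mulrC.
- rewrite brkZr (string_bracket a).1 -thZ; congr th; vcoefs C; field;
  by rewrite ?a0 ?kap_neq0.
- have -> : e2 + b%:R *: e1 = b%:R *: e1 + e2 by rewrite addrC.
  by rewrite (rp_lin r1) (rp_lin r2) b1e2 b2e1 (rp_2 r1) (rp_2 r2); ring.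
Qed.

End Strings.

(** * Independent products of string elements *)

Section Products.
Variables (b1 b2 : T -> C) (e1 e2 : T) (x1 y1 x2 y2 : g) (a b : nat).
Hypotheses (r1 : rootpair b1 e1 x1 y1) (r2 : rootpair b2 e2 x2 y2).
Hypotheses (x1y2 : brk x1 y2 = 0) (x2y1 : brk x2 y1 = 0).
Hypotheses (b2e1 : b2 e1 = - a%:R) (b1e2 : b1 e2 = - b%:R).

Notation ustr := (ustr x1 x2).
Notation vstr := (vstr y1 y2).

(** Distance two already gives commutation, but [wcoef 0 2] vanishes when [b = 1]; distance three
    makes the weights strictly negative. *)
Definition far m l := (m + 3 <= l)%N || (l + 3 <= m)%N.

Let beN (be : T -> C) t : (forall k s u, be (k *: s + u) = k * be s + be u) ->
  be (- t) = - be t.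
Proof.
move=> lin; have b0 : be 0 = 0 by have := lin (-1) 0 0; rewrite scaler0 addr0 mulN1r addNr.
by have := lin (-1) t 0; rewrite b0 !addr0 scaleN1r mulN1r.
Qed.

Lemma vstr_ustr_far m l : far m l -> brk (vstr m) (ustr l) = 0.
Proof.
case/orP => ml.
  rewrite (even_skew _ (ustr_even r1 r2 l)).
  by rewrite (string_far r1 r2 x1y2 x2y1 b2e1) ?oppr0 //; lia.
apply: (string_far (rootpair_opp r1) (rootpair_opp r2)); last by lia.
- by rewrite (even_skew _ (rp_x r2)) x2y1 oppr0.
- by rewrite (even_skew _ (rp_x r1)) x1y2 oppr0.
- by rewrite /= (beN _ (rp_lin r2)) b2e1 opprK.
Qed.

Definition xprod (s : seq nat) : g := foldr (fun m z => brk (ustr m) z) x2 s.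
Definition ydown (s : seq nat) (z : g) : g := foldl (fun z m => brk (vstr m) z) z s.

Lemma xprod_wt s t :
  brk (th t) (xprod s) = (\sum_(l <- 0%N :: s) (b2 t + l%:R * b1 t)) *: xprod s.
Proof.
elim: s => [|m s IH] /=; first by rewrite big_seq1 mul0r addr0 (rp_wx r2).
rewrite even_jacobi // (ustr_wt r1 r2) IH brkZl brkZr -scalerDl.
by congr (_ *: _); rewrite !big_cons; ring.
Qed.

Lemma vstr_xprod_far m s : all (far m) (0%N :: s) -> brk (vstr m) (xprod s) = 0.
Proof.
case/andP => m0; elim: s => [|l s IH] /=; first by move=> _; apply: (vstr_ustr_far m0).
case/andP => ml ms; rewrite even_jacobi ?(vstr_even r1 r2) // vstr_ustr_far // brk0l.
by rewrite IH // brk0r addr0.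
Qed.

Hypotheses (a_gt0 : (0 < a)%N) (b_gt0 : (0 < b)%N).

(* Minus the value of the [l]-th weight of the string on the coroot of the
   [m]-th one; it is positive when [m] and [l] are at distance at least three. *)
Definition wcoef m l : nat := (b * (m * (a - l) + l * (a - m)) - 2 * a)%N.

Lemma wcoef_gt0 m l : (m <= a)%N -> (l <= a)%N -> far m l -> (0 < wcoef m l)%N.
Proof.
move=> ma la ml; rewrite /wcoef subn_gt0.
apply: (@leq_trans (m * (a - l) + l * (a - m))); last by rewrite leq_pmull.
case/orP: ml => ml.
  have [k ->] : exists k, l = (m + 3 + k)%N by exists (l - (m + 3))%N; lia.
  have [k' aE] : exists k', a = (l + k')%N by exists (a - l)%N; lia.
  nia.
have [k ->] : exists k, m = (l + 3 + k)%N by exists (m - (l + 3))%N; lia.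
have [k' aE] : exists k', a = (m + k')%N by exists (a - m)%N; lia.
nia.
Qed.

Lemma string_wt m l : (m <= a)%N -> (l <= a)%N -> far m l ->
  b2 (a%:R *: e2 + (m%:R * b%:R) *: e1) + l%:R * b1 (a%:R *: e2 + (m%:R * b%:R) *: e1)
  = - (wcoef m l)%:R.
Proof.
move=> ma la ml; have := wcoef_gt0 ma la ml; rewrite /wcoef subn_gt0 => /ltnW w0.
have bZ (be : T -> C) k t : (forall k s u, be (k *: s + u) = k * be s + be u) ->
    be (k *: t) = k * be t.
  move=> lin; have b0 : be 0 = 0 by have := lin (-1) 0 0; rewrite scaler0 addr0 mulN1r addNr.
  by have := lin k t 0; rewrite b0 !addr0.
rewrite (rp_lin r1) (rp_lin r2) (bZ _ _ _ (rp_lin r1)) (bZ _ _ _ (rp_lin r2)).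
rewrite b1e2 b2e1 (rp_2 r1) (rp_2 r2) natrB // !natrM natrD !natrM !natrB //.
by ring.
Qed.

(** Only the bracket with the outer factor survives. It is a torus element acting by a sum of
    weights of one sign, so nothing cancels. *)
Lemma vstr_xprod m s : (m <= a)%N -> all (fun l => l <= a)%N s ->
  all (far m) (0%N :: s) ->
  brk (vstr m) (xprod (m :: s))
  = (kap a m * (\sum_(l <- 0%N :: s) wcoef m l)%:R) *: xprod s.
Proof.
move=> ma sa ms; rewrite /= even_jacobi ?(vstr_even r1 r2) // vstr_xprod_far // brk0r addr0.
rewrite (even_skew _ (ustr_even r1 r2 m)) brkNl.
rewrite (string_bracket r1 r2 x1y2 x2y1 b2e1 b1e2 a_gt0 m).1 thZ brkZl xprod_wt.
rewrite scalerA -scaleNr -mulrN; congr (_ * _ *: _).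
rewrite natr_sum -sumrN; rewrite !big_seq; apply: eq_bigr => l ls.
rewrite string_wt ?opprK //; last by rewrite (allP ms).
by move: ls; rewrite inE => /orP[/eqP->|/(allP sa)].
Qed.

(* The two alternatives for each [d] have the same total degree. *)
Fixpoint choices k (c : seq bool) : seq nat :=
  if c is d :: c' then
    (if d then [:: 12 * k + 3; 12 * k + 12] else [:: 12 * k + 6; 12 * k + 9])%N
    ++ choices k.+1 c'
  else [::].

Lemma choices_ge k c l : l \in choices k c -> (12 * k + 3 <= l)%N.
Proof.
elim: c k => [//|d c IH] k; rewrite mem_cat => /orP[|/IH]; last by lia.
by case: d; rewrite !inE => /orP[] /eqP ->; lia.
Qed.
Lemma choices_le k c l : l \in choices k c -> (l <= 12 * (k + size c))%N.
Proof.
elim: c k => [//|d c IH] k; rewrite mem_cat => /orP[|/IH] /=; last by lia.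
by case: d; rewrite !inE => /orP[] /eqP ->; lia.
Qed.

Lemma ydown0 s : ydown s 0 = 0.
Proof. by elim: s => //= m s IH; rewrite brk0r. Qed.
Lemma ydownZ s k z : ydown s (k *: z) = k *: ydown s z.
Proof. by elim: s z => //= m s IH z; rewrite brkZr IH. Qed.
Lemma ydownD s z z' : ydown s (z + z') = ydown s z + ydown s z'.
Proof. by elim: s z z' => //= m s IH z z'; rewrite brkDr IH. Qed.

(** The Gram matrix is diagonal with nonzero entries. The positions 3, 6, 9, 12 of a block keep
    distance at least three from each other, from [x2] at position 0 and from later blocks. *)
Lemma choices_gram k (c c' : seq bool) : (12 * (k + size c) <= a)%N -> size c = size c' ->
  exists2 lam : C, lam != 0
    & ydown (choices k c') (xprod (choices k c)) = (if c == c' then lam else 0) *: x2.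
Proof.
elim: c c' k => [|d c IH] [|d' c'] //= k ka; first by exists 1; rewrite ?oner_eq0 ?scale1r.
case=> sz; have [|lam l0 IHlam] := IH c' k.+1 _ sz; first by lia.
have fars m l : (m <= 12 * k + 12)%N -> l \in choices k.+1 c -> far m l.
  by move=> mk /choices_ge lk; rewrite /far; lia.
have les l : l \in choices k.+1 c -> (l <= a)%N by move/choices_le; lia.
have all_far m : (3 <= m <= 12 * k + 12)%N -> all (far m) (0%N :: choices k.+1 c).
  case/andP=> m3 mk; apply/allP => l; rewrite inE => /orP[/eqP->|lc].
    by rewrite /far; lia.
  exact: fars.
have step m m' : (3 <= m <= 12 * k + 12)%N -> (3 <= m' <= 12 * k + 12)%N -> far m m' ->
  exists2 nu : C, nu != 0 &
    brk (vstr m') (brk (vstr m) (xprod [:: m, m' & choices k.+1 c]))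
    = nu *: xprod (choices k.+1 c).
  move=> mk mk' mm.
  have w_neq0 l s : (l <= a)%N -> all (far l) (0%N :: s) ->
      all (fun l => l <= a)%N s ->
      kap a l * (\sum_(j <- 0%N :: s) wcoef l j)%:R != 0.
    move=> la ls sa; rewrite mulf_neq0 ?kap_neq0 // pnatr_eq0 -lt0n big_cons addn_gt0.
    by rewrite wcoef_gt0 //; case/andP: ls.
  have sa : all (fun l => l <= a)%N (choices k.+1 c) by apply/allP => l /les.
  have sa' : all (fun l => l <= a)%N (m' :: choices k.+1 c).
    by rewrite /= sa andbT; lia.
  have fm : all (far m) [:: 0%N, m' & choices k.+1 c].
    by have /= /andP[-> ->] := all_far m mk; rewrite mm.
  have ma : (m <= a)%N by lia.
  have ma' : (m' <= a)%N by lia.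
  exists ((kap a m * (\sum_(l <- [:: 0%N, m' & choices k.+1 c]) wcoef m l)%:R)
      * (kap a m' * (\sum_(l <- 0%N :: choices k.+1 c) wcoef m' l)%:R)).
    by rewrite mulf_neq0 ?w_neq0 ?all_far.
  by rewrite vstr_xprod // brkZr vstr_xprod ?all_far // scalerA.
have kill m m1 m2 : (3 <= m <= 12 * k + 12)%N -> far m m1 -> far m m2 ->
    brk (vstr m) (xprod [:: m1, m2 & choices k.+1 c]) = 0.
  move=> mk f1 f2; apply: vstr_xprod_far.
  by have /= /andP[-> ->] := all_far m mk; rewrite f1 f2.
have [dd|dd] := eqVneq d d'; last first.
  exists 1; first exact: oner_neq0.
  rewrite eqseq_cons (negbTE dd) scale0r.
  (* At the first block that differs, the first lowering element is far from every remaining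
     factor. *)
  by case: d d' dd => [] [] //= _; rewrite (kill _ _ _) ?brk0r ?ydown0 // /far; lia.
subst d'; have [nu nu0 E] : exists2 nu : C, nu != 0 &
    ydown (choices k (d :: c')) (xprod (choices k (d :: c)))
    = ydown (choices k.+1 c') (nu *: xprod (choices k.+1 c)).
  case: d => /=.
    have [||| nu nu0 E] := step (12 * k + 3)%N (12 * k + 12)%N; rewrite /far; try lia.
    by exists nu; rewrite // -E.
  have [||| nu nu0 E] := step (12 * k + 6)%N (12 * k + 9)%N; rewrite /far; try lia.
  by exists nu; rewrite // -E.
exists (nu * lam); first by rewrite mulf_neq0.
rewrite -[LHS]/(ydown (choices k (d :: c')) (xprod (choices k (d :: c)))).
rewrite E ydownZ IHlam scalerA eqseq_cons eqxx /=.
by case: eqP => _; rewrite ?mulr0.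
Qed.

Hypothesis x2_neq0 : x2 != 0.
Variable q : nat.
Hypothesis q_le : (12 * q <= a)%N.

Lemma choices_dim (d : nat) (bs : 'I_d -> g) :
  (forall c : q.-tuple bool, exists k : 'I_d -> C,
    xprod (choices 0 c) = \sum_i k i *: bs i) -> (2 ^ q <= d)%N.
Proof.
move=> spn; rewrite leqNgt; apply/negP => dq.
have [k kE] := choice spn.
pose I := [the finType of q.-tuple bool].
pose M : 'M[C]_(#|I|, d) := \matrix_(c, i) k (enum_val c) i.
have cardI : #|I| = (2 ^ q)%N by rewrite card_tuple card_bool.
have nf : ~~ row_free M.
  rewrite -row_leq_rank -ltnNge; apply: leq_ltn_trans (rank_leq_col M) _.
  by rewrite cardI.
case/negP: nf; apply: inj_row_free => v vM; apply/rowP => c0; rewrite [RHS]mxE.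
have sum0 : \sum_c v 0 c *: xprod (choices 0 (enum_val c)) = 0.
  under eq_bigr => c _ do rewrite kE scaler_sumr.
  rewrite exchange_big /= big1 // => i _.
  have := congr1 (fun u : 'rV_d => u 0 i) vM; rewrite !mxE => vMi.
  under eq_bigr => c _ do rewrite scalerA.
  rewrite -scaler_suml -[RHS](scale0r (bs i)); congr (_ *: _).
  by rewrite -[RHS]vMi; apply: eq_bigr => c _; rewrite mxE.
have sums (F : 'I_#|I| -> g) s : ydown s (\sum_c F c) = \sum_c ydown s (F c).
  by elim/big_rec2: _ => [|c z z' _ <-]; rewrite ?ydown0 ?ydownD.
have := congr1 (ydown (choices 0 (enum_val c0))) sum0; rewrite ydown0 sums.
rewrite (bigD1 c0) //= big1 => [|c cc0].
  have [||lam l0] := @choices_gram 0 (enum_val c0) (enum_val c0) => //.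
    by rewrite size_tuple.
  rewrite eqxx addr0 ydownZ => -> /eqP; rewrite scalerA scaler_eq0 (negbTE x2_neq0).
  by rewrite orbF mulf_eq0 (negbTE l0) orbF => /eqP.
have [||lam l0] := @choices_gram 0 (enum_val c) (enum_val c0).
- by rewrite size_tuple.
- by rewrite !size_tuple.
rewrite ydownZ => ->; case: eqP => [cE|_]; last by rewrite scale0r scaler0.
by case/eqP: cc0; apply/enum_val_inj/val_inj.
Qed.

End Products.

(** For [a = 1] the auxiliary lemma is applied to the opposite pairs with the two roots exchanged,
    as then [b >= 4]. *)
Lemma reflected_comm b1 b2 e1 e2 x1 y1 x2 y2 (a b : nat) :
  rootpair b1 e1 x1 y1 -> rootpair b2 e2 x2 y2 ->
  brk x1 y2 = 0 -> brk x2 y1 = 0 -> b2 e1 = - a%:R -> b1 e2 = - b%:R ->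
  (4 <= a * b)%N -> brk (ustr x2 x1 b) (vstr y1 y2 a) = 0.
Proof.
move=> r1 r2 x1y2 x2y1 b2e1 b1e2 ab.
have [a1|a1] := ltnP 1 a.
  apply: (reflected_comm_aux r1 r2 x1y2 x2y1 b2e1 a1); last by nia.
  by apply/orP; case: (ltnP 2 a) => a2; [left | right; nia].
have beN (be : T -> C) t : (forall k s u, be (k *: s + u) = k * be s + be u) ->
    be (- t) = - be t.
  move=> lin; have b0 : be 0 = 0 by have := lin (-1) 0 0; rewrite scaler0 addr0 mulN1r addNr.
  by have := lin (-1) t 0; rewrite b0 !addr0 scaleN1r mulN1r.
rewrite (even_skew _ (vstr_even r1 r2 a)).
rewrite -[vstr y1 y2 a]/(iter a (brk y1) y2) -[ustr x2 x1 b]/(vstr x2 x1 b).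
rewrite (reflected_comm_aux (rootpair_opp r2) (rootpair_opp r1)) ?oppr0 //.
- by rewrite (even_skew _ (rp_x r1)) x1y2 oppr0.
- by rewrite (even_skew _ (rp_x r2)) x2y1 oppr0.
- by rewrite /= (beN _ _ (rp_lin r1)) b1e2 opprK.
- by nia.
- by apply/orP; left; nia.
- by nia.
Qed.

(** * Iterated reflections and exponential growth *)

Section Doubling.
Variable deg : nat -> g -> Prop.
Hypothesis deg_brk : forall k l x y, deg k x -> deg l y -> deg (k + l)%N (brk x y).

Lemma deg_iter k l x y m : deg k x -> deg l y -> deg (l + m * k)%N (iter m (brk x) y).
Proof.
move=> dx dy; elim: m => [|m IH] /=; first by rewrite addn0.
by rewrite mulSn addnCA; apply: deg_brk.
Qed.

Variables (b3 : T -> C) (e3 : T) (x3 y3 : g).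
Hypothesis r3 : rootpair b3 e3 x3 y3.

Definition dstate (a b P1 P2 Q1 Q2 D1 D2 : nat) : Prop :=
  exists b1 b2 e1 e2 x1 y1 x2 y2,
  [/\ [/\ rootpair b1 e1 x1 y1, rootpair b2 e2 x2 y2, brk x1 y2 = 0 & brk x2 y1 = 0],
      [/\ brk x1 y3 = 0, brk x3 y1 = 0, brk x2 y3 = 0 & brk x3 y2 = 0],
      [/\ b2 e1 = - a%:R, b1 e2 = - b%:R, b3 e1 = - P1%:R & b3 e2 = - P2%:R],
      b1 e3 = - Q1%:R /\ b2 e3 = - Q2%:R
    & deg D1 x1 /\ deg D2 x2].

(** Evaluating $\beta_2 + a \beta_1$ on $e_1 + a e_2$ gives $3a - a^2 b$. Since $ab - 3 \ge 1$, the
    new product is again at least four. *)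
Lemma dstate_step a b P1 P2 Q1 Q2 D1 D2 : (4 <= a * b)%N ->
  dstate a b P1 P2 Q1 Q2 D1 D2 ->
  dstate (a * (a * b - 3)) (b * (a * b - 3)) (P1 + a * P2) (P2 + b * P1)
    (Q1 + b * Q2) (Q2 + a * Q1) (D1 + b * D2) (D2 + a * D1).
Proof.
move=> ab [b1 [b2 [e1 [e2 [x1 [y1 [x2 [y2 [[r1 r2 x1y2 x2y1] [x1y3 x3y1 x2y3 x3y2]]]]]]]]]].
move=> [b2e1 b1e2 b3e1 b3e2] [b1e3 b2e3] [d1 d2].
have a0 : (0 < a)%N by nia.
have b0 : (0 < b)%N by nia.
have s1 := reflect_pair r2 r1 x2y1 x1y2 b1e2 b2e1 b0.
have s2 := reflect_pair r1 r2 x1y2 x2y1 b2e1 b1e2 a0.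
have ba : (4 <= b * a)%N by rewrite mulnC.
have abE : (a * b - 3)%:R = a%:R * b%:R - 3 :> C by rewrite natrB ?natrM; last by lia.
have c_iter (z x y : g) m : part false z = z -> brk z x = 0 -> brk z y = 0 ->
    brk z (iter m (brk x) y) = 0.
  by move=> ze zx zy; elim: m => //= m IH; rewrite even_jacobi // zx brk0l IH brk0r addr0.
have c_iter' (z x y : g) m : part false z = z -> brk x z = 0 -> brk y z = 0 ->
    brk (iter m (brk x) y) z = 0.
  move=> ze xz yz; rewrite (even_skew _ ze) c_iter ?oppr0 //.
    by rewrite -[LHS]opprK -(even_skew _ ze) xz oppr0.
  by rewrite -[LHS]opprK -(even_skew _ ze) yz oppr0.
have beZ (be : T -> C) k t : (forall k s u, be (k *: s + u) = k * be s + be u) ->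
    be (k *: t) = k * be t.
  move=> lin; have be0 : be 0 = 0 by have := lin (-1) 0 0; rewrite scaler0 addr0 mulN1r addNr.
  by have := lin k t 0; rewrite be0 !addr0.
have beDZ (be : T -> C) k t u : (forall k s u, be (k *: s + u) = k * be s + be u) ->
    be (t + k *: u) = be t + k * be u.
  by move=> lin; rewrite addrC lin addrC.
have [x3e y3e] := (rp_x r3, rp_y r3).
exists (fun t => b1 t + b%:R * b2 t), (fun t => b2 t + a%:R * b1 t).
do 6!eexists; split.
- split; [exact: s1 | exact: s2 | |].
    by rewrite brkZr (reflected_comm r1 r2) // scaler0.
  by rewrite brkZr (reflected_comm r2 r1) // scaler0.
- split; rewrite ?brkZr.
  + exact: c_iter'.
  + by rewrite c_iter ?scaler0.
  + exact: c_iter'.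
  + by rewrite c_iter ?scaler0.
- split; rewrite /= !beDZ; try exact: rp_lin r1; try exact: rp_lin r2; try exact: rp_lin r3.
  + by rewrite b2e1 b1e2 (rp_2 r1) (rp_2 r2) natrM abE; ring.
  + by rewrite b2e1 b1e2 (rp_2 r1) (rp_2 r2) natrM abE; ring.
  + by rewrite b3e1 b3e2 natrD natrM; ring.
  + by rewrite b3e1 b3e2 natrD natrM; ring.
- by rewrite b1e3 b2e3 !natrD !natrM; split; ring.
- by split; apply: deg_iter.
Qed.

(* The bound D1 <= K1 P1 persists because the ratio a : b does. *)
Lemma dstate_grow a b P1 P2 Q1 Q2 D1 D2 K1 K2 s : (4 <= a * b)%N ->
  (0 < P1)%N -> (0 < P2)%N -> (0 < Q1)%N -> (0 < Q2)%N ->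
  (a * K1 = b * K2)%N -> (D1 <= K1 * P1)%N -> (D2 <= K2 * P2)%N ->
  dstate a b P1 P2 Q1 Q2 D1 D2 ->
  exists a' b' P1' P2' Q1' Q2' D1' D2', [/\ (s + P1 <= P1')%N, (0 < Q1')%N,
    (D1' <= K1 * P1')%N & dstate a' b' P1' P2' Q1' Q2' D1' D2'].
Proof.
elim: s a b P1 P2 Q1 Q2 D1 D2 => [|s IH] a b P1 P2 Q1 Q2 D1 D2 ab p1 p2 q1 q2 abK d1 d2 st.
  by exists a, b, P1, P2, Q1, Q2, D1, D2.
have [||||||||a' [b' [P1' [P2' [Q1' [Q2' [D1' [D2' [sP ? ? ?]]]]]]]]] :=
    IH _ _ _ _ _ _ _ _ _ _ _ _ _ _ _ _ (dstate_step ab st).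
- nia.
- nia.
- nia.
- nia.
- nia.
- by rewrite [LHS]mulnAC abK [LHS]mulnAC.
- by rewrite mulnDr mulnA [(K1 * a)%N]mulnC abK -mulnA; apply: leq_add => //; apply: leq_mul.
- by rewrite mulnDr mulnA [(K2 * b)%N]mulnC -abK -mulnA; apply: leq_add => //; apply: leq_mul.
exists a', b', P1', P2', Q1', Q2', D1', D2'; split=> //; nia.
Qed.

Lemma deg_xprod D1 x1 s : deg D1 x1 -> deg 1 x3 ->
  deg (sumn [seq (1 + m * D1)%N | m <- s] + 1)%N (xprod x1 x3 s).
Proof.
move=> d1 d3; elim: s => [|m s IH] //=; rewrite -addnA.
by apply: deg_brk => //; apply: deg_iter.
Qed.

Fixpoint cdeg D k q : nat :=
  if q is q'.+1 then (2 + (24 * k + 15) * D + cdeg D k.+1 q')%N else 0%N.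

Lemma sumn_choices D k c :
  sumn [seq (1 + m * D)%N | m <- choices k c] = cdeg D k (size c).
Proof.
elim: c k => //= d c IH k; rewrite map_cat sumn_cat IH; congr (_ + _)%N.
by case: d => /=; nia.
Qed.
Lemma cdeg_le D k q : (cdeg D k q <= q * (2 + (24 * (k + q) + 15) * D))%N.
Proof.
elim: q k => // q IH k; have := IH k.+1; rewrite [(k.+1 + q)%N]addSnnS => le.
rewrite -[cdeg D k q.+1]/(2 + (24 * k + 15) * D + cdeg D k.+1 q)%N.
rewrite [(q.+1 * _)%N]mulSn; apply: leq_add; last exact: le.
by rewrite leq_add2l leq_mul2r; apply/orP; right; lia.
Qed.

Hypothesis x3_neq0 : x3 != 0.
Hypothesis deg_x3 : deg 1 x3.

Lemma growth_contradiction a b P1 P2 Q1 Q2 (pz : {poly nat}) : (4 <= a * b)%N ->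
  (0 < P1)%N -> (0 < P2)%N -> (0 < Q1)%N -> (0 < Q2)%N ->
  dstate a b P1 P2 Q1 Q2 1 1 ->
  ~ (forall k, exists bs : 'I_(pz.[k]) -> g, forall x, deg k x ->
       exists c : 'I_(pz.[k]) -> C, x = \sum_i c i *: bs i).
Proof.
move=> ab p1 p2 q1 q2 st fg.
have [K [e pK]] := poly_nat_bound pz.
(* The degree is at most [q (2 + (24 q + 15) D)] plus one, with [24 q + 15 <= 39 (q + 1)] and
   [D <= 12 b (q + 1)]; here 468 = 39 * 12 and the 4 covers the lower-order terms. *)
pose B := (4 + 468 * b)%N.
have [s0 Hs] := exp_beats_poly (3 * e) (K * B ^ e).
have [||a' [b' [P1' [P2' [Q1' [Q2' [D1' [D2' [sP q1' DP st']]]]]]]]] :=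
  dstate_grow (12 * s0 + 12) (K1 := b) (K2 := a) ab p1 p2 q1 q2 (mulnC _ _) _ _ st.
- nia.
- nia.
case: st' => c1 [c2 [t1 [t2 [x1 [y1 [x2 [y2 [[r1 _ _ _] [x1y3 x3y1 _ _]]]]]]]]].
move=> [_ _ c3t1 _] [c1t3 _] [dx1 _].
pose q := (P1' %/ 12)%N; have qP : (12 * q <= P1')%N by rewrite /q; lia.
have Pq : (P1' < 12 * q.+1)%N by rewrite /q; lia.
have s0q : (s0 <= q)%N by rewrite /q; lia.
have P0 : (0 < P1')%N by lia.
pose k := (cdeg D1' 0 q + 1)%N; have [bs bsP] := fg k.
have le : (2 ^ q <= pz.[k])%N.
  apply: (choices_dim r1 r3 x1y3 x3y1 c3t1 c1t3 P0 q1' x3_neq0 qP (bs := bs)) => c.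
  apply: bsP; have := sumn_choices D1' 0 c; rewrite size_tuple => cE.
  by rewrite /k -cE; apply: deg_xprod.
have kB : (k.+1 <= B * q.+1 ^ 3)%N.
  have := cdeg_le D1' 0 q; rewrite /k /B add0n => cle.
  have DB : (D1' <= 12 * b * q.+1)%N by nia.
  have : (q * (2 + (24 * q + 15) * D1') <= q.+1 * (2 * q.+1 + 39 * q.+1 * (12 * b * q.+1)))%N.
    by apply: leq_mul => //; apply: leq_add; [lia | apply: leq_mul => //; lia].
  have : (q.+1 ^ 3 = q.+1 * (q.+1 * q.+1))%N by [].
  move=> -> cle'.
  have le3 : (q.+1 <= q.+1 * (q.+1 * q.+1))%N by rewrite leq_pmulr.
  have le2 : (q.+1 * q.+1 <= q.+1 * (q.+1 * q.+1))%N by rewrite leq_mul2l leq_pmulr // orbT.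
  nia.
have : (pz.[k] <= K * (B * q.+1 ^ 3) ^ e)%N.
  apply: leq_trans (pK k) _; rewrite leq_mul2l; apply/orP; right.
  move: kB; move: (k.+1) (B * q.+1 ^ 3)%N => u v uv.
  by elim: (e) => // e' IHe; rewrite !expnS leq_mul.
rewrite expnMn mulnA -expnM => le'.
by have := Hs q s0q; rewrite ltnNge (leq_trans le le').
Qed.

End Doubling.
End RootPairs.

(* Here j - k is coupled, i - j and i - k are not, and A, A', ... are minus the
   Cartan integers of the triangle; e and e' are square roots of A A' and B B'. *)
Lemma triangle_relations (C : numFieldType)
    (xij xji xik xki xjk xkj yij yji yik yki A A' B B' D D' : C) :
  yij != 0 -> yik != 0 -> xjk != 0 -> A != 0 -> B != 0 -> D != 0 ->
  yji * 2 = yij * - A' + xij * (xji * yji) ->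
  yij * 2 = yji * - A + xji * (xij * yij) ->
  yki * 2 = yik * - B' + xik * (xki * yki) ->
  yik * 2 = yki * - B + xki * (xik * yik) ->
  xjk * yik = - D * yij -> xkj * yij = - D' * yik ->
  yji * - B + xji * (xik * yik) = yij * - D ->
  yki * - A + xki * (xij * yij) = yik * - D' ->
  xkj * (xji * yji) = xjk * (xki * yki) ->
  exists e e' : C, [/\ e ^+ 2 = A * A', e' ^+ 2 = B * B',
    (D * D' - 4) * (e + e' - 2) = 0
    & D * D' - 4 + e' * (2 + D * A / B) + e * (2 + B * D' / A) = 0].
Proof.
move=> y0 yk0 x0 A0 B0 D0 H1 H1' H2 H2' H3 H3' H4 H5 H6.
(* [H1] and [H1'] become [e yji = - A' yij] and [A yji = - e yij], whence [e ^+ 2 = A A']; likewise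
   for [e']. *)
pose e := 2 - xij * xji; pose e' := 2 - xik * xki; exists e, e'.
have E1 : e * yji = - A' * yij.
  transitivity (yji * 2 - xij * (xji * yji)); first by rewrite /e; ring.
  by rewrite H1; ring.
have E1' : A * yji = - e * yij.
  transitivity (xji * (xij * yij) - yij * 2); last by rewrite /e; ring.
  by rewrite H1'; ring.
have E2 : e' * yki = - B' * yik.
  transitivity (yki * 2 - xik * (xki * yki)); first by rewrite /e'; ring.
  by rewrite H2; ring.
have E2' : B * yki = - e' * yik.
  transitivity (xki * (xik * yik) - yik * 2); last by rewrite /e'; ring.
  by rewrite H2'; ring.
have yjiE : yji = - e * yij / A by rewrite -E1' mulrAC mulfV // mul1r.
have ykiE : yki = - e' * yik / B by rewrite -E2' mulrAC mulfV // mul1r.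
have yikE : yik = - D * yij / xjk by rewrite -H3 mulrAC mulfV // mul1r.
have e2 : e ^+ 2 = A * A'.
  apply: (mulIf y0); transitivity (- A * (e * yji)); last by rewrite E1; ring.
  by rewrite yjiE; field.
have e2' : e' ^+ 2 = B * B'.
  apply: (mulIf yk0); transitivity (- B * (e' * yki)); last by rewrite E2; ring.
  by rewrite ykiE; field.
have xkjE : xkj = D * D' / xjk.
  by apply: (mulIf y0); rewrite H3' yikE; field.
have uE : xji * xik = xjk * (1 + e * B / (A * D)).
  apply: (mulIf yk0); transitivity (yji * B - yij * D).
    transitivity (yji * - B + xji * (xik * yik) + yji * B); first by ring.
    by rewrite H4; ring.
  by rewrite yjiE yikE; field; rewrite ?x0 ?A0 ?D0.
have vE : xki * xij = D / xjk * (D' + e' * A / B).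
  apply: (mulIf y0); transitivity (yki * A - yik * D').
    transitivity (yki * - A + xki * (xij * yij) + yki * A); first by ring.
    by rewrite H5; ring.
  by rewrite ykiE yikE; field; rewrite ?x0 ?B0.
(* The product of the left sides of [uE] and [vE], regrouped as
   [(xij xji) (xik xki) = (2 - e) (2 - e')]. *)
have UV : D * D' - 4 + e' * (2 + D * A / B) + e * (2 + B * D' / A) = 0.
  transitivity ((xji * xik) * (xki * xij) - (2 - e) * (2 - e')); last by rewrite /e /e'; ring.
  by rewrite uE vE; field; rewrite ?x0 ?A0 ?B0 ?D0.
have nz : yij / A != 0 by rewrite mulf_neq0 // invr_neq0.
have nz' : yij * D / (B * xjk) != 0 by rewrite !mulf_neq0 // invr_neq0 // mulf_neq0.
(* [H6] times [xik]; multiplying by [xij] instead gives [C2]. *)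
have C1 : D * D' * e + 2 * (A * D / B) * e' = A * D * B' - A' * B * D'.
  have : xkj * (xji * xik) * yji - xjk * (2 - e') * yki = 0.
    transitivity ((xkj * (xji * yji)) * xik - xjk * (2 - e') * yki); first by ring.
    by rewrite H6 /e'; ring.
  rewrite xkjE uE yjiE ykiE yikE => E.
  suff : D * D' * e + D' * B / A * e ^+ 2 + 2 * (A * D / B) * e' - A * D / B * e' ^+ 2 = 0.
    rewrite e2 e2' => F; apply/eqP; rewrite -subr_eq0 -[X in _ == X]F; apply/eqP.
    by field; rewrite ?A0 ?B0.
  apply: (mulIf nz); rewrite mul0r -[RHS]oppr0 -[in RHS]E.
  by field; rewrite ?x0 ?A0 ?B0 ?D0.
have C2 : D * D' * e' + 2 * (B * D' / A) * e = B * D' * A' - B' * A * D.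
  have : xkj * (2 - e) * yji - xjk * (xki * xij) * yki = 0.
    transitivity ((xkj * (xji * yji)) * xij - xjk * (xki * xij) * yki).
      by rewrite /e; ring.
    by rewrite H6; ring.
  rewrite xkjE vE yjiE ykiE yikE => E.
  suff : D * D' * e' + D * A / B * e' ^+ 2 + 2 * (B * D' / A) * e - B * D' / A * e ^+ 2 = 0.
    rewrite e2 e2' => F; apply/eqP; rewrite -subr_eq0 -[X in _ == X]F; apply/eqP.
    by field; rewrite ?A0 ?B0.
  apply: (mulIf nz'); rewrite mul0r -[RHS]oppr0 -[in RHS]E.
  by field; rewrite ?x0 ?A0 ?B0 ?D0.
(* The right sides of [C1] and [C2] cancel in their sum; subtracting twice [UV] leaves the factored
   form. *)
split=> //; transitivity ((D * D' * e + 2 * (A * D / B) * e' - (A * D * B' - A' * B * D'))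
  + (D * D' * e' + 2 * (B * D' / A) * e - (B * D' * A' - B' * A * D))
  - 2 * (D * D' - 4 + e' * (2 + D * A / B) + e * (2 + B * D' / A))).
  by field; rewrite ?A0 ?B0.
by rewrite C1 C2 UV; ring.
Qed.

(** As [d d' < 4], [e + e' = 2], so $4e = 4 + aa' - bb'$ is an integer with square $16 aa'$. In the
    range 1 to 3 this leaves $aa' = bb' = 1$ and $e = 1$, and the last relation becomes $dd' + d +
    d' = 0$. *)
Lemma triangle_absurd (C : numFieldType) (e e' : C) (a a' b b' d d' : nat) :
  (0 < a)%N -> (0 < a')%N -> (0 < b)%N -> (0 < b')%N -> (0 < d)%N -> (0 < d')%N ->
  (a * a' < 4)%N -> (b * b' < 4)%N -> (d * d' < 4)%N ->
  e ^+ 2 = a%:R * a'%:R -> e' ^+ 2 = b%:R * b'%:R ->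
  (d%:R * d'%:R - 4) * (e + e' - 2) = 0 ->
  d%:R * d'%:R - 4 + e' * (2 + d%:R * a%:R / b%:R) + e * (2 + b%:R * d'%:R / a%:R) = 0 ->
  False.
Proof.
move=> a0 a'0 b0 b'0 d0 d'0 aa bb dd e2 e2' F1 F2.
have ee : e' = 2 - e.
  move/eqP: F1; rewrite mulf_eq0 -natrM subr_eq0 eqr_nat => /orP[/eqP dd4|/eqP ee0].
    by rewrite dd4 in dd.
  by transitivity (e + e' - 2 + (2 - e)); [ring | rewrite ee0 add0r].
have e4 : 4 * e = (4 + a * a' - b * b')%:R.
  rewrite natrB ?natrD ?natrM; last by lia.
  by rewrite -e2 -e2' ee; ring.
have sq : (16 * (a * a') = (4 + a * a' - b * b') * (4 + a * a' - b * b'))%N.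
  apply/eqP; rewrite -(eqr_nat C) [X in _ == X]natrM -e4 natrM natrM -e2; apply/eqP; ring.
have [aa1 bb1] : (a * a' = 1 /\ b * b' = 1)%N.
  have : (0 < a * a')%N by rewrite muln_gt0 a0.
  have : (0 < b * b')%N by rewrite muln_gt0 b0.
  move: (a * a')%N (b * b')%N aa bb sq => p r.
  by case: p => [|[|[|[|p]]]] //; case: r => [|[|[|[|r]]]].
have a1 : a = 1%N by apply/eqP; rewrite -dvdn1 -aa1 dvdn_mulr.
have b1 : b = 1%N by apply/eqP; rewrite -dvdn1 -bb1 dvdn_mulr.
have e1 : e = 1.
  have four0 : (4 : C) != 0 by rewrite pnatr_eq0.
  by apply: (mulfI four0); rewrite e4 aa1 bb1 mulr1.
have : (d * d' + d + d')%:R = 0 :> C.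
  by rewrite !natrD natrM -[RHS]F2 ee e1 a1 b1; field.
move/eqP; rewrite pnatr_eq0 !addn_eq0 => /andP[/andP[_ /eqP d00] _].
by rewrite d00 in d0.
Qed.

(** * Coupling *)

Section Coupling.
Variables (C : numClosedFieldType) (A : cartanDatum C) (G : generators A).
Notation h := (cd_h A).
Notation n := (cd_n A).
Hypotheses (qkm : QKM A) (ind : indecomposable A) (fg : finite_growth A).
Hypothesis two_roots : exists i j : 'I_n, i != j.

Notation nn i j := (alpha j (gh G i)).
Notation cc i j := (alpha j (gc G i)).
Notation X i j := (gX G i j).
Notation Y i j := (gY G i j).

Let km1 : KM1 A. Proof. by case: qkm. Qed.
Let km2 : KM2 A. Proof. by case: qkm. Qed.
Let km3 : KM3 A. Proof. by case: qkm. Qed.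
Let km4 : KM4 A. Proof. by case: qkm. Qed.

(** Otherwise [i] alone would split off, by KM2 and the existence of a second root. *)
Lemma some_unkilled (i : 'I_n) : exists k, ~ hroot_kills i k.
Proof.
have [i0 [j0 ij0]] := two_roots; apply: contrapT => nex.
have kill k : hroot_kills i k by apply: contrapT => nk; apply: nex; exists k.
apply: (ind (S := [set i])).
- by apply/set0Pn; exists i; rewrite inE.
- apply/eqP => iT; case/eqP: ij0.
  by have [/set1P -> /set1P ->] : i0 \in [set i] /\ j0 \in [set i] by rewrite iT !inE.
- by move=> i' j /set1P -> _; split; [apply: kill | apply/km2/kill].
Qed.

Let nk := some_unkilled.

Let nat_gh i j := @alpha_gh_nat C A G km1 km3 km4 nk i j.
Let gc_eq0 i j := @alpha_gc_eq0 C A G km1 km3 km4 nk i j.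
Let gh_eq0 i j := @alpha_gh_eq0 C A G km1 km3 km4 nk i j.
Let Ydiag i : Y i i = 0. Proof. exact: gY_diag km1 km3 km4 nk i. Qed.
Let nn_diag i : nn i i = X i i. Proof. exact: alpha_gh km3 km4 i. Qed.
Let cc_diag i : cc i i = 0. Proof. by rewrite (alpha_gc G km3 km4). Qed.
Let X_sl2 i : gtype G i = TakSL2 -> X i i = 2.
Proof. by case/(diag_sl2 km1 km3 km4 nk). Qed.
Let X_nat i : gtype G i <> TakSL11 -> exists2 m : nat, (0 < m)%N & X i i = m%:R.
Proof.
case tE: (gtype G i) => // _; first by exists 2%N; rewrite ?X_sl2.
by exists 1%N => //; case: (diag_osp km1 km3 km4 nk tE).
Qed.
Let relk i j k : Y j i * nn i k + X j i * cc i k = Y i j * nn j k + X i j * cc j k.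
Proof. exact: gH_comm_alpha. Qed.
Let rel_i i j : Y j i * X i i = Y i j * nn j i + X i j * cc j i.
Proof. by have := relk i j i; rewrite nn_diag cc_diag mulr0 addr0. Qed.
Let relH i j k : X i j * Y k j + Y i j * X k j = nn i j * Y k i + cc i j * X k i.
Proof. exact: fab_rel_gH. Qed.
(** The case [k = i] of [relH]; in type Tak(sl(2)) it reads $\alpha_j(c_i) = x_{ij} y_{ij}$. *)
Let XY i j : 2 * (X i j * Y i j) = cc i j * X i i.
Proof. by have := relH i j i; rewrite Ydiag mulr0 add0r => <-; ring. Qed.

Lemma connected_sym i j : connected G i j -> connected G j i.
Proof. by case=> ij n0; split; [rewrite eq_sym | rewrite mulrC]. Qed.
Lemma coupled_sym i j : coupled G i j -> coupled G j i.
Proof. by case=> /connected_sym. Qed.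
Lemma connected_nn i j : connected G i j -> [/\ i != j, nn i j != 0 & nn j i != 0].
Proof. by case=> ij; rewrite mulf_eq0 negb_or => /andP[]. Qed.

(** One of the two Cartan integers vanishes. If it is the one of the pair [j], [i], KM2 carries the
    vanishing over to [i], [j]. *)
Lemma not_connected i j : i != j -> ~ connected G i j ->
  [/\ X i j = 0, Y i j = 0, nn i j = 0 & cc i j = 0].
Proof.
move=> ij ncon.
have zero k l : X k l = 0 /\ Y k l = 0 -> [/\ X k l = 0, Y k l = 0, nn k l = 0 & cc k l = 0].
  by case=> x0 y0; have [n0 c0] := gXY_alpha km3 km4 x0 y0.
have [n0|n0] := eqVneq (nn i j) 0; first exact/zero/gh_eq0.
have [n0'|n0'] := eqVneq (nn j i) 0; last by case: ncon; split=> //; rewrite mulf_neq0.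
apply: zero; apply/(gXY_kills G km3 km4)/km2/(gXY_kills G km3 km4).
by apply: gh_eq0; rewrite // eq_sym.
Qed.

Lemma not_connected_kills i j : i != j -> ~ connected G i j ->
  hroot_kills i j /\ hroot_kills j i.
Proof.
move=> ij ncon; have [x0 y0 _ _] := not_connected ij ncon.
have kij : hroot_kills i j by apply/(gXY_kills G km3 km4).
by split=> //; apply: km2.
Qed.

Lemma connected_nat i j : gtype G i <> TakSL11 -> connected G i j ->
  exists2 m : nat, (0 < m)%N & nn i j = - m%:R.
Proof.
move=> ti /connected_nn[ij n0 _]; have [m mE] := nat_gh ti ij; exists m => //.
by rewrite lt0n; apply: contra_neq n0 => m0; rewrite mE m0 oppr0.
Qed.

(** $\alpha_i$ has type Tak(sl(2)), and [XY] gives $y_{ij} \ne 0$. If $y_{ji} = 0$, then also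
    $\alpha_i(c_j) = 0$, and [rel_i] reduces to $y_{ij} \alpha_i(h_j) = 0$. *)
Lemma uncoupled_edge1 i j : connected G i j -> cc i j != 0 ->
  [/\ Y i j != 0, Y j i != 0, gtype G i <> TakSL11 & gtype G j <> TakSL11].
Proof.
move=> con c0; have [ij n0 n0'] := connected_nn con.
have ti : gtype G i = TakSL2.
  by apply: contrapT => /gc_eq0/(_ ij) /eqP; rewrite (negbTE c0).
have two0 : (2 : C) != 0 by rewrite pnatr_eq0.
have y0 : Y i j != 0.
  apply: contra_neq c0 => y0; have := XY i j; rewrite y0 !mulr0 X_sl2 // => /esym/eqP.
  by rewrite mulf_eq0 (negbTE two0) orbF => /eqP.
have cj : gtype G j <> TakSL2 -> cc j i = 0 by move/gc_eq0; apply; rewrite eq_sym.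
have Yji0 : Y j i != 0.
  apply/negP => /eqP y0'; have c0' : cc j i = 0.
    case tj: (gtype G j); try (by apply: cj; rewrite tj).
    have := XY j i; rewrite y0' !mulr0 X_sl2 // => /esym/eqP.
    by rewrite mulf_eq0 (negbTE two0) orbF => /eqP.
  have := rel_i i j; rewrite y0' c0' mul0r mulr0 addr0 => /esym/eqP.
  by rewrite mulf_eq0 (negbTE y0) (negbTE n0').
split=> //; rewrite ?ti // => tj.
have c0' : cc j i = 0 by apply: cj; rewrite tj.
have xjj : X j j = 0 by case: (diag_sl11 km3 km4 nk tj).
have x0 : X j i = 0.
  have := XY j i; rewrite c0' mul0r => /eqP; rewrite !mulf_eq0 (negbTE two0).
  by rewrite (negbTE Yji0) orbF => /eqP.
have := relk i j j; rewrite x0 mul0r addr0 nn_diag xjj cc_diag !mulr0 addr0 => /eqP.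
by rewrite mulf_eq0 (negbTE Yji0) (negbTE n0).
Qed.

Lemma uncoupled_edge i j : connected G i j -> ~ coupled G i j ->
  [/\ Y i j != 0, Y j i != 0, gtype G i <> TakSL11 & gtype G j <> TakSL11].
Proof.
move=> con nc; have [c0|c0] := eqVneq (cc i j) 0; last exact: uncoupled_edge1.
have [c0'|c0'] := eqVneq (cc j i) 0; first by case: nc.
by have [] := uncoupled_edge1 (connected_sym con) c0'.
Qed.

Lemma coupled_all i j : coupled G i j -> Y i j != 0 -> forall k, k = i \/ k = j.
Proof.
move=> cij y0; have [con c0' c0] := cij; have [ij n0 n0'] := connected_nn con.
have two0 : (2 : C) != 0 by rewrite pnatr_eq0.
have E1 := rel_i i j; rewrite c0' mulr0 addr0 in E1.
have E2 := rel_i j i; rewrite c0 mulr0 addr0 in E2.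
have : Y i j * nn j i != 0 by rewrite mulf_neq0.
rewrite -E1 mulf_eq0 negb_or => /andP[y0' xii].
have xjj : X j j != 0.
  have : Y j i * nn i j != 0 by rewrite mulf_neq0.
  by rewrite -E2 mulf_eq0 negb_or => /andP[].
have ti : gtype G i <> TakSL11.
  by move=> ti; case: (diag_sl11 km3 km4 nk ti) => x0 _; rewrite x0 eqxx in xii.
have tj : gtype G j <> TakSL11.
  by move=> tj; case: (diag_sl11 km3 km4 nk tj) => x0 _; rewrite x0 eqxx in xjj.
have x0 : X i j = 0.
  have := XY i j; rewrite c0 mul0r => /eqP; rewrite !mulf_eq0 (negbTE two0).
  by rewrite (negbTE y0) orbF => /eqP.
have x0' : X j i = 0.
  have := XY j i; rewrite c0' mul0r => /eqP; rewrite !mulf_eq0 (negbTE two0).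
  by rewrite (negbTE y0') orbF => /eqP.
have [r r0 rE] := connected_nat tj (connected_sym con).
have [xi xi0 xiE] := X_nat ti.
have iso k : k != i -> k != j -> nn i k = 0 /\ nn j k = 0.
  move=> ki kj; have [m mE] : exists m : nat, nn i k = - m%:R by apply: nat_gh; rewrite // eq_sym.
  have [m' mE'] : exists m : nat, nn j k = - m%:R by apply: nat_gh; rewrite // eq_sym.
  have := relk i j k; rewrite x0 x0' !mul0r !addr0 mE mE' => Ek.
  (* $y_{ji} h_i = y_{ij} h_j$ evaluated at $\alpha_k$, with $y_{ji}$ eliminated by [E1]. All
     summands are natural numbers, and [r], [xi] are positive, so both values vanish. *)
  have : Y i j * (r * m + m' * xi)%:R = 0.
    rewrite natrD !natrM; transitivity
      (- (Y i j * - r%:R) * m%:R + Y i j * m'%:R * xi%:R); first by ring.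
    rewrite -rE -E1 xiE; transitivity
      ((- (Y i j * - m'%:R) + Y j i * - m%:R) * xi%:R); first by ring.
    by rewrite Ek addNr mul0r.
  move/eqP; rewrite mulf_eq0 (negbTE y0) pnatr_eq0 addn_eq0 !muln_eq0.
  rewrite -(prednK r0) -(prednK xi0) /= orbF => /andP[/eqP-> /eqP->].
  by rewrite oppr0.
move=> k; apply: contrapT => nk'.
have ki : k != i by apply/eqP => ki; apply: nk'; left.
have kj : k != j by apply/eqP => kj; apply: nk'; right.
apply: (ind (S := [set i; j])).
- by apply/set0Pn; exists i; rewrite !inE eqxx.
- apply/eqP => ST; have : k \in [set i; j] by rewrite ST inE.
  by rewrite !inE (negbTE ki) (negbTE kj).
- move=> i' l; rewrite !inE negb_or => /orP[] /eqP -> /andP[li lj];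
    have [ni nj] := iso l li lj; apply: not_connected_kills; rewrite 1?eq_sym //;
    by case/connected_nn=> _ /eqP.
Qed.

Notation kH x := (gK_gen (GH x) : gKM A).
Notation kP v := (gK_gen (GP v) : gKM A).
Notation kM v := (gK_gen (GM v) : gKM A).

Definition torus (t : h) : gKM A := kH (part false t).

Lemma simple_rootpair i : gtype G i = TakSL2 ->
  rootpair torus (alpha i) (gh G i) (kP (ge G i)) (kM (gf G i)).
Proof.
move=> ti; split.
- by move=> a s t; rewrite linearP.
- by have := ge_part G i; rewrite ti -kP_part /= => ->.
- by have := gf_part G i; rewrite ti -kM_part /= => ->.
- by move=> t; rewrite /torus kHP gpos_wt kPZ.
- by move=> t; rewrite /torus kHM gneg_wt kMZ.
- by rewrite kPM /torus gh_part.
- by rewrite nn_diag X_sl2.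
Qed.

(** The even generators of the three roots start the iteration in degree one; connectedness to
    $\alpha_k$ makes all its initial integers positive. *)
Lemma triangle_bound i j k : gtype G i = TakSL2 -> gtype G j = TakSL2 ->
  gtype G k = TakSL2 -> connected G i j -> connected G i k -> connected G j k ->
  forall a b : nat, nn i j = - a%:R -> nn j i = - b%:R -> (a * b < 4)%N.
Proof.
move=> ti tj tk cij cik cjk a b aE bE; rewrite ltnNge; apply/negP => ab.
have nsl11 l : gtype G l = TakSL2 -> gtype G l <> TakSL11 by move=> ->.
have [P1 p1 P1E] := connected_nat (nsl11 _ ti) cik.
have [P2 p2 P2E] := connected_nat (nsl11 _ tj) cjk.
have [Q1 q1 Q1E] := connected_nat (nsl11 _ tk) (connected_sym cik).
have [Q2 q2 Q2E] := connected_nat (nsl11 _ tk) (connected_sym cjk).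
have [ij _ _] := connected_nn cij; have [ik _ _] := connected_nn cik.
have [jk _ _] := connected_nn cjk.
have [pz pzP] := fg.
have tlin a' s t : torus (a' *: s + t) = a' *: torus s + torus t.
  by rewrite /torus partD partZ kH_lin.
have teven t : part false (torus t) = torus t by rewrite /torus -kH_part part_part.
pose deg (m : nat) (z : gKM A) := gdeg (Posz m) z.
have deg_brk m l x y : deg m x -> deg l y -> deg (m + l)%N (brk x y).
  by move=> dx dy; rewrite /deg PoszD; apply: gdeg_brk.
apply: (@growth_contradiction C h (gKM A) torus tlin teven deg deg_brk (alpha k) (gh G k)
  (kP (ge G k)) (kM (gf G k)) (simple_rootpair tk)
  (kP_neq0 G km3 km4 nk (ge_neq0 G k)) (gdeg_p (ge G k)) a b P1 P2 Q1 Q2 pz ab p1 p2 q1 q2).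
  exists (alpha i), (alpha j), (gh G i), (gh G j), (kP (ge G i)), (kM (gf G i)),
    (kP (ge G j)), (kM (gf G j)).
  split.
  - by split; [exact: simple_rootpair | exact: simple_rootpair | apply: kPM0
      | apply: kPM0; rewrite eq_sym].
  - by split; apply: kPM0; rewrite // eq_sym.
  - by [].
  - by [].
  - by split; apply: gdeg_p.
move=> m; have [bs bsP] := pzP (Posz m); exists bs => x; exact: bsP.
Qed.

Lemma uncoupled_coupled_absurd i j k :
  connected G i j -> ~ coupled G i j -> coupled G j k ->
  (forall i j, coupled G i j -> Y i j = 0) -> False.
Proof.
move=> cij ncij cjk Y0; have [conjk cckj ccjk] := cjk.
have [ij nij nji] := connected_nn cij; have [jk njk nkj] := connected_nn conjk.
have ik : i != k by apply/eqP => ik; apply: ncij; rewrite ik; apply: coupled_sym.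
have [yij yji ti tj] := uncoupled_edge cij ncij.
have yjk : Y j k = 0 by apply: Y0.
have ykj : Y k j = 0 by apply/Y0/coupled_sym.
have X_neq0 l m : Y l m = 0 -> nn l m != 0 -> X l m != 0.
  by move=> y0; apply: contra_neq => x0; case: (gXY_alpha km3 km4 x0 y0).
have xjk := X_neq0 j k yjk njk; have xkj := X_neq0 k j ykj nkj.
have R1 := relk i j k; rewrite ccjk mulr0 addr0 in R1.
(* Without the edge [i - k], [R1] would leave only $y_{ij} \alpha_k(h_j) = 0$. *)
have [conik|nik] := pselect (connected G i k); last first.
  have [_ _ n0 c0] := not_connected ik nik.
  by move/esym/eqP: R1; rewrite n0 c0 !mulr0 addr0 mulf_eq0 (negbTE yij) (negbTE njk).
have [_ nik nki] := connected_nn conik.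
have R6 := relk j k i; rewrite yjk ykj !mul0r !add0r in R6.
have c_eq0 : cc j i = 0 <-> cc k i = 0.
  split=> c0.
    by move/esym/eqP: R6; rewrite c0 mulr0 mulf_eq0 (negbTE xjk) => /eqP.
  by move/eqP: R6; rewrite c0 mulr0 mulf_eq0 (negbTE xkj) => /eqP.
(* With [i - k] coupled, [c_eq0] gives $\alpha_i(c_j) = 0$ and $[H_i, H_k]$ at $\alpha_j$ gives
   $\alpha_j(c_i) = 0$, so [i - j] would be coupled. *)
have [cik|ncik] := pselect (coupled G i k).
  have [_ ccki ccik] := cik; apply: ncij; split=> //; first exact/c_eq0.
  have yik : Y i k = 0 by apply: Y0.
  have yki : Y k i = 0 by apply/Y0/coupled_sym.
  have := relk i k j; rewrite yik yki !mul0r !add0r cckj mulr0 => /eqP.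
  by rewrite mulf_eq0 (negbTE (X_neq0 k i yki nki)) => /eqP.
have [yik yki _ tk] := uncoupled_edge conik ncik.
have two0 : (2 : C) != 0 by rewrite pnatr_eq0.
have [a' a'0 a'E] := connected_nat tj (connected_sym cij).
have [b b0 bE] := connected_nat ti conik.
have [d d0 dE] := connected_nat tj conjk.
(* Without these terms $y_{ji} / y_{ij}$ would be negative by [rel_i] and positive by [R1].
   Therefore the values on the $c$'s must contribute, which forces type Tak(sl(2)) at all three
   roots. *)
have no_mixing : X i j * cc j i = 0 -> X j i * cc i k = 0 -> False.
  move=> z1 z2; have [xi xi0 xiE] := X_nat ti.
  have E1 := rel_i i j; rewrite z1 addr0 xiE a'E in E1.
  move: R1; rewrite z2 addr0 bE dE => E2.
  have : Y i j * (a' * b + d * xi)%:R = 0.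
    rewrite natrD !natrM; transitivity
      (- (Y i j * - a'%:R) * b%:R - (Y i j * - d%:R) * xi%:R); first by ring.
    by rewrite -E1 -E2; ring.
  move/eqP; rewrite mulf_eq0 (negbTE yij) pnatr_eq0 addn_eq0 !muln_eq0.
  by rewrite -(prednK a'0) -(prednK b0).
have XY0 l m : cc l m = 0 -> Y l m != 0 -> X l m = 0.
  move=> c0 y0; have := XY l m; rewrite c0 mul0r => /eqP.
  by rewrite !mulf_eq0 (negbTE two0) (negbTE y0) orbF => /eqP.
have si : gtype G i = TakSL2.
  apply: contrapT => nsi; apply: no_mixing; last by rewrite (gc_eq0 nsi ik) mulr0.
  by rewrite (XY0 i j (gc_eq0 nsi ij) yij) mul0r.
have cji : cc j i != 0.
  by apply/eqP => c0; apply: no_mixing; rewrite ?(XY0 j i c0 yji) ?c0 ?mulr0 ?mul0r.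
have cki : cc k i != 0 by apply: contra_neq cji => /c_eq0.
have sj : gtype G j = TakSL2.
  by apply: contrapT => nsj; case/eqP: cji; apply: gc_eq0; rewrite // eq_sym.
have sk : gtype G k = TakSL2.
  by apply: contrapT => nsk; case/eqP: cki; apply: gc_eq0; rewrite // eq_sym.
have ccE l m : gtype G l = TakSL2 -> cc l m = X l m * Y l m.
  move=> sl; apply: (mulIf two0); rewrite -{1}(X_sl2 sl) -XY; ring.
have [a a0 aE] := connected_nat ti cij.
have [b' b'0 b'E] := connected_nat tk (connected_sym conik).
have [d' d'0 d'E] := connected_nat tk (connected_sym conjk).
have nz (m : nat) : (0 < m)%N -> m%:R != 0 :> C by rewrite pnatr_eq0 -lt0n.
have [||||||||| e [e' [e2 e2' F1 F2]]] := @triangle_relations C (X i j) (X j i) (X i k)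
  (X k i) (X j k) (X k j) (Y i j) (Y j i) (Y i k) (Y k i) a%:R a'%:R b%:R b'%:R d%:R d'%:R
  yij yik xjk (nz _ a0) (nz _ b0) (nz _ d0).
- by rewrite -a'E -ccE // -(X_sl2 si) rel_i.
- by rewrite -aE -ccE // -(X_sl2 sj) rel_i.
- by rewrite -b'E -ccE // -(X_sl2 si) rel_i.
- by rewrite -bE -ccE // -(X_sl2 sk) rel_i.
- by have := relH j k i; rewrite yjk ccjk !mul0r !addr0 dE.
- by have := relH k j i; rewrite ykj cckj !mul0r !addr0 d'E.
- by rewrite -bE -ccE // R1 dE.
- by have := relk i k j; rewrite cckj mulr0 addr0 aE d'E ccE.
- by rewrite -!ccE.
(* The growth bound is applied to each edge, the opposite vertex being the third root. *)
apply: (triangle_absurd a0 a'0 b0 b'0 d0 d'0 _ _ _ e2 e2' F1 F2).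
- exact: (triangle_bound si sj sk cij conik conjk aE a'E).
- exact: (triangle_bound si sk sj conik cij (connected_sym conjk) bE b'E).
- exact: (triangle_bound sj sk si conjk (connected_sym cij) (connected_sym conik) dE d'E).
Qed.

Lemma trichotomy :
  completely_X_coupled G \/ completely_Y_coupled G \/ completely_uncoupled G.
Proof.
have [[i [j [cij y0]]]|noY] := pselect (exists i j, coupled G i j /\ Y i j != 0).
  left; have [[ij _] c1 c2] := cij; have all_ij := coupled_all cij y0.
  have two0 : (2 : C) != 0 by rewrite pnatr_eq0.
  have XY0 l m : cc l m = 0 -> Y l m != 0 -> X l m = 0.
    move=> c0 ylm; have := XY l m; rewrite c0 mul0r => /eqP.
    by rewrite !mulf_eq0 (negbTE two0) (negbTE ylm) orbF => /eqP.
  have xij : X i j = 0 by apply: XY0.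
  have xji : X j i = 0.
    apply: XY0 => //; apply: contra_neq y0 => yji.
    have := rel_i i j; rewrite yji c1 mul0r mulr0 addr0 => /esym/eqP.
    by case: cij => /connected_nn[_ _ /negbTE nji] _ _; rewrite mulf_eq0 nji orbF => /eqP.
  move=> k l kl; have [kE|kE] := all_ij k; have [lE|lE] := all_ij l;
    by move: kl; rewrite kE lE ?eqxx.
have Y0 i j : coupled G i j -> Y i j = 0.
  by move=> cij; apply/eqP/negPn/negP => y0; apply: noY; exists i, j.
right; have [[i [j [cij ncij]]]|noU] :=
    pselect (exists i j, connected G i j /\ ~ coupled G i j); last first.
  left; apply/matrixP => i j; rewrite mxE.
  have [->|ij] := eqVneq i j; first exact: Ydiag.
  have [con|ncon] := pselect (connected G i j); last by case: (not_connected ij ncon).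
  by apply: Y0; apply: contrapT => nc; apply: noU; exists i, j.
right=> k l _ ckl.
(* The ends of uncoupled edges. By [uS] no coupled edge touches [S], and an edge leaving [S] would
   have to be coupled, so indecomposability makes [S] everything. *)
pose S : {set 'I_n} := [set u | `[< exists v, connected G v u /\ ~ coupled G v u >]].
have uS u v : u \in S -> coupled G u v -> False.
  by rewrite inE => /asboolP[w [cw ncw]] cuv; apply: (uncoupled_coupled_absurd cw ncw cuv Y0).
have [ST|ST] := eqVneq S [set: 'I_n].
  by apply: (uS k l _ ckl); rewrite ST inE.
apply: (ind _ ST).
  by apply/set0Pn; exists j; rewrite inE; apply/asboolP; exists i.
move=> u v uinS vS; have uv : u != v by apply/eqP => uv; rewrite -uv uinS in vS.
apply: not_connected_kills => // con; have [cuv|ncuv] := pselect (coupled G u v).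
  exact: uS uinS cuv.
by case/negP: vS; rewrite inE; apply/asboolP; exists u.
Qed.

End Coupling.

Theorem theorem1p1 (R : realType) (A : cartanDatum R[i]) :
  QKM A -> indecomposable A -> finite_growth A ->
  forall G : generators A,
    completely_X_coupled G \/ completely_Y_coupled G \/ completely_uncoupled G.
Proof.
move=> qkm ind fg G.
have [two|one] := pselect (exists i j : 'I_(cd_n A), i != j).
  exact: (trichotomy G qkm ind fg two).
(* With at most one simple root the first alternative is vacuous. *)
by left=> i j ij; case: one; exists i, j.
Qed.
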